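(* Let $b\in(0,1)$, $L>R\ge0$ and $T\ge1$. Consider the ASEP with jump rates $L,R$ in which, at time $0$, a second class particle sits at the origin and every other site is occupied by a (first class) particle independently with probability $b$. Let $Q(t)$ denote the position of the second class particle at time $t$, and let $x_0:=(L-R)(2b-1)T$. Then there are constants $C,c>0$ such that for $0\le u\le T(L-R)$, $$\mathbb{P}\big[|Q(T)-x_0|>u\big]\le C\mathrm{e}^{-cu^3(T(L-R))^{-2}}.$$
   Context: ASEP: particles on $\mathbb{Z}$, at most one per site. Each site carries two independent exponential clocks of rates $R$ (right jumps) and $L$ (left jumps); when a clock rings at a site occupied by a first class particle, it jumps to the corresponding neighbor if that site is empty, and if the neighbor is occupied by the second class particle the two swap positions; if the neighbor holds a first class particle nothing happens. When a clock rings at the site of the second class particle, it jumps to the corresponding neighbor only if that site is empty (of both first and second class particles). Equivalently, the second class particle is the single discrepancy between two ASEPs, started from ordered initial configurations differing only at the origin, driven by the same clocks. *)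

(* Defs.v *)
From HB Require Import structures.
From mathcomp Require Import all_boot all_order all_algebra.
From mathcomp Require Import all_classical all_reals all_analysis.
Set Implicit Arguments. Unset Strict Implicit. Unset Printing Implicit Defensive.
Import Order.TTheory GRing.Theory Num.Theory.
Local Open Scope classical_set_scope.
Local Open Scope ring_scope.

(* Index set of the driving randomness:
   inl x        : the initial occupation variable of site x (x <> 0 used),
   inr (x,d,k)  : the k-th standard Exp(1) interarrival time of the clock at
                  site x in direction d (d = true : right, d = false : left). *)
Definition asep_index : Type := (int + (int * bool * nat))%type.

Section Defs.
Context {R : realType} {d : measure_display} {Omega : measurableType d}.

Definition mutually_independent {I : eqType} (P : probability Omega R)
    (X : I -> Omega -> R) : Prop :=
  (forall i, measurable_fun setT (X i)) /\
  forall (J : seq I), uniq J -> forall B : I -> set R,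
    (forall i, measurable (B i)) ->
    P (\bigcap_(i in [set` J]) (X i @^-1` B i)) =
    (\prod_(i <- J) P (X i @^-1` B i))%E.

Definition bernoulli_rv (P : probability Omega R) (b : R) (X : Omega -> R) :=
  P [set w | X w = 1] = b%:E /\ P [set w | X w = 0] = (1 - b)%:E.

Definition std_exponential_rv (P : probability Omega R) (X : Omega -> R) :=
  forall t : R, 0 <= t -> P [set w | X w <= t] = (1 - expR (- t))%:E.

Definition asep_data (P : probability Omega R) (b : R)
    (Y : asep_index -> Omega -> R) : Prop :=
  mutually_independent P Y /\
  (forall x : int, x != 0 -> bernoulli_rv P b (Y (inl x))) /\
  (forall x dir k, std_exponential_rv P (Y (inr (x, dir, k)))).

(* initial occupation of site x (only meaningful for x <> 0) *)
Definition occ0 (Y : asep_index -> Omega -> R) (w : Omega) (x : int) : bool :=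
  Y (inl x) w == 1.

Definition clock_rate (rR rL : R) (dir : bool) : R := if dir then rR else rL.

(* k-th ring time (k = 0,1,...) of the clock (x,dir): a Poisson process of
   rate clock_rate built from the Exp(1) interarrival times. A clock of rate 0
   never rings. *)
Definition ring_time (rR rL : R) (Y : asep_index -> Omega -> R) (w : Omega)
    (x : int) (dir : bool) (k : nat) : R :=
  (\sum_(i < k.+1) Y (inr (x, dir, (i : nat))) w) / clock_rate rR rL dir.

Definition rings_at rR rL Y w x dir (t : R) : Prop :=
  0 < clock_rate rR rL dir /\ exists k, ring_time rR rL Y w x dir k = t.

Definition rings_in rR rL Y w x dir (s t : R) : Prop :=
  0 < clock_rate rR rL dir /\ exists k, s < ring_time rR rL Y w x dir k <= t.

Definition jump (a b : bool) : bool * bool :=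
  if a && ~~ b then (false, true) else (a, b).

Definition follows_asep (rR rL : R) (Y : asep_index -> Omega -> R) (w : Omega)
    (init : int -> bool) (eta : R -> int -> bool) : Prop :=
  eta 0 = init /\
  (forall (x : int) (s t : R), 0 <= s -> s <= t ->
     ~ rings_in rR rL Y w x true s t -> ~ rings_in rR rL Y w x false s t ->
     ~ rings_in rR rL Y w (x - 1) true s t ->
     ~ rings_in rR rL Y w (x + 1) false s t ->
     eta t x = eta s x) /\
  (forall (x : int) (t : R), rings_at rR rL Y w x true t ->
     exists s, 0 <= s < t /\
       (forall r, s <= r < t -> eta r x = eta s x /\ eta r (x + 1) = eta s (x + 1)) /\
       (eta t x, eta t (x + 1)) = jump (eta s x) (eta s (x + 1))) /\
  (forall (x : int) (t : R), rings_at rR rL Y w x false t ->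
     exists s, 0 <= s < t /\
       (forall r, s <= r < t -> eta r x = eta s x /\ eta r (x - 1) = eta s (x - 1)) /\
       (eta t x, eta t (x - 1)) = jump (eta s x) (eta s (x - 1))).

(* Q t w is the position at time t of the second class particle started at
   the origin: the unique discrepancy between two ASEPs driven by the same
   clocks, started from the initial configuration with the origin empty,
   resp. occupied.  Required almost surely, plus measurability of Q. *)
Definition second_class_process (P : probability Omega R) (rR rL : R)
    (Y : asep_index -> Omega -> R) (Q : R -> Omega -> int) : Prop :=
  (forall (t : R) (y : int), measurable [set w | Q t w = y]) /\
  {ae P, forall w,
    exists eta1 eta2 : R -> int -> bool,
      follows_asep rR rL Y w (fun y => if y == 0 then false else occ0 Y w y) eta1 /\
      follows_asep rR rL Y w (fun y => if y == 0 then true else occ0 Y w y) eta2 /\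
      forall t : R, 0 <= t -> forall y : int, eta1 t y != eta2 t y <-> y = Q t w}.

End Defs.

(* Main.v *)
(* Exchanging particles and holes (for the right tail) or reflecting the lattice (for the left
   one), one is left with the right tail of a second class particle in a density [lam] when the
   rate [r] of right jumps exceeds the rate [l] of left jumps.  This tail can only increase when
   the density left of the origin is lowered to [rho < lam].  Compare with the pair of ASEPs of
   density [rho] on the left, and of densities [lam' < rho] and [lam] on the right: the sum over
   its second class particles of [(l/r)^(number of second class particles to the left)] times
   the tail of that particle is invariant, so that the tail of the leftmost one is controlled by
   the number of second class particles up to the threshold, that is by the currents of the two
   ASEPs.  These obey an exact exponential identity: between reservoirs of densities [al] and
   [be], started from the product measure jumping from [al] to [be] at the origin, one
   exponential moment of the current is explicit.  Taking [lam - rho] and [rho - lam']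
   proportional to [u / T] gives the exponent [u^3 / T^2].
   All this is done for a discrete time chain in a finite box.  It applies to the graphical
   construction since bonds whose clocks do not ring before [T] isolate a finite block, and
   since the exponential waiting times, cut into short slots, produce at most one ring per slot
   outside of an event of small probability. *)

Require Import Defs.
From HB Require Import structures.
From mathcomp Require Import all_boot all_order all_algebra.
From mathcomp Require Import all_classical all_reals all_analysis.
From mathcomp Require Import zify ring lra.
Set Implicit Arguments. Unset Strict Implicit. Unset Printing Implicit Defensive.
Import Order.TTheory GRing.Theory Num.Theory.
Import numFieldNormedType.Exports.
Local Open Scope ring_scope.

(** * Second class particles in a finite box *)

(** The two ASEPs of the pair start with the same particles left of the origin, which makes the
    tagged particle their leftmost discrepancy; lowering the density there only speeds the tag up.
    This monotonicity fails for the coupling by common rings, under which two tags on one bond may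
    cross; pairing left rings of one system with right rings of the other repairs it, provided that
    right jumps dominate. In the invariant sum the leftmost particle has weight one and the weights
    decay geometrically, so it remains to find about [u ^ 2 / T] second class particles up to the
    threshold, a failure of which is a deviation of one of two currents. The current identity is
    exact because a factor [expR (- theta)] per crossing undoes the jump of density; the bond terms
    then telescope and cancel against the reservoirs. The exponent comes from a Chernoff function
    stationary at the middle density: a slope of order [u * eps] over a length [eps] of order
    [u / T]. The constants for the finite chain depend neither on the box nor on the time step; both
    are chosen last, to push the remaining errors below the bound itself. *)

Definition bond_op {R : realFieldType} {m : nat} (wR wL : R) {S : Type}
    (st : 'I_m -> bool -> S -> S) (V : S -> R) (s : S) : R :=
  (1 - m%:R * (wR + wL)) * V s +
  \sum_y (wR * V (st y true s) + wL * V (st y false s)).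

Section BondOp.
Context {R : realFieldType} (m : nat) (wR wL : R).
Hypotheses (wR0 : 0 <= wR) (wL0 : 0 <= wL) (wm : m%:R * (wR + wL) <= 1).

(** [iter n (bond_op wR wL st) V s] is the mean of [V] after [n] steps from [s]: a step chooses each
    bond with probability [wR] or [wL] according to the direction, and otherwise does nothing.
    Coupling two chains by the same choices is then a termwise comparison of sums, without any path
    space. *)
Lemma bond_op_le_rel S1 S2 (st1 : 'I_m -> bool -> S1 -> S1)
    (st2 : 'I_m -> bool -> S2 -> S2) (rel : S1 -> S2 -> Prop)
    (V1 : S1 -> R) (V2 : S2 -> R) n s1 s2 :
  (forall y d s1 s2, rel s1 s2 -> rel (st1 y d s1) (st2 y d s2)) ->
  (forall s1 s2, rel s1 s2 -> V1 s1 <= V2 s2) -> rel s1 s2 ->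
  iter n (bond_op wR wL st1) V1 s1 <= iter n (bond_op wR wL st2) V2 s2.
Proof.
move=> Hst HV; elim: n s1 s2 => [|n IH] s1 s2 r12 /=; first exact: HV.
apply: lerD; first by rewrite ler_wpM2l ?subr_ge0 ?IH.
by apply: ler_sum => y _; apply: lerD; rewrite ler_wpM2l ?IH//; exact: Hst.
Qed.

Lemma bond_op_le S (st : 'I_m -> bool -> S -> S) (V1 V2 : S -> R) n s :
  (forall s, V1 s <= V2 s) ->
  iter n (bond_op wR wL st) V1 s <= iter n (bond_op wR wL st) V2 s.
Proof.
move=> H; apply: (@bond_op_le_rel _ _ st st eq) => //.
  by move=> y d ? ? ->.
by move=> ? ? ->.
Qed.

Lemma iter_bond_op S (st : 'I_m -> bool -> S -> S) (V : S -> R) n s :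
  let W := iter n (bond_op wR wL st) V in
  iter n.+1 (bond_op wR wL st) V s =
  (1 - m%:R * (wR + wL)) * W s +
  \sum_y (wR * W (st y true s) + wL * W (st y false s)).
Proof. by []. Qed.

Lemma bond_op_add S (st : 'I_m -> bool -> S -> S) (V1 V2 : S -> R) n s :
  iter n (bond_op wR wL st) (fun s => V1 s + V2 s) s =
  iter n (bond_op wR wL st) V1 s + iter n (bond_op wR wL st) V2 s.
Proof.
elim: n s => [//|n IH] s; rewrite !iter_bond_op /= IH.
under eq_bigr do rewrite !IH.
rewrite mulrDr [RHS]addrACA -big_split /=; congr (_ + _).
by apply: eq_bigr => y _; rewrite !mulrDr addrACA.
Qed.

Lemma bond_op_scale S (st : 'I_m -> bool -> S -> S) (c : R) (V : S -> R) n s :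
  iter n (bond_op wR wL st) (fun s => c * V s) s =
  c * iter n (bond_op wR wL st) V s.
Proof.
elim: n s => [//|n IH] s; rewrite !iter_bond_op /= IH.
under eq_bigr do rewrite !IH.
rewrite [RHS]mulrDr mulr_sumr mulrCA; congr (_ + _).
by apply: eq_bigr => y _; rewrite mulrDr !(mulrCA c).
Qed.

Lemma bond_op_cst S (st : 'I_m -> bool -> S -> S) (c : R) n s :
  iter n (bond_op wR wL st) (fun=> c) s = c.
Proof.
elim: n s => [//|n IH] s; rewrite !iter_bond_op /= IH.
under eq_bigr do rewrite !IH.
rewrite sumr_const card_ord -mulr_natl; ring.
Qed.

Lemma bond_op_proj S1 S2 (st1 : 'I_m -> bool -> S1 -> S1)
    (st2 : 'I_m -> bool -> S2 -> S2) (f : S1 -> S2) (V : S2 -> R) n s :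
  (forall y d s, f (st1 y d s) = st2 y d (f s)) ->
  iter n (bond_op wR wL st1) (fun s => V (f s)) s =
  iter n (bond_op wR wL st2) V (f s).
Proof.
move=> Hf; elim: n s => [//|n IH] s; rewrite !iter_bond_op /= IH.
by congr (_ + _); apply: eq_bigr => y _; rewrite !IH !Hf.
Qed.

End BondOp.

Section Config.
Context {m : nat}.
Definition config := {ffun 'I_m.+1 -> bool}.
Definition lsite (y : 'I_m) : 'I_m.+1 := widen_ord (leqnSn m) y.
Definition rsite (y : 'I_m) : 'I_m.+1 := lift ord0 y.
Implicit Types (y : 'I_m) (d : bool) (c : config) (z a b : 'I_m.+1).

(** A ring sorts the two occupations of its bond, a right ring putting the larger one on the right.
    Written with [&&] and [||], the rule is visibly monotone in the configuration. *)
Definition hop y d c : config :=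
  [ffun z => if z == lsite y then
               if d then c (lsite y) && c (rsite y) else c (lsite y) || c (rsite y)
             else if z == rsite y then
               if d then c (lsite y) || c (rsite y) else c (lsite y) && c (rsite y)
             else c z].

(* A second class particle, counted as an occupied site of [c], is overtaken
   exactly when both sites of the bond are occupied. *)
Definition move y d c a : 'I_m.+1 :=
  if (a == lsite y) || (a == rsite y) then
    if (c (lsite y) && c (rsite y)) (+) d then rsite y else lsite y
  else a.

Definition tagged_step y d (s : config * 'I_m.+1) : config * 'I_m.+1 :=
  (hop y d s.1, move y d s.1 s.2).

Lemma lsite_rsite y : (lsite y == rsite y) = false.
Proof. by apply/eqP => /(congr1 val) /=; rewrite /bump /=; lia. Qed.
Lemma rsite_lsite y : (rsite y == lsite y) = false.
Proof. by rewrite eq_sym lsite_rsite. Qed.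
Lemma hopE y d c z : hop y d c z =
  if z == lsite y then
    if d then c (lsite y) && c (rsite y) else c (lsite y) || c (rsite y)
  else if z == rsite y then
    if d then c (lsite y) || c (rsite y) else c (lsite y) && c (rsite y)
  else c z.
Proof. by rewrite ffunE. Qed.

(** The second and third conditions together say that the first class particles of [s'] are among
    those of [s]: the inclusion survives the removal of each tag from its own configuration. *)
Definition slower (s s' : config * 'I_m.+1) : Prop :=
  [/\ (s.2 <= s'.2)%N, (forall z, s'.1 z -> s.1 z), (s'.1 s.2 -> s.2 = s'.2),
      s.1 s.2 & s'.1 s'.2].

(** The one situation in which common rings break the order: both tags on a bond that is full for
    [s] but not for [s']. A left ring then sends the tag of [s] to the right, since it is overtaken,
    and the tag of [s'] to the left. *)
Definition doubly_tagged y (s s' : config * 'I_m.+1) : bool :=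
  [&& s.1 (lsite y), s.1 (rsite y), (s.2 == lsite y) || (s.2 == rsite y),
      (s'.2 == lsite y) || (s'.2 == rsite y) &
      ~~ (s'.1 (lsite y) && s'.1 (rsite y))].

Variant site_spec y z : bool -> bool -> Type :=
  | SiteL of z = lsite y : site_spec y z true false
  | SiteR of z = rsite y : site_spec y z false true
  | SiteO of (z == lsite y) = false & (z == rsite y) = false
          & z != y :> nat & z != y.+1 :> nat : site_spec y z false false.

Lemma siteP y z : site_spec y z (z == lsite y) (z == rsite y).
Proof.
have [->|zl] := eqVneq z (lsite y); first by rewrite lsite_rsite; constructor.
have [->|zr] := eqVneq z (rsite y); first by constructor.
by constructor; rewrite ?(negbTE zl) ?(negbTE zr)//; move: zl zr; rewrite -!val_eqE.
Qed.

Lemma move_occupied y d c a : c a -> hop y d c (move y d c a).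
Proof.
move=> ca; have lr := lsite_rsite y; have rl := rsite_lsite y.
rewrite hopE /move; case: (siteP y a) ca => [->|->|a1 a2 _ _] /= ca.
- rewrite ca /=; case cr : (c (rsite y)); case: d => /=;
    by rewrite ?eqxx ?lr ?rl.
- rewrite ca andbT orbT; case cr : (c (lsite y)); case: d => /=;
    by rewrite ?eqxx ?lr ?rl.
  by rewrite a1 a2.
Qed.

Lemma hop_mono y d c c' : (forall z, c' z -> c z) ->
  forall z, hop y d c' z -> hop y d c z.
Proof.
move=> cc' z; rewrite !hopE.
have H1 := cc' (lsite y); have H2 := cc' (rsite y); have H3 := cc' z.
case: (siteP y z) => [_|_|_ _ _ _]; case: d => //=; move: H1 H2;
  case: (c' (lsite y)); case: (c' (rsite y)); case: (c (lsite y));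
  case: (c (rsite y)) => //=; lia.
Qed.

Definition del c a : config := [ffun z => c z && (z != a)].

Lemma delE c a z : del c a z = c z && (z != a).
Proof. by rewrite ffunE. Qed.

(** The tag is the discrepancy between two ASEPs under common rings: this is what ties the rule
    [move] to the definition of a second class particle. *)
Lemma hop_del y d c a : c a -> hop y d (del c a) = del (hop y d c) (move y d c a).
Proof.
move=> ca; have lr := lsite_rsite y; have rl := rsite_lsite y.
apply/ffunP => z; rewrite hopE [RHS]ffunE hopE !ffunE /move.
case: (siteP y a) ca => [->|->|a1 a2 _ _] ca; rewrite ?ca ?eqxx ?lr ?rl /=.
- by case: (siteP y z) => [->|->|z1 z2 _ _]; case: (c (rsite y)); case: d;
    rewrite ?eqxx ?lr ?rl ?andbT ?andbF ?z1 ?z2 ?andbT.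
- by case: (siteP y z) => [->|->|z1 z2 _ _]; case: (c (lsite y)); case: d;
    rewrite ?eqxx ?lr ?rl ?andbT ?andbF ?z1 ?z2 ?andbT.
rewrite 2!(eq_sym _ a) a1 a2 !andbT.
by case: (siteP y z) => // ->; rewrite eq_sym ?a1 ?a2 andbT.
Qed.

Let bond_below (x : bool) (y a b : nat) : (a == y) || (a == y.+1) ->
  ~~ ((b == y) || (b == y.+1)) -> (a <= b)%N -> (x + y <= b)%N.
Proof. by case: x => /=; lia. Qed.
Let bond_above (x : bool) (y a b : nat) : (b == y) || (b == y.+1) ->
  ~~ ((a == y) || (a == y.+1)) -> (a <= b)%N -> (a <= x + y)%N.
Proof. by case: x => /=; lia. Qed.

Lemma slower_step y d s s' : slower s s' -> ~~ doubly_tagged y s s' ->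
  slower (tagged_step y d s) (tagged_step y d s').
Proof.
case: s s' => [c a] [c' b]; rewrite /slower /doubly_tagged /tagged_step /=.
move=> [ab cc' ca' ca cb'] nd.
split; [|exact: hop_mono| |exact: move_occupied|exact: move_occupied].
- have e1 z : (z == lsite y) = (z == y :> nat) by rewrite -val_eqE.
  have e2 z : (z == rsite y) = (z == y.+1 :> nat) by rewrite -val_eqE.
  have vm (x : bool) : val (if x then rsite y else lsite y) = (x + y)%N.
    by case: x.
  have [ha|ha] := boolP ((a == lsite y) || (a == rsite y));
    have [hb|hb] := boolP ((b == lsite y) || (b == rsite y)).
  + rewrite /move ha hb.
    suff -> : (c (lsite y) && c (rsite y)) = (c' (lsite y) && c' (rsite y)) by [].
    apply/idP/idP => [cl|/andP[/cc' -> /cc' -> //]]; apply/negPn.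
    by apply: contra nd => nc; rewrite ha hb nc !andbT.
  + move: ha hb ab; rewrite /move => ha hb; rewrite ha (negbTE hb).
    move: ha hb; rewrite !e1 !e2 !vm => ha hb ab; exact: (bond_below _ ha hb ab).
  + move: ha hb ab; rewrite /move => ha hb; rewrite hb (negbTE ha).
    move: ha hb; rewrite !e1 !e2 !vm => ha hb ab; exact: (bond_above _ hb ha ab).
  + by rewrite /move (negbTE ha) (negbTE hb).
- have mono : forall z, del (hop y d c') (move y d c' b) z ->
      del (hop y d c) (move y d c a) z.
    move=> z; rewrite -!hop_del//; apply: hop_mono => {}z; rewrite !delE.
    move=> /andP[c'z zb]; rewrite cc'//=; apply: contraNneq zb => za.
    by rewrite za in c'z *; rewrite ca'.
  move=> hc'; apply/eqP/negP => /negP ne.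
  by have := mono (move y d c a); rewrite !delE ne eqxx andbF hc' => /(_ isT).
Qed.

Lemma doubly_taggedP y s s' : slower s s' -> doubly_tagged y s s' ->
  exists c1 c2 : config,
    [/\ tagged_step y true s = (s.1, lsite y),
        tagged_step y false s = (s.1, rsite y),
        tagged_step y true s' = (c1, rsite y),
        tagged_step y false s' = (c2, lsite y) &
        [/\ slower (s.1, lsite y) (c1, rsite y),
            slower (s.1, lsite y) (c2, lsite y) &
            slower (s.1, rsite y) (c1, rsite y)]].
Proof.
case: s s' => [c a] [c' b]; rewrite /slower /doubly_tagged /tagged_step /=.
move=> [ab cc' ca' ca cb'] /and5P[cl cr ha hb nb].
exists (hop y true c'), (hop y false c').
have lr := lsite_rsite y; have rl := rsite_lsite y.
have hc d : hop y d c = c.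
  apply/ffunP => z; rewrite hopE cl cr.
  by case: (siteP y z) => [->|->|_ _ _ _]; case: d; rewrite ?cl ?cr.
have cb2 : c' (lsite y) || c' (rsite y).
  by case/orP: hb => /eqP eb; rewrite -eb cb' ?orbT.
rewrite /move ha hb cl cr (negbTE nb) !hc /=; split => //; split; split => //=.
- by move=> z /(hop_mono cc'); rewrite hc.
- by rewrite hopE eqxx (negbTE nb).
- by rewrite hopE rl eqxx.
- by move=> z /(hop_mono cc'); rewrite hc.
- by rewrite hopE eqxx.
- by move=> z /(hop_mono cc'); rewrite hc.
- by rewrite hopE rl eqxx.
Qed.

End Config.

Section Monotonicity.
Context {R : realFieldType} (m : nat) (wR wL : R).
Hypotheses (wL0 : 0 <= wL) (wLR : wL <= wR) (wm : m%:R * (wR + wL) <= 1).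

(** On a doubly tagged bond, left rings of the first chain, which send its tag right, are matched
    with right rings of the second, and left rings of the second with right rings of the first. The
    surplus [wR - wL] of right rings is matched with itself, and must be nonnegative. *)
Lemma bond_op_slower (V : @config m * 'I_m.+1 -> R) n s s' :
  (forall s s', slower s s' -> V s <= V s') -> slower s s' ->
  iter n (bond_op wR wL tagged_step) V s <=
  iter n (bond_op wR wL tagged_step) V s'.
Proof.
move=> HV; elim: n s s' => [|n IH] s s' ss'; first exact: HV.
rewrite !iter_bond_op; apply: lerD; first by rewrite ler_wpM2l ?subr_ge0 ?IH.
have wR0 : 0 <= wR := le_trans wL0 wLR.
apply: ler_sum => y _; have [dt|ndt] := boolP (doubly_tagged y s s'); last first.
  by apply: lerD; rewrite ler_wpM2l ?IH//; exact: slower_step.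
have [c1 [c2 [-> -> -> -> [/IH s1 /IH s2 /IH s3]]]] := doubly_taggedP ss' dt.
set W := iter _ _ _ in s1 s2 s3 *.
have -> : wR * W (s.1, lsite y) + wL * W (s.1, rsite y) =
  (wR - wL) * W (s.1, lsite y) + wL * (W (s.1, lsite y) + W (s.1, rsite y)).
  by ring.
have -> : wR * W (c1, rsite y) + wL * W (c2, lsite y) =
  (wR - wL) * W (c1, rsite y) + wL * (W (c2, lsite y) + W (c1, rsite y)).
  by ring.
by apply: lerD; rewrite ler_wpM2l ?subr_ge0//; exact: lerD.
Qed.

End Monotonicity.

Section Discrepancies.
Context {R : realFieldType} (m : nat) (wR wL q : R).
Hypotheses (wL0 : 0 <= wL) (wR0 : 0 < wR) (qE : q = wL / wR) (q1 : q < 1)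
  (wm : m%:R * (wR + wL) <= 1).
Implicit Types (y : 'I_m) (d : bool) (e c : @config m) (z : 'I_m.+1).

Definition pair_step y d (s : @config m * @config m) := (hop y d s.1, hop y d s.2).

(* [discr e c] is the set of second class particles of the ordered pair [e <= c]. *)
Definition discr e c : {set 'I_m.+1} := [set z | c z && ~~ e z].
Definition discr_below e c (k : nat) : nat := #|[set z in discr e c | (z < k)%N]|.

(** In [V (s.2, z)] the particle at [z] is tagged inside [s.2], so that all other elements of
    [discr] count as first class particles for it. *)
Definition rank_sum (V : @config m * 'I_m.+1 -> R) (s : @config m * @config m) : R :=
  \sum_(z in discr s.1 s.2) q ^+ discr_below s.1 s.2 z * V (s.2, z).

Lemma discr_move y d e c z : (forall z, e z -> c z) -> z \in discr e c ->
  move y d c z \in discr (hop y d e) (hop y d c).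
Proof.
move=> ec; rewrite !inE => /andP[cz ez]; rewrite move_occupied//=.
apply/negP => he; suff : del (hop y d c) (move y d c z) (move y d c z).
  by rewrite delE eqxx andbF.
rewrite -hop_del//; apply: hop_mono he => w ew; rewrite delE ec//=.
by apply: contraNneq ez => <-.
Qed.

Lemma move_ltn y d e c w z :
  ~~ ((lsite y \in discr e c) && (rsite y \in discr e c)) ->
  w \in discr e c -> z \in discr e c ->
  (move y d c w < move y d c z)%N = (w < z)%N.
Proof.
move=> nb wX zX; have vm (x : bool) : (if x then rsite y else lsite y) = (x + y)%N :> nat.
  by case: x.
rewrite /move; case: (siteP y w) wX => [->|->|_ _ w1 w2] wX;
  case: (siteP y z) zX => [->|->|_ _ z1 z2] zX /=; rewrite ?ltnn ?vm//.
- by rewrite wX zX in nb.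
- by case: (_ (+) _) => /=; lia.
- by rewrite wX zX in nb.
- by case: (_ (+) _) => /=; rewrite /bump /=; lia.
- by case: (_ (+) _) => /=; lia.
- by case: (_ (+) _) => /=; rewrite /bump /=; lia.
Qed.

Lemma discr_hop y d e c : (forall z, e z -> c z) ->
  ~~ ((lsite y \in discr e c) && (rsite y \in discr e c)) ->
  discr (hop y d e) (hop y d c) = move y d c @: discr e c.
Proof.
move=> ec nb; apply/eqP; rewrite finset.eqEsubset; apply/andP; split; last first.
  by apply/fintype.subsetP => _ /imsetP[z zX ->]; exact: discr_move.
have lr := lsite_rsite y; have rl := rsite_lsite y.
have el := ec (lsite y); have er := ec (rsite y).
apply/fintype.subsetP => z; rewrite inE !hopE => zX; apply/imsetP.
move: nb; rewrite !inE; case: (siteP y z) zX => [->|->|z1 z2 _ _] zX nb.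
- exists (if c (lsite y) && ~~ e (lsite y) then lsite y else rsite y);
    move: zX nb el er; rewrite /move; case: d;
    case cl: (c (lsite y)); case cr: (c (rsite y)); case hl: (e (lsite y));
    case hr: (e (rsite y)) => //=; rewrite ?inE ?cl ?cr ?hl ?hr ?eqxx ?lr ?rl //=.
- exists (if c (lsite y) && ~~ e (lsite y) then lsite y else rsite y);
    move: zX nb el er; rewrite /move; case: d;
    case cl: (c (lsite y)); case cr: (c (rsite y)); case hl: (e (lsite y));
    case hr: (e (rsite y)) => //=; rewrite ?inE ?cl ?cr ?hl ?hr ?eqxx ?lr ?rl //=.
- exists z; first by rewrite inE.
  by rewrite /move z1 z2.
Qed.

Lemma move_inj y d e c :
  ~~ ((lsite y \in discr e c) && (rsite y \in discr e c)) ->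
  {in discr e c &, injective (move y d c)}.
Proof.
move=> nb u v uX vX uv; have := move_ltn d nb uX vX; have := move_ltn d nb vX uX.
by rewrite uv ltnn; case: (ltngtP u v) => // /ord_inj.
Qed.

Lemma discr_below_move y d e c z : (forall z, e z -> c z) ->
  ~~ ((lsite y \in discr e c) && (rsite y \in discr e c)) ->
  z \in discr e c ->
  discr_below (hop y d e) (hop y d c) (move y d c z) = discr_below e c z.
Proof.
move=> ec nb zX; rewrite /discr_below discr_hop//.
have inj := move_inj (d := d) nb.
rewrite -[RHS](@card_in_imset _ _ (move y d c)); last first.
  by move=> u v /finset.setIdP[uX _] /finset.setIdP[vX _]; apply: inj.
apply: eq_card => w; rewrite inE.
apply/andP/imsetP => [[/imsetP[u uX ->]]|[u]].
  by rewrite (move_ltn d nb)// => uz; exists u; rewrite // inE uX.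
rewrite inE => /andP[uX uz] ->; rewrite (move_ltn d nb)//; split=> //.
exact: imset_f.
Qed.

(** Away from a bond holding two second class particles, a tag follows its particle and keeps its
    rank. On such a bond the pair [(e, c)] is frozen, while the tag passes to the lower rank with
    weight [wR] and to the higher one with weight [wL]; as [wL = q * wR], the weights [q ^ rank] are
    reversible for this exchange. *)
Lemma rank_sum_bond y V e c : (forall z, e z -> c z) ->
  \sum_(z in discr e c) q ^+ discr_below e c z *
     (wR * V (tagged_step y true (c, z)) + wL * V (tagged_step y false (c, z))) =
  wR * rank_sum V (pair_step y true (e, c)) +
  wL * rank_sum V (pair_step y false (e, c)).
Proof.
move=> ec; have [/andP[lX rX]|nb] :=
    boolP ((lsite y \in discr e c) && (rsite y \in discr e c)); last first.
  have H d : rank_sum V (pair_step y d (e, c)) =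
      \sum_(z in discr e c) q ^+ discr_below e c z * V (tagged_step y d (c, z)).
    rewrite /rank_sum /= discr_hop// big_imset /=; last exact: move_inj.
    by apply: eq_bigr => z zX; rewrite discr_below_move.
  rewrite !H !mulr_sumr -big_split /=; apply: eq_bigr => z _; ring.
move: (lX) (rX); rewrite !inE => /andP[cl el] /andP[cr er].
have hc d : hop y d c = c.
  apply/ffunP => z; rewrite hopE cl cr.
  by case: (siteP y z) => [->|->|_ _ _ _]; case: d; rewrite ?cl ?cr.
have he d : hop y d e = e.
  apply/ffunP => z; rewrite hopE (negbTE el) (negbTE er).
  by case: (siteP y z) => [->|->|_ _ _ _]; case: d; rewrite ?(negbTE el) ?(negbTE er).
have lr := lsite_rsite y; have rl := rsite_lsite y.
have rb : discr_below e c (rsite y) = (discr_below e c (lsite y)).+1.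
  rewrite /discr_below (cardsD1 (lsite y)) inE lX leqnn add1n; congr _.+1.
  apply: eq_card => w; rewrite !inE.
  by rewrite -val_eqE /= /bump /= add1n ltnS [(w < y)%N]ltn_neqAle andbCA.
have qw : wL = q * wR by rewrite qE divfK// gt_eqF.
rewrite /rank_sum /= !hc !he.
have key (F : 'I_m.+1 -> R) : \sum_(z in discr e c) F z = F (lsite y) +
    (F (rsite y) + \sum_(z in discr e c | (z != lsite y) && (z != rsite y)) F z).
  rewrite (bigD1 (lsite y) lX) (bigD1 (rsite y)) /=; last by rewrite rl andbT; exact: rX.
  by congr (_ + (_ + _)); apply: eq_bigl => z; rewrite andbA.
rewrite [LHS]key (key (fun z => q ^+ discr_below e c z * V (c, z))).
rewrite /tagged_step /= /move /= !eqxx !lr !rl cl cr /= !hc rb.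
set S1 := \sum_(i in _ | _) _; set S2 := \sum_(i in _ | _) _.
suff -> : S1 = (wR + wL) * S2 by rewrite exprS qw; ring.
rewrite /S1 /S2 mulr_sumr; apply: eq_bigr => z /and3P[_ zl zr].
by rewrite (negbTE zl) (negbTE zr) /=; ring.
Qed.

Lemma rank_sum_iter V n e c : (forall z, e z -> c z) ->
  \sum_(z in discr e c) q ^+ discr_below e c z *
     iter n (bond_op wR wL tagged_step) V (c, z) =
  iter n (bond_op wR wL pair_step) (rank_sum V) (e, c).
Proof.
elim: n e c => [//|n IH] e c ec; rewrite iter_bond_op -IH//.
set W := iter n _ V.
have -> : \sum_y (wR * iter n (bond_op wR wL pair_step) (rank_sum V)
                       (pair_step y true (e, c)) +
                  wL * iter n (bond_op wR wL pair_step) (rank_sum V)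
                       (pair_step y false (e, c))) =
   \sum_y \sum_(z in discr e c) q ^+ discr_below e c z *
     (wR * W (tagged_step y true (c, z)) + wL * W (tagged_step y false (c, z))).
  apply: eq_bigr => y _; rewrite rank_sum_bond //.
  by rewrite /rank_sum !IH //; apply: hop_mono.
rewrite exchange_big /= mulr_sumr -big_split /=; apply: eq_bigr => z zX.
rewrite -/W -mulr_sumr mulrCA -mulrDr; congr (_ * _).
Qed.

Lemma discr_belowS e c z :
  discr_below e c z.+1 = ((z \in discr e c) + discr_below e c z)%N.
Proof.
rewrite /discr_below (cardsD1 z) finset.in_set ltnSn andbT; congr (_ + _)%N.
apply: eq_card => w; rewrite finset.in_setD1 !finset.in_set ltnS leq_eqVlt val_eqE.
by case: eqVneq => [->|_] //=; rewrite ltnn andbF.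
Qed.

(** The particles beyond [x] have consecutive ranks, starting from the number of particles up to
    [x]: their weights form a geometric series. *)
Lemma rank_sum_le (x : nat) e c :
  (1 - q) * rank_sum (fun s => (x < s.2)%N%:R) (e, c) <= q ^+ discr_below e c x.+1.
Proof.
have q0 : 0 <= q by rewrite qE divr_ge0 // ltW.
pose g k := q ^+ discr_below e c k.
(* [g k - g k.+1] is [(1 - q) * q ^+ rank] when [k] carries a second class particle and vanishes
   otherwise, so the sum over sites telescopes. *)
pose F k := if (x < k)%N then g k - g k.+1 else 0.
have -> : (1 - q) * rank_sum (fun s => (x < s.2)%N%:R) (e, c) = \sum_(k < m.+1) F k.
  rewrite /rank_sum mulr_sumr big_mkcond; apply: eq_bigr => z _.
  rewrite /F /g discr_belowS; case: (z \in _) => /=; case: (x < z)%N => //=.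
  - by rewrite exprS; ring.
  - by rewrite !mulr0.
  - by rewrite subrr.
have H M : \sum_(k < M) F k = if (x < M)%N then g x.+1 - g M else 0.
  elim: M => [|M IH]; first by rewrite big_ord0.
  rewrite big_ord_recr /= IH /F ltnS.
  by case: (ltngtP x M) => [_|_|->] /=; rewrite ?subrr ?addr0 //; ring.
rewrite H; case: ifP => _; last exact: exprn_ge0.
by rewrite lerBlDr lerDl exprn_ge0.
Qed.

(** The leftmost particle has rank zero: its tail is one nonnegative term, of weight one, of the
    invariant sum. *)
Lemma tagged_tail_le (x : nat) n e c a : (forall z, e z -> c z) ->
  a \in discr e c -> (forall z, z \in discr e c -> (a <= z)%N) ->
  (1 - q) * iter n (bond_op wR wL tagged_step) (fun s => (x < s.2)%N%:R) (c, a) <=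
  iter n (bond_op wR wL pair_step) (fun s => q ^+ discr_below s.1 s.2 x.+1) (e, c).
Proof.
move=> ec aX amin; have wR0' := ltW wR0.
have q0 : 0 <= q by rewrite qE divr_ge0.
set V := fun s : config * _ => _.
have H s : (1 - q) * rank_sum V s <= q ^+ discr_below s.1 s.2 x.+1.
  by case: s => e' c'; exact: rank_sum_le.
apply: le_trans (bond_op_le wR0' wL0 wm pair_step n (e, c) H).
rewrite bond_op_scale ler_wpM2l ?subr_ge0 ?(ltW q1)//.
rewrite -rank_sum_iter// (bigD1 a)//=.
have -> : discr_below e c a = 0%N.
  apply: eq_card0 => w; apply/negP => /finset.setIdP[/amin]; by rewrite leqNgt => /negP.
rewrite expr0 mul1r lerDl sumr_ge0// => z _; rewrite mulr_ge0 ?exprn_ge0//.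
rewrite -(bond_op_cst wR wL tagged_step 0 n (c, z)).
by apply: bond_op_le => // s; exact: ler0n.
Qed.

End Discrepancies.

(** * Product measures and their monotone couplings *)

Section ProductAverage.
Context {R : realFieldType} (m : nat).
Implicit Types (p : 'I_m.+1 -> R).

Definition bern (x : R) (s : bool) : R := if s then x else 1 - x.

Definition pavg (T : finType) (w : 'I_m.+1 -> T -> R)
    (F : {ffun 'I_m.+1 -> T} -> R) : R :=
  \sum_(t : {ffun 'I_m.+1 -> T}) (\prod_z w z (t z)) * F t.

Definition avg p (F : @config m -> R) : R := pavg (fun z => bern (p z)) F.

Lemma pavg_marginal (T S : finType) (f : T -> S) (w : 'I_m.+1 -> T -> R)
    (w' : 'I_m.+1 -> S -> R) (F : {ffun 'I_m.+1 -> S} -> R) :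
  (forall z s, \sum_(t | f t == s) w z t = w' z s) ->
  pavg w (fun t => F [ffun z => f (t z)]) = pavg w' F.
Proof.
move=> fw; rewrite /pavg.
rewrite (partition_big (fun t : {ffun 'I_m.+1 -> T} => [ffun z => f (t z)]) predT)//=.
apply: eq_bigr => s _.
have -> : \prod_z w' z (s z) = \prod_z \sum_(t | f t == s z) w z t.
  by apply: eq_bigr => z _; rewrite fw.
rewrite bigA_distr_big_dep /= mulr_suml; apply: eq_big => [t|t /eqP <- //].
apply/eqP/familyP => [<- z|H]; first by rewrite unfold_in /= ffunE.
by apply/ffunP => z; rewrite ffunE; apply/eqP; have := H z; rewrite unfold_in.
Qed.

(** The comparison is only asked on the support of the weights; this is how the order built into a
    coupling of two product measures enters. *)
Lemma pavg_le (T : finType) (w : 'I_m.+1 -> T -> R) F G :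
  (forall z t, 0 <= w z t) ->
  (forall t : {ffun 'I_m.+1 -> T}, (forall z, w z (t z) != 0) -> F t <= G t) ->
  pavg w F <= pavg w G.
Proof.
move=> w0 FG; apply: ler_sum => t _.
have [/eqP/prodf_eq0[z _ /eqP wz]|/prodf_neq0 H] := eqVneq (\prod_z w z (t z)) 0.
  by rewrite (bigD1 z)//= wz !mul0r.
by apply: ler_wpM2l; [exact: prodr_ge0 | apply: FG => z; exact: H].
Qed.

Lemma pavg_prod (T : finType) (w : 'I_m.+1 -> T -> R) (g : 'I_m.+1 -> T -> R) :
  pavg w (fun t => \prod_z g z (t z)) = \prod_z \sum_t w z t * g z t.
Proof.
rewrite bigA_distr_bigA /=; apply: eq_bigr => t _.
by rewrite -big_split.
Qed.

Lemma pavgD (T : finType) (w : 'I_m.+1 -> T -> R) F G :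
  pavg w (fun t => F t + G t) = pavg w F + pavg w G.
Proof. by rewrite -big_split; apply: eq_bigr => t _; rewrite mulrDr. Qed.

Lemma pavgZ (T : finType) (w : 'I_m.+1 -> T -> R) a F :
  pavg w (fun t => a * F t) = a * pavg w F.
Proof. by rewrite /pavg mulr_sumr; apply: eq_bigr => t _; rewrite mulrCA. Qed.

Lemma avg_cst p a : avg p (fun=> a) = a.
Proof.
have one : avg p (fun=> 1) = 1.
  have := pavg_prod (fun z => bern (p z)) (fun _ _ => 1).
  rewrite [X in _ = X]big1 => [H|z _].
    by rewrite -[RHS]H; apply: eq_bigr => c _; rewrite [X in _ = _ * X]big1.
  by rewrite big_bool /bern /= !mulr1 addrC subrK.
transitivity (avg p (fun=> a * 1)); first by rewrite mulr1.
by rewrite [LHS]pavgZ [X in a * X]one mulr1.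
Qed.

(** The monotone coupling of Bernoulli variables of parameters [x <= y]: the pair [(true, false)]
    has weight zero. *)
Definition bern2 (x y : R) (s : bool * bool) : R :=
  if s.2 then (if s.1 then x else y - x) else (if s.1 then 0 else 1 - y).

Lemma avg_coupling1 p p' F :
  pavg (fun z => bern2 (p z) (p' z)) (fun t => F [ffun z => (t z).1]) = avg p F.
Proof.
apply: pavg_marginal => z [].
  rewrite (eq_bigl (fun t => t \in [:: (true, true); (true, false)])); last by case=> [[] []].
  by rewrite -big_uniq//= 2!big_cons big_nil /bern2 /= !addr0.
rewrite (eq_bigl (fun t => t \in [:: (false, true); (false, false)])); last by case=> [[] []].
by rewrite -big_uniq//= 2!big_cons big_nil /bern2 /bern /=; ring.
Qed.

Lemma avg_coupling2 p p' F :
  pavg (fun z => bern2 (p z) (p' z)) (fun t => F [ffun z => (t z).2]) = avg p' F.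
Proof.
apply: pavg_marginal => z [].
  rewrite (eq_bigl (fun t => t \in [:: (true, true); (false, true)])); last by case=> [[] []].
  by rewrite -big_uniq//= 2!big_cons big_nil /bern2 /=; ring.
rewrite (eq_bigl (fun t => t \in [:: (true, false); (false, false)])); last by case=> [[] []].
by rewrite -big_uniq//= 2!big_cons big_nil /bern2 /bern /=; ring.
Qed.

(** Forcing the occupation of the origin costs a constant factor only. This replaces the starts with
    occupation [1] or [0] at the origin by the product measure for which the current identity is
    exact. *)
Lemma avg_le_density (o : 'I_m.+1) p p' k F :
  (forall c, 0 <= F c) -> (forall z, 0 <= p z <= 1) -> (forall z, z != o -> p z = p' z) ->
  (forall s, bern (p o) s <= k * bern (p' o) s) ->
  avg p F <= k * avg p' F.
Proof.
move=> F0 p01 pp' H; rewrite -pavgZ; apply: ler_sum => c _.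
rewrite mulrCA mulrA; apply: ler_wpM2r => //.
rewrite (bigD1 o) // [X in _ <= _ * X](bigD1 o) //= mulrA.
rewrite [X in _ <= _ * X](_ : _ = \prod_(i < m.+1 | i != o) bern (p i) (c i)); last first.
  by apply: eq_bigr => z zo; rewrite pp'.
apply: ler_wpM2r => //; apply: prodr_ge0 => z _; rewrite /bern.
by have /andP[? ?] := p01 z; case: ifP; rewrite ?subr_ge0.
Qed.

End ProductAverage.

Section Counting.
Context {m : nat}.
Implicit Types (y : 'I_m) (d : bool) (e c : @config m) (z : 'I_m.+1) (k : nat).

Definition cnt c k : nat := \sum_(z < m.+1 | (z < k)%N) c z.

Lemma cnt_split y c k : cnt c k = ((y < k) * c (lsite y) + (y.+1 < k) * c (rsite y) +
  \sum_(z < m.+1 | (z != lsite y) && (z != rsite y)) (z < k) * c z)%N.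
Proof.
rewrite /cnt big_mkcond /= (bigD1 (lsite y)) //= (bigD1 (rsite y)) /=; last first.
  by rewrite rsite_lsite.
rewrite addnA /bump /= add1n; congr (_ + _ + _)%N; try by case: ifP; rewrite ?mul1n.
by apply: eq_bigr => z _; case: ifP; rewrite ?mul1n.
Qed.

Lemma cnt_hop_rest y d c k :
  (\sum_(z < m.+1 | (z != lsite y) && (z != rsite y)) (z < k) * hop y d c z =
  \sum_(z < m.+1 | (z != lsite y) && (z != rsite y)) (z < k) * c z)%N.
Proof. by apply: eq_bigr => z /andP[/negbTE zl /negbTE zr]; rewrite hopE zl zr. Qed.

Lemma cnt_hop y d c k : k != y.+1 -> cnt (hop y d c) k = cnt c k.
Proof.
move=> ky; rewrite !(cnt_split y) cnt_hop_rest; congr (_ + _)%N.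
rewrite !hopE !eqxx rsite_lsite; case: d; case: (c (lsite y)); case: (c (rsite y)) => //=;
  lia.
Qed.

Lemma cnt_hopS y d c :
  (cnt (hop y d c) y.+1 + (d && c (lsite y) && ~~ c (rsite y)) =
   cnt c y.+1 + (~~ d && ~~ c (lsite y) && c (rsite y)))%N.
Proof.
rewrite !(cnt_split y) cnt_hop_rest !hopE !eqxx rsite_lsite ltnSn ltnn.
by case: d; case: (c (lsite y)); case: (c (rsite y)) => //=; lia.
Qed.

Lemma discr_below_cnt e c k : (forall z, e z -> c z) ->
  (discr_below e c k + cnt e k)%N = cnt c k.
Proof.
move=> ec; rewrite /discr_below -sum1_card /cnt big_mkcond /=.
rewrite [X in (_ + X)%N]big_mkcond [RHS]big_mkcond /=.
rewrite -big_split /=; apply: eq_bigr => z _; rewrite !inE.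
by have := ec z; case: (z < k)%N; case: (e z); case: (c z) => //= /(_ isT).
Qed.

End Counting.

Section TaggedTail.
Context {R : realFieldType} (m : nat) (wR wL q : R) (o : 'I_m.+1).
Hypotheses (wL0 : 0 <= wL) (wLR : wL < wR) (qE : q = wL / wR)
  (wm : m%:R * (wR + wL) <= 1).

Definition dens (al ka be : R) (z : 'I_m.+1) : R :=
  if (z < o)%N then al else if z == o then ka else be.

(** [P] also receives the initial number of particles up to [o]. Subtracting the final number up to
    [x] gives the net current across the line from [o] to [x], read off the configurations without
    recording jumps. *)
Definition hop_tail (n : nat) (P : nat -> @config m -> bool) (c0 : config) : R :=
  iter n (bond_op wR wL hop) (fun c => (P (cnt c0 o.+1) c)%:R) c0.

Let q01 : 0 <= q < 1.
Proof.
have wR0 : 0 < wR := le_lt_trans wL0 wLR.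
by rewrite qE divr_ge0 ?(ltW wR0)// ltr_pdivrMr// mul1r.
Qed.

Lemma tagged_avg_le (lam rho : R) n (x : nat) : 0 <= rho <= lam -> lam <= 1 ->
  avg (dens lam 1 lam) (fun c => iter n (bond_op wR wL tagged_step)
    (fun s => (x < s.2)%N%:R) (c, o)) <=
  avg (dens rho 1 lam) (fun c => iter n (bond_op wR wL tagged_step)
    (fun s => (x < s.2)%N%:R) (c, o)).
Proof.
move=> /andP[r0 rl] l1.
rewrite -[leRHS](avg_coupling1 _ (dens lam 1 lam)).
rewrite -[leLHS](avg_coupling2 (dens rho 1 lam)).
apply: pavg_le => [z t|t Ht].
  by rewrite /bern2 /dens; case: t => [[] []] /=; case: (z < o)%N;
    case: (z == o); rewrite ?lexx ?subr_ge0 ?ler01 //; lra.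
have sup z : ((t z).1 -> (t z).2) /\ (z == o -> (t z).2).
  have := Ht z; rewrite /bern2; case: (t z) => [[] []] //=; first by rewrite eqxx.
  move=> h; split=> // /eqP zo; move: h.
  by rewrite zo /dens ltnn eqxx subrr eqxx.
apply: bond_op_slower => //; first exact: ltW.
  move=> [c a] [c' b] [/= ab _ _ _ _]; rewrite ler_nat.
  by case: (ltnP x a) => // xa; rewrite (leq_trans xa ab).
split=> //= [z||]; rewrite ?ffunE.
- by have [+ _] := sup z.
- by have [_ ->] := sup o.
- have := Ht o; rewrite /bern2 /dens ltnn eqxx; case: (t o) => [[] []] //=; by rewrite subrr eqxx.
Qed.

(** With [D] second class particles up to [x], the current of [c] exceeds that of [e] by exactly
    [1 - D], where the one is the particle at [o]. Hence [D] is at least [k], or the current of [c]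
    reaches [a], or that of [e] stays below [a + k]. *)
Lemma tagged_pair_le (e c : @config m) n (x k : nat) (a : R) :
  (forall z, e z -> c z) -> c o -> ~~ e o ->
  (forall z : 'I_m.+1, (z < o)%N -> e z = c z) ->
  (1 - q) * iter n (bond_op wR wL tagged_step) (fun s => (x < s.2)%N%:R) (c, o) <=
  q ^+ k + (hop_tail n (fun N c => a <= N%:R - (cnt c x.+1)%:R) c +
            hop_tail n (fun N c => N%:R - (cnt c x.+1)%:R < a + k%:R) e).
Proof.
move=> ec co eo elt; have [q0 q1] := andP q01.
have wR0 : 0 < wR := le_lt_trans wL0 wLR.
have oX : o \in discr e c by rewrite inE co.
have omin z : z \in discr e c -> (o <= z)%N.
  by rewrite inE leqNgt => /andP[cz]; apply: contra => /elt ->.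
apply: le_trans (tagged_tail_le wL0 wR0 qE q1 wm x n ec oX omin) _.
have cE : cnt c o.+1 = (cnt e o.+1).+1.
  rewrite -(discr_below_cnt _ ec) discr_belowS oX.
  suff -> : discr_below e c o = 0%N by [].
  by apply: eq_card0 => w; apply/negP => /finset.setIdP[/omin]; rewrite leqNgt => /negP.
pose G1 (c1 : @config m) : R := (a <= (cnt c o.+1)%:R - (cnt c1 x.+1)%:R)%R%:R.
pose G2 (c1 : @config m) : R := ((cnt e o.+1)%:R - (cnt c1 x.+1)%:R < a + k%:R)%R%:R.
have -> : q ^+ k + (hop_tail n (fun N c => a <= N%:R - (cnt c x.+1)%:R) c +
            hop_tail n (fun N c => N%:R - (cnt c x.+1)%:R < a + k%:R) e) =
   iter n (bond_op wR wL (@pair_step m)) (fun s => q ^+ k + (G1 s.2 + G2 s.1)) (e, c).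
  rewrite bond_op_add bond_op_cst bond_op_add.
  by rewrite (bond_op_proj wR wL (st2 := hop) (f := snd))//
    (bond_op_proj wR wL (st2 := hop) (f := fst)).
pose rel (s1 s2 : @config m * @config m) := s1 = s2 /\ forall z, s1.1 z -> s1.2 z.
apply: (@bond_op_le_rel R m wR wL (ltW wR0) wL0 wm _ _ _ _ rel) => //.
  by move=> y d s1 _ [<- H]; split=> //; exact: hop_mono.
move=> [e' c'] _ [<- /= ec']; rewrite /G1 /G2.
have := discr_below_cnt x.+1 ec'; set D := discr_below e' c' x.+1 => DE.
have [kD|Dk] := leqP k D.
  apply: (@le_trans _ _ (q ^+ k)); first by rewrite ler_wiXn2l// ltW.
  by rewrite lerDl addr_ge0 ?ler0n.
apply: (@le_trans _ _ 1); first by rewrite exprn_ile1// ltW.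
rewrite -[X in X <= _]add0r lerD ?exprn_ge0//.
have [//|h1] := leP a; first by rewrite lerDl ler0n.
rewrite add0r; have [//|h2] := ltP _ (a + k%:R); exfalso.
move: h1 h2; rewrite cE -DE -natr1 natrD.
have : (D%:R : R) <= k%:R by rewrite ler_nat ltnW.
lra.
Qed.

(** In the coupling of [dens rho 0 lam'] with [dens rho 1 lam], equal densities make the starts
    coincide left of [o], and the values [0] and [1] at [o] make the tag the leftmost
    discrepancy. *)
Lemma tagged_split (lam rho lam' : R) n (x k : nat) (a : R) :
  0 <= lam' <= rho -> rho <= lam <= 1 ->
  (1 - q) * avg (dens lam 1 lam) (fun c => iter n (bond_op wR wL tagged_step)
    (fun s => (x < s.2)%N%:R) (c, o)) <=
  q ^+ k + (avg (dens rho 1 lam) (hop_tail n (fun N c => a <= N%:R - (cnt c x.+1)%:R)) +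
     avg (dens rho 0 lam') (hop_tail n (fun N c => N%:R - (cnt c x.+1)%:R < a + k%:R))).
Proof.
move=> /andP[l'0 l'r] /andP[rl l1]; have [q0 q1] := andP q01.
apply: (@le_trans _ _ ((1 - q) * avg (dens rho 1 lam) (fun c =>
  iter n (bond_op wR wL tagged_step) (fun s => (x < s.2)%N%:R) (c, o)))).
  by rewrite ler_wpM2l ?subr_ge0 ?(ltW q1)// tagged_avg_le// (le_trans l'0).
rewrite -[leLHS]pavgZ -(avg_cst (dens rho 1 lam) (q ^+ k)).
rewrite -[leLHS](avg_coupling2 (dens rho 0 lam') (dens rho 1 lam)).
rewrite -[X in _ <= X + _](avg_coupling2 (dens rho 0 lam') (dens rho 1 lam)).
rewrite -[X in _ <= _ + (X + _)](avg_coupling2 (dens rho 0 lam') (dens rho 1 lam)).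
rewrite -[X in _ <= _ + (_ + X)](avg_coupling1 (dens rho 0 lam') (dens rho 1 lam)).
rewrite -!pavgD; apply: pavg_le => [z t|t Ht].
  by rewrite /bern2 /dens; case: t => [[] []] /=; case: (z < o)%N;
    case: (z == o); rewrite ?lexx ?subr_ge0 ?ler01 ?subrr ?subr0 //; lra.
have sup z : [/\ (t z).1 -> (t z).2, z == o -> (t z).2 && ~~ (t z).1 &
    (z < o)%N -> (t z).1 = (t z).2].
  have := Ht z; rewrite /bern2 /dens; case: (t z) => [[] []] //=; rewrite ?eqxx//.
  - by move=> h; split=> // /eqP zo; move: h; rewrite zo ltnn !eqxx.
  - by move=> h; split=> // zo; move: h; rewrite zo subrr eqxx.
  - by move=> h; split=> // /eqP zo; move: h; rewrite zo ltnn !eqxx subrr eqxx.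
have [_ /(_ (eqxx o))/andP[co eo] _] := sup o.
apply: tagged_pair_le => [z|||z]; rewrite !ffunE //.
- by have [+ _ _] := sup z.
- by have [_ _] := sup z.
Qed.

End TaggedTail.

(** * Reservoirs *)

Section Involutions.
Context {R : realFieldType} (m : nat).
Implicit Types (y : 'I_m) (c : @config m) (z : 'I_m.+1) (p : 'I_m.+1 -> R).

Definition exchange y c : config :=
  [ffun z => if z == lsite y then c (rsite y)
             else if z == rsite y then c (lsite y) else c z].

Lemma exchangeK y : involutive (exchange y).
Proof.
move=> c; apply/ffunP => z; rewrite !ffunE !eqxx rsite_lsite.
by case: (siteP y z) => [->|->|].
Qed.

Lemma avg_exchange p y (f : R) (b : bool) (F : @config m -> R) :
  bern (p (lsite y)) b * bern (p (rsite y)) (~~ b) * f =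
  bern (p (lsite y)) (~~ b) * bern (p (rsite y)) b ->
  avg p (fun c => ((c (lsite y) == b) && (c (rsite y) == ~~ b))%:R *
                  (f * F (exchange y c))) =
  avg p (fun c => ((c (lsite y) == ~~ b) && (c (rsite y) == b))%:R * F c).
Proof.
move=> pf; rewrite [LHS](reindex_inj (inv_inj (exchangeK y))) /=.
apply: eq_bigr => c _; rewrite exchangeK !ffunE !eqxx rsite_lsite.
rewrite [(c (lsite y) == _) && _]andbC.
case: eqP => [cr|_]; last by rewrite !mul0r !mulr0.
case: eqP => [cl|_]; last by rewrite !mul0r !mulr0.
rewrite /= !mul1r mulrA; congr (_ * _).
have prodE c' : \prod_z bern (p z) (c' z) =
    bern (p (lsite y)) (c' (lsite y)) * bern (p (rsite y)) (c' (rsite y)) *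
    \prod_(z < m.+1 | (z != lsite y) && (z != rsite y)) bern (p z) (c' z).
  by rewrite (bigD1 (lsite y))//= (bigD1 (rsite y)) ?rsite_lsite//= mulrA.
rewrite !prodE cl cr !ffunE !eqxx rsite_lsite cl cr mulrAC pf; congr (_ * _).
by apply: eq_bigr => z /andP[/negbTE zl /negbTE zr]; rewrite ffunE zl zr.
Qed.

Lemma bernC (x : R) b : bern x b + bern x (~~ b) = 1.
Proof. by case: b; rewrite /bern /=; ring. Qed.

Definition set_site z (b : bool) c : config := [ffun u => if u == z then b else c u].

Lemma avg_set_site p z b (F : @config m -> R) :
  bern (p z) b * avg p (fun c => F (set_site z b c)) =
  avg p (fun c => (c z == b)%:R * F c).
Proof.
pose flip c : @config m := [ffun u => if u == z then ~~ c u else c u].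
have flipK : involutive flip.
  by move=> c; apply/ffunP => u; rewrite !ffunE; case: eqP => // _; rewrite negbK.
have split : avg p (fun c => F (set_site z b c)) =
    avg p (fun c => (c z == b)%:R * F c) +
    avg p (fun c => (c z == ~~ b)%:R * F (flip c)).
  rewrite -pavgD; apply: eq_bigr => c _; congr (_ * _).
  have [cz|cz] := eqVneq (c z) b.
    have -> : set_site z b c = c by apply/ffunP => u; rewrite ffunE; case: eqP => // ->.
    by rewrite cz; case: b {cz} => /=; rewrite mul1r mul0r addr0.
  have cz' : c z = ~~ b by move: cz; case: (c z); case: b.
  have -> : set_site z b c = flip c.
    by apply/ffunP => u; rewrite !ffunE; case: eqP => // ->; rewrite cz' negbK.
  by rewrite cz' eqxx mul0r add0r mul1r.
have prodE c' : \prod_u bern (p u) (c' u) =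
    bern (p z) (c' z) * \prod_(u < m.+1 | u != z) bern (p u) (c' u).
  by rewrite (bigD1 z).
have -> : bern (p z) b * avg p (fun c => F (set_site z b c)) =
  bern (p z) b * avg p (fun c => (c z == b)%:R * F c) +
  bern (p z) (~~ b) * avg p (fun c => (c z == b)%:R * F c).
  rewrite split mulrDr; congr (_ + _).
  rewrite -[LHS]pavgZ -[RHS]pavgZ [LHS](reindex_inj (inv_inj flipK)) /=.
  apply: eq_bigr => c _; rewrite flipK !prodE ffunE eqxx.
  have -> : \prod_(u < m.+1 | u != z) bern (p u) (flip c u) =
            \prod_(u < m.+1 | u != z) bern (p u) (c u).
    by apply: eq_bigr => u /negbTE uz; rewrite ffunE uz.
  have [->|cz] := eqVneq (c z) b; first by rewrite eqxx; ring.
  rewrite (inj_eq negb_inj) (negbTE cz).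
  by rewrite !mul0r !mulr0.
by rewrite -mulrDl bernC mul1r.
Qed.

End Involutions.

Section OpenChain.
Context {R : realType} (m : nat) (wR wL al be theta : R) (ob : 'I_m).
Hypotheses (al01 : 0 < al < 1) (be01 : 0 < be < 1)
  (thetaE : expR theta = al * (1 - be) / (be * (1 - al))).
Let o : 'I_m.+1 := lsite ob.

(* Boundary reservoirs: the left one has density [al], the right one density [be];
   [e.1] is the side, [e.2] the occupation forced on the end site. *)
Definition res_rate (e : bool * bool) : R :=
  if e.1 then (if e.2 then wR * al else wL * (1 - al))
  else (if e.2 then wL * be else wR * (1 - be)).

Definition open_op (S : Type) (st : 'I_m -> bool -> S -> S)
    (ext : bool * bool -> S -> S) (V : S -> R) (s : S) : R :=
  bond_op wR wL st V s + \sum_e res_rate e * (V (ext e s) - V s).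

Definition end_site (b : bool) : 'I_m.+1 := if b then ord0 else ord_max.

Definition flux y d (c : @config m) : R :=
  if y == ob then (d && c (lsite y) && ~~ c (rsite y))%:R -
                  (~~ d && ~~ c (lsite y) && c (rsite y))%:R else 0.

Definition flux_step y d (s : @config m * R) := (hop y d s.1, s.2 + flux y d s.1).
Definition flux_ext (e : bool * bool) (s : @config m * R) :=
  (set_site (end_site e.1) e.2 s.1, s.2).

(** On such observables the chain with recorded flux reduces to a chain on configurations, tilted by
    [expR (- theta)] per crossing of [ob], and the flux may be started from zero. *)
Definition homogeneous (W : @config m * R -> R) :=
  forall c j, W (c, j) = expR (- theta * j) * W (c, 0).

Lemma open_op_homogeneous W : homogeneous W ->
  homogeneous (open_op flux_step flux_ext W).
Proof.
move=> hW c j; rewrite /open_op /bond_op !mulrDr [W (c, j)]hW; congr (_ + _ + _).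
- by rewrite mulrCA.
- rewrite mulr_sumr; apply: eq_bigr => y _; rewrite /flux_step /= !add0r mulrDr.
  rewrite (hW _ (j + flux y true c)) (hW _ (j + flux y false c)).
  rewrite (hW _ (flux y true c)) (hW _ (flux y false c)).
  by rewrite !mulrDr !expRD; ring.
- rewrite mulr_sumr; apply: eq_bigr => e _; rewrite /flux_ext /=.
  by rewrite [W (set_site _ _ _, _)]hW; ring.
Qed.

Let mu := dens o al al be.

Let mu_eq y : mu (lsite y) = mu (rsite y) \/ y = ob.
Proof.
rewrite /mu /dens /o; have [->|yo] := eqVneq y ob; first by right.
left; have {}yo : (y != ob :> nat) by [].
rewrite -!val_eqE /= /bump /= add1n.
by case: (ltngtP y ob) yo => // yo _; case: (ltngtP y.+1 ob) => //; lia.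
Qed.

Let mu_ob : mu (lsite ob) = al /\ mu (rsite ob) = be.
Proof.
by rewrite /mu /dens /o ltnn eqxx rsite_lsite /= /bump /= add1n ltnNge leqnSn.
Qed.

(** This is where [theta] comes from: the tilt compensates the change of weight of [mu] when a
    particle crosses [ob], so every bond looks as if it had equal densities at its ends. *)
Let mu_ratio y : let f := if y == ob then expR (- theta) else 1 in
  mu (lsite y) * (1 - mu (rsite y)) * f = (1 - mu (lsite y)) * mu (rsite y).
Proof.
have [al0 al1] := andP al01; have [be0 be1] := andP be01.
rewrite /=; case: (mu_eq y) => [E|->].
  case: eqVneq => [yo|_]; last by rewrite E; ring.
  have [a b] := mu_ob; rewrite yo a b in E *; rewrite E expRN thetaE E.
  by rewrite divff ?invr1; [ring|rewrite mulf_neq0 ?subr_eq0 ?gt_eqF//].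
have [-> ->] := mu_ob; rewrite eqxx expRN thetaE.
by field; rewrite !subr_eq0 !gt_eqF.
Qed.

(** Exchanging the two occupations is a bijection that multiplies the weight by the factor the tilt
    undoes. It transfers the ring from [W] to the measure and leaves the asymmetry times a discrete
    gradient. *)
Lemma bond_avg (W : @config m * R -> R) y : homogeneous W ->
  avg mu (fun c => wR * W (flux_step y true (c, 0)) +
                   wL * W (flux_step y false (c, 0))) =
  avg mu (fun c => (wR + wL + (wR - wL) *
     ((c (rsite y))%:R - (c (lsite y))%:R)) * W (c, 0)).
Proof.
move=> hW; pose f := if y == ob then expR (- theta) else 1.
have f0 : f != 0 by rewrite /f; case: ifP => _; rewrite ?oner_eq0// gt_eqF ?expR_gt0.
have fr := mu_ratio y; rewrite -/f /= in fr.
have E1 : avg mu (fun c => ((c (lsite y) == true) && (c (rsite y) == ~~ true))%:R *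
      (f * W (exchange y c, 0))) =
    avg mu (fun c => ((c (lsite y) == ~~ true) && (c (rsite y) == true))%:R * W (c, 0)).
  by apply: (@avg_exchange _ _ mu y f true (fun c => W (c, 0))); rewrite /bern /=.
have E2 : avg mu (fun c => ((c (lsite y) == false) && (c (rsite y) == ~~ false))%:R *
      (f^-1 * W (exchange y c, 0))) =
    avg mu (fun c => ((c (lsite y) == ~~ false) && (c (rsite y) == false))%:R * W (c, 0)).
  apply: (@avg_exchange _ _ mu y f^-1 false (fun c => W (c, 0))); rewrite /bern /=.
  by rewrite -fr mulfK.
transitivity (avg mu (fun c => wR * (((c (lsite y) == true) && (c (rsite y) == ~~ true))%:R *
      (f * W (exchange y c, 0)))) +
    avg mu (fun c => wL * (((c (lsite y) == false) && (c (rsite y) == ~~ false))%:R *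
      (f^-1 * W (exchange y c, 0)))) +
    avg mu (fun c => (wR * (~~ (c (lsite y) && ~~ c (rsite y)))%:R +
                      wL * (~~ (~~ c (lsite y) && c (rsite y)))%:R) * W (c, 0))).
  rewrite -!pavgD; apply: eq_bigr => c _; congr (_ * _); rewrite /flux_step /= !add0r.
  rewrite (hW _ (flux y true c)) (hW _ (flux y false c)) /flux.
  have h10 d : c (lsite y) = c (rsite y) -> hop y d c = c.
    move=> E; apply/ffunP => z; rewrite hopE E; case: (siteP y z) => [->|->|//];
    by case: d; rewrite ?E ?andbb ?orbb.
  have h1 : c (lsite y) && ~~ c (rsite y) -> hop y true c = exchange y c /\ hop y false c = c.
    move=> /andP[cl /negbTE cr]; split; apply/ffunP => z; rewrite hopE ?ffunE cl cr //.
    by case: (siteP y z) => [->|->|//]; rewrite ?cl ?cr.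
  have h2 : ~~ c (lsite y) && c (rsite y) -> hop y false c = exchange y c /\ hop y true c = c.
    move=> /andP[/negbTE cl cr]; split; apply/ffunP => z; rewrite hopE ?ffunE cl cr //.
    by case: (siteP y z) => [->|->|//]; rewrite ?cl ?cr.
  have fE : expR (- theta * (if y == ob then 1 else 0)) = f.
    by rewrite /f; case: ifP; rewrite ?mulr1 // mulr0 expR0.
  have fE' : expR (- theta * (if y == ob then - 1 else 0)) = f^-1.
    by rewrite -fE -expRN; congr expR; case: ifP => _; ring.
  have fE0 : expR (- theta * (if y == ob then 0 else 0)) = 1.
    by case: ifP; rewrite mulr0 expR0.
  case cl: (c (lsite y)) h10 h1 h2; case cr: (c (rsite y)) => /= h10 h1 h2.
  - by rewrite !h10 // subr0 fE0; ring.
  - by have [-> ->] := h1 isT; rewrite ?subr0 fE fE0; ring.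
  - by have [-> ->] := h2 isT; rewrite ?subr0 sub0r fE' fE0; ring.
  - by rewrite !h10 // subr0 fE0; ring.
rewrite 2![avg mu (fun c => _ * (_ * _))]pavgZ [pavg _ _]E1 [X in _ + wL * X]E2 -!pavgZ -!pavgD.
apply: eq_bigr => c _; congr (_ * _).
by case: (c (lsite y)); case: (c (rsite y)) => /=; ring.
Qed.

Lemma sum_bool_pair (F : bool * bool -> R) :
  \sum_e F e = F (true, true) + F (true, false) + (F (false, true) + F (false, false)).
Proof.
transitivity (\sum_(a : bool) \sum_(b : bool) F (a, b)); last by rewrite !big_bool.
by rewrite pair_big; apply: eq_bigr => [[]].
Qed.

Let mu0 : mu ord0 = al.
Proof.
rewrite /mu /dens /o -val_eqE /=.
by case: (ltngtP 0%N ob) => //; rewrite ?ltn0.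
Qed.

Let mu_max : mu ord_max = be.
Proof.
rewrite /mu /dens /o -val_eqE /=; have := ltn_ord ob.
by case: ltngtP.
Qed.

Lemma end_avg (W : @config m * R -> R) :
  avg mu (fun c => \sum_e res_rate e * (W (flux_ext e (c, 0)) - W (c, 0))) =
  avg mu (fun c => ((wR - wL) * ((c ord0)%:R - (c ord_max)%:R + be - al)) * W (c, 0)).
Proof.
have E z b w : w * bern (mu z) b * avg mu (fun c => W (set_site z b c, 0)) =
    avg mu (fun c => w * ((c z == b)%:R * W (c, 0))).
  rewrite -mulrA (avg_set_site mu z b (fun c => W (c, 0))).
  by rewrite -[LHS]pavgZ.
transitivity (wR * bern (mu ord0) true * avg mu (fun c => W (set_site ord0 true c, 0)) +
  wL * bern (mu ord0) false * avg mu (fun c => W (set_site ord0 false c, 0)) +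
  (wL * bern (mu ord_max) true * avg mu (fun c => W (set_site ord_max true c, 0)) +
   wR * bern (mu ord_max) false * avg mu (fun c => W (set_site ord_max false c, 0))) +
  avg mu (fun c => - (\sum_e res_rate e) * W (c, 0))).
  rewrite mu0 mu_max -4!pavgZ -!pavgD; apply: eq_bigr => c _; congr (_ * _).
  by rewrite !sum_bool_pair /res_rate /flux_ext /end_site /bern /=; ring.
rewrite !E -!pavgD; apply: eq_bigr => c _; congr (_ * _).
rewrite sum_bool_pair /res_rate /=.
by case: (c ord0); case: (c ord_max) => /=; ring.
Qed.

(** The gradients telescope to the two end sites, where the reservoirs produce the opposite terms.
    Only a constant survives, so [mu] is an exact left eigenvector of the tilted chain. *)
Lemma open_op_avg W : homogeneous W ->
  avg mu (fun c => open_op flux_step flux_ext W (c, 0)) =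
  (1 + (wR - wL) * (be - al)) * avg mu (fun c => W (c, 0)).
Proof.
move=> hW; rewrite /open_op /bond_op [LHS]pavgD [X in X + _]pavgD [X in _ + X]end_avg.
have -> : pavg (fun z => bern (mu z)) (fun c => \sum_y
    (wR * W (flux_step y true (c, 0)) + wL * W (flux_step y false (c, 0)))) =
  \sum_y avg mu (fun c => (wR + wL + (wR - wL) *
     ((c (rsite y))%:R - (c (lsite y))%:R)) * W (c, 0)).
  rewrite /pavg; under eq_bigr do rewrite mulr_sumr.
  by rewrite exchange_big; apply: eq_bigr => y _; exact: bond_avg.
rewrite /avg /pavg exchange_big /= -!big_split mulr_sumr; apply: eq_bigr => c _.
have T : \sum_(y < m) ((c (rsite y))%:R - (c (lsite y))%:R) =
    (c ord_max)%:R - (c ord0)%:R :> R.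
  have e : (c ord0)%:R + \sum_(y < m) (c (rsite y))%:R =
      \sum_(y < m) (c (lsite y))%:R + (c ord_max)%:R :> R.
    transitivity (\sum_(z < m.+1) (c z)%:R : R); first by rewrite [RHS]big_ord_recl.
    by rewrite [LHS]big_ord_recr.
  by rewrite sumrB; apply/eqP; rewrite subr_eq addrAC eq_sym subr_eq addrC -e addrC.
set P := \prod_z _; set w := W _.
have -> : \sum_(y < m) P * ((wR + wL + (wR - wL) * ((c (rsite y))%:R -
    (c (lsite y))%:R)) * w) =
  P * w * (m%:R * (wR + wL) + (wR - wL) * ((c ord_max)%:R - (c ord0)%:R)).
  transitivity (\sum_(y < m) P * w * ((wR + wL) + (wR - wL) *
    ((c (rsite y))%:R - (c (lsite y))%:R))); first by apply: eq_bigr => y _; ring.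
  by rewrite -mulr_sumr big_split /= sumr_const card_ord -[_ *+ m]mulr_natl -mulr_sumr T.
by rewrite /=; ring.
Qed.

Lemma open_mgf n (G : @config m -> R) :
  avg mu (fun c => iter n (open_op flux_step flux_ext)
     (fun s => expR (- theta * s.2) * G s.1) (c, 0)) =
  (1 + (wR - wL) * (be - al)) ^+ n * avg mu G.
Proof.
pose V0 (s : @config m * R) := expR (- theta * s.2) * G s.1; rewrite -/V0.
have hV k : homogeneous (iter k (open_op flux_step flux_ext) V0).
  elim: k => [|k IH]; last exact: open_op_homogeneous.
  by move=> c j; rewrite /V0 /= mulr0 expR0 mul1r.
elim: n => [|n IH].
  rewrite expr0 mul1r; apply: eq_bigr => c _.
  by rewrite /V0 /= mulr0 expR0 mul1r.
by rewrite exprS -mulrA -IH -open_op_avg.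
Qed.

End OpenChain.

Section CountReal.
Context {R : realType} (m : nat).

Lemma cntE (c : @config m) k : (cnt c k)%:R = \sum_(z < m.+1) (z < k)%N%:R * (c z)%:R :> R.
Proof.
rewrite /cnt big_mkcond natr_sum; apply: eq_bigr => z _.
by case: ifP; rewrite ?mul1r ?mul0r.
Qed.

Lemma sum_ltn k : (k <= m.+1)%N -> \sum_(z < m.+1) (z < k)%N%:R = k%:R :> R.
Proof.
move=> km; rewrite -natr_sum; congr _%:R.
rewrite (eq_bigr (fun z : 'I_m.+1 => if (z < k)%N then 1%N else 0%N)); last by move=> z _; case: ifP.
by rewrite -big_mkcond /= (big_ord_narrow km) sum1_card card_ord.
Qed.

End CountReal.

Section OpenOp.
Context {R : realType} (m : nat) (wR wL al be : R).
Hypotheses (wR0 : 0 <= wR) (wL0 : 0 <= wL) (al01 : 0 < al < 1) (be01 : 0 < be < 1)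
  (wm : m%:R * (wR + wL) + \sum_e res_rate wR wL al be e <= 1).
Local Notation open_op := (open_op wR wL al be).

Lemma res_rate_ge0 e : 0 <= res_rate wR wL al be e.
Proof.
have [a0 a1] := andP al01; have [b0 b1] := andP be01.
by case: e => [[] []]; rewrite /res_rate /= mulr_ge0 // ?subr_ge0 ltW.
Qed.

Lemma open_opE S (st : 'I_m -> bool -> S -> S) (ext : bool * bool -> S -> S) V s :
  open_op st ext V s =
  (1 - m%:R * (wR + wL) - \sum_e res_rate wR wL al be e) * V s +
  \sum_y (wR * V (st y true s) + wL * V (st y false s)) +
  \sum_e res_rate wR wL al be e * V (ext e s).
Proof.
rewrite /open_op /bond_op.
under [X in _ + X = _]eq_bigr do rewrite mulrBr.
by rewrite sumrB -mulr_suml; ring.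
Qed.

Lemma open_op_le_rel S1 S2 (st1 : 'I_m -> bool -> S1 -> S1) (ext1 : bool * bool -> S1 -> S1)
    (st2 : 'I_m -> bool -> S2 -> S2) (ext2 : bool * bool -> S2 -> S2)
    (rel : S1 -> S2 -> Prop) (V1 : S1 -> R) (V2 : S2 -> R) n s1 s2 :
  (forall y d s1 s2, rel s1 s2 -> rel (st1 y d s1) (st2 y d s2)) ->
  (forall e s1 s2, rel s1 s2 -> rel (ext1 e s1) (ext2 e s2)) ->
  (forall s1 s2, rel s1 s2 -> V1 s1 <= V2 s2) -> rel s1 s2 ->
  iter n (open_op st1 ext1) V1 s1 <= iter n (open_op st2 ext2) V2 s2.
Proof.
move=> Hst Hext HV; elim: n s1 s2 => [|n IH] s1 s2 r12; first exact: HV.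
rewrite !iterS !open_opE; apply: lerD; last first.
  by apply: ler_sum => e _; rewrite ler_wpM2l ?res_rate_ge0// IH//; exact: Hext.
apply: lerD; first by rewrite ler_wpM2l ?IH// -addrA -opprD subr_ge0.
by apply: ler_sum => y _; apply: lerD; rewrite ler_wpM2l ?IH//; exact: Hst.
Qed.

Lemma open_op_add S (st : 'I_m -> bool -> S -> S) (ext : bool * bool -> S -> S)
    (V1 V2 : S -> R) n s :
  iter n (open_op st ext) (fun s => V1 s + V2 s) s =
  iter n (open_op st ext) V1 s + iter n (open_op st ext) V2 s.
Proof.
elim: n s => [//|n IH] s; rewrite !iterS !open_opE IH.
set W1 := iter n _ V1 in IH *; set W2 := iter n _ V2 in IH *.
rewrite (eq_bigr (fun y => (wR * W1 (st y true s) + wL * W1 (st y false s)) +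
  (wR * W2 (st y true s) + wL * W2 (st y false s)))); last by move=> y _; rewrite !IH; ring.
rewrite [X in _ + _ + X = _](eq_bigr (fun e => res_rate wR wL al be e * W1 (ext e s) +
  res_rate wR wL al be e * W2 (ext e s))); last by move=> e _; rewrite IH mulrDr.
by rewrite !big_split /=; ring.
Qed.

Lemma open_op_proj S1 S2 (st1 : 'I_m -> bool -> S1 -> S1) (ext1 : bool * bool -> S1 -> S1)
    (st2 : 'I_m -> bool -> S2 -> S2) (ext2 : bool * bool -> S2 -> S2)
    (f : S1 -> S2) (V : S2 -> R) n s :
  (forall y d s, f (st1 y d s) = st2 y d (f s)) ->
  (forall e s, f (ext1 e s) = ext2 e (f s)) ->
  iter n (open_op st1 ext1) (fun s => V (f s)) s = iter n (open_op st2 ext2) V (f s).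
Proof.
move=> Hst Hext; elim: n s => [//|n IH] s; rewrite !iterS !open_opE IH.
congr (_ + _ + _); last by apply: eq_bigr => e _; rewrite IH Hext.
by apply: eq_bigr => y _; rewrite !IH !Hst.
Qed.

Lemma open_op_closed S (st : 'I_m -> bool -> S -> S) (V : S -> R) n s :
  iter n (open_op st (fun=> id)) V s = iter n (bond_op wR wL st) V s.
Proof.
elim: n s => [//|n IH] s; rewrite !iterS /open_op big1 ?addr0.
  by rewrite /bond_op IH; congr (_ + _); apply: eq_bigr => y _; rewrite !IH.
by move=> e _; rewrite subrr mulr0.
Qed.

Definition rung_step (y : 'I_m) (d : bool) (r : {set 'I_m}) : {set 'I_m} := y |: r.

Lemma bernoulli_ineq (y e : R) k : 0 <= y -> 0 <= e ->
  y ^+ k + k%:R * e * y ^+ k.-1 <= (y + e) ^+ k.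
Proof.
move=> y0 e0; elim: k => [|[|k] IH]; first by rewrite !mul0r addr0.
  by rewrite !expr1 expr0 mulr1 mul1r.
rewrite /= in IH *; rewrite [(y + e) ^+ _]exprS.
apply: le_trans (_ : (y + e) * (y ^+ k.+1 + k.+1%:R * e * y ^+ k) <= _).
  rewrite exprS -[k.+2%:R]natr1 !exprS.
  have : 0 <= e * k.+1%:R * e * y ^+ k by rewrite !mulr_ge0 ?exprn_ge0.
  lra.
by rewrite ler_wpM2l ?addr_ge0.
Qed.

(** One step rings at most one bond, which makes rings of different bonds negatively correlated: the
    bound is the value for independent bonds. In the induction, the first order terms in the
    expansion of a power are all that one step can produce. *)
Lemma all_rung_le (B : {set 'I_m}) n r : wR + wL <= 1 ->
  iter n (bond_op wR wL rung_step) (fun r => (B \subset r)%:R) r <=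
  (1 - (1 - (wR + wL)) ^+ n) ^+ #|B :\: r|.
Proof.
move=> w1; set w := wR + wL in w1 *; have w0 : 0 <= w by exact: addr_ge0.
have y01 k : 0 <= 1 - (1 - w) ^+ k <= 1.
  by rewrite subr_ge0 exprn_ile1 ?subr_ge0 ?gerBl//= exprn_ge0 ?subr_ge0.
elim: n r => [|n IH] r /=.
  rewrite expr0 subrr -finset.setD_eq0 -cards_eq0.
  by case: eqP => [->|/eqP]; rewrite ?expr0// -lt0n => /prednK <-; rewrite expr0n.
set y := 1 - (1 - w) ^+ n in IH; set k := #|B :\: r|.
have [y0 y1] := andP (y01 n).
have wm' : m%:R * w <= 1.
  by apply: le_trans wm; rewrite lerDl sumr_ge0// => e _; exact: res_rate_ge0.
have -> : 1 - (1 - w) ^+ n.+1 = y + w * (1 - y) by rewrite /y exprS; ring.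
apply: le_trans (bernoulli_ineq k y0 _); last by rewrite mulr_ge0 ?subr_ge0.
rewrite /bond_op -/w.
apply: (@le_trans _ _ ((1 - m%:R * w) * y ^+ k +
   \sum_(z < m) (w * (if z \in B :\: r then y ^+ k.-1 else y ^+ k)))).
  apply: lerD; first by rewrite ler_wpM2l ?subr_ge0// IH.
  apply: ler_sum => z _; rewrite -mulrDl ler_wpM2l//.
  apply: le_trans (IH _) _; rewrite /rung_step.
  have -> : B :\: (z |: r) = (B :\: r) :\ z by apply/finset.setP => u;
    rewrite !inE negb_or; case: (u == z); rewrite ?andbF.
  case: ifP => [zB|/negbT zB]; first by rewrite /k (cardsD1 z (B :\: r)) zB.
  by rewrite /k (cardsD1 z (B :\: r)) (negbTE zB).
have -> : \sum_(z < m) w * (if z \in B :\: r then y ^+ k.-1 else y ^+ k) =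
    w * (m%:R * y ^+ k + k%:R * (y ^+ k.-1 - y ^+ k)).
  rewrite -mulr_sumr; congr (_ * _).
  transitivity (\sum_(z < m) (y ^+ k + if z \in B :\: r then y ^+ k.-1 - y ^+ k else 0)).
    by apply: eq_bigr => z _; case: ifP => _; rewrite ?addr0 // addrC subrK.
  by rewrite big_split /= -big_mkcond /= !sumr_const card_ord !mulr_natl.
case: k => [|k]; first by rewrite !mul0r !expr0; lra.
by rewrite /= exprS le_eqVlt; apply/orP; left; apply/eqP; ring.
Qed.

End OpenOp.

Section TailMgf.
Context {R : realType} (m : nat) (wR wL al be theta kappa : R) (ob : 'I_m).
Hypotheses (wR0 : 0 <= wR) (wL0 : 0 <= wL) (al01 : 0 < al < 1) (be01 : 0 < be < 1)
  (wm : m%:R * (wR + wL) + \sum_e res_rate wR wL al be e <= 1)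
  (thetaE : expR theta = al * (1 - be) / (be * (1 - al)))
  (kappaE : expR kappa = (1 - be) / (1 - al)).
Let o : 'I_m.+1 := lsite ob.
Local Notation open_op := (open_op wR wL al be).

(** A site of density [be] tilted by [theta] and a site of density [al] tilted by [- theta]
    contribute inverse factors. This is why one [kappa] serves thresholds on both sides of the
    origin. *)
Lemma avg_tilt (x : nat) : (x <= m)%N ->
  avg (dens o al al be) (fun c => expR (theta * ((cnt c x.+1)%:R - (cnt c o.+1)%:R))) =
  expR (kappa * (x%:R - o%:R)).
Proof.
move=> xm; have [a0 a1] := andP al01; have [b0 b1] := andP be01.
pose eps (z : 'I_m.+1) : R := (z < x.+1)%N%:R - (z < o.+1)%N%:R.
transitivity (avg (dens o al al be) (fun c => \prod_z expR (theta * (eps z * (c z)%:R)))).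
  apply: eq_bigr => c _; congr (_ * _); rewrite !cntE -sumrB mulr_sumr expR_sum.
  by apply: eq_bigr => z _; rewrite -mulrBl.
rewrite /avg (pavg_prod _ (fun z (t : bool) => expR (theta * (eps z * t%:R)))) /=.
transitivity (\prod_z expR (kappa * eps z)).
  apply: eq_bigr => z _; rewrite big_bool /bern /= mulr1 !mulr0 expR0 /eps.
  rewrite /dens !ltnS -val_eqE /=.
  have F : be * (al * (1 - be) / (be * (1 - al))) + (1 - be) = (1 - be) / (1 - al).
    by field; rewrite !gt_eqF ?subr_gt0.
  have F' : al * (al * (1 - be) / (be * (1 - al)))^-1 + (1 - al) = ((1 - be) / (1 - al))^-1.
    by field; rewrite !gt_eqF ?subr_gt0.
  case: (leqP z x) => zx; case: (ltngtP z ob) => zo /=; rewrite ?zo ?subrr ?subr0 ?sub0r ?mulr0 ?mulr1 ?mulrN1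
    ?expR0 ?expRN ?thetaE ?kappaE ?mulr1 //; lra.
rewrite -expR_sum -mulr_sumr sumrB !sum_ltn ?ltnS //; last exact: ltnW (ltn_ord ob).
by rewrite -!natr1; congr expR; ring.
Qed.

Definition joint_step y d (s : @config m * (@config m * R) * {set 'I_m}) :=
  (hop y d s.1.1, flux_step ob y d s.1.2, y |: s.2).
Definition joint_ext e (s : @config m * (@config m * R) * {set 'I_m}) :=
  (s.1.1, flux_ext e s.1.2, s.2).

Definition left_bonds (lo : nat) : {set 'I_m} := [set y : 'I_m | (y < lo)%N].
Definition right_bonds (hi : nat) : {set 'I_m} := [set y : 'I_m | (hi <= y)%N].

(** The reservoirs act at the ends of the box, and no influence crosses a bond that has not rung.
    Quantifying over all pairs of bonds still silent, instead of fixing one pair, gives an invariant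
    of the joint chain, as the set of rung bonds only grows. *)
Definition agree (n0 : nat) (s : @config m * (@config m * R) * {set 'I_m}) : Prop :=
  forall y1 y2 : 'I_m, (y1 < ob)%N -> (ob < y2)%N -> y1 \notin s.2 -> y2 \notin s.2 ->
  (forall z : 'I_m.+1, (y1 < z <= y2)%N -> s.1.1 z = s.1.2.1 z) /\
  n0%:R - (cnt s.1.1 o.+1)%:R = s.1.2.2.

Lemma agree_step n0 y d s : agree n0 s -> agree n0 (joint_step y d s).
Proof.
case: s => [[c [e j]] r] H y1 y2 h1 h2; rewrite /= !finset.in_setU1 !negb_or.
move=> /andP[yy1 r1] /andP[yy2 r2]; have [/= ce jE] := H _ _ h1 h2 r1 r2.
have {}yy1 : (y1 != y :> nat) by []. have {}yy2 : (y2 != y :> nat) by [].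
have inb (P : bool) : (y1 < y < y2)%N -> c (lsite y) = e (lsite y) /\ c (rsite y) = e (rsite y).
  by move=> /andP[a b]; split; apply: ce; rewrite /= ?/bump /=; lia.
split.
  move=> z zb; rewrite !hopE (ce z zb); case: (siteP y z) zb => [->|->|//] zb;
  by have [|-> ->//] := inb true; move: zb; rewrite /= /bump /=; lia.
rewrite /flux; case: eqP => [yo|yo].
  have [|cl cr] := inb true; first by rewrite yo h1 h2.
  rewrite -jE -cl -cr; move: (cnt_hopS y d c); rewrite yo.
  move=> /(congr1 (fun k : nat => k%:R : R)); rewrite !natrD.
  change (ob.+1) with (o.+1) => /eqP; rewrite -subr_eq -addrA => /eqP <-.
  by ring.
rewrite addr0 -jE cnt_hop // eqSS; apply/eqP => oy; apply: yo; apply/val_inj.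
by rewrite /= -oy.
Qed.

Lemma agree_ext n0 e s : agree n0 s -> agree n0 (joint_ext e s).
Proof.
case: s => [[c [e' j]] r] H y1 y2 h1 h2 /= r1 r2; have [/= ce jE] := H _ _ h1 h2 r1 r2.
split=> // z zb; rewrite ffunE ce //; case: eqP => // ze; exfalso.
move: zb; rewrite ze /end_site; case: (e.1) => /= => //.
have := ltn_ord y2; lia.
Qed.

Lemma agree_cnt n0 s (x lo hi : nat) : agree n0 s ->
  (lo <= x)%N -> (lo <= ob)%N -> (x <= hi)%N -> (ob < hi)%N ->
  ~~ (left_bonds lo \subset s.2) -> ~~ (right_bonds hi \subset s.2) ->
  n0%:R - (cnt s.1.1 x.+1)%:R =
  s.1.2.2 + ((cnt s.1.2.1 o.+1)%:R - (cnt s.1.2.1 x.+1)%:R).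
Proof.
move=> H lox loo xhi ohi /fintype.subsetPn[y1 + n1] /fintype.subsetPn[y2 + n2]; rewrite !inE => y1lo y2hi.
have [ce <-] := H _ _ (leq_trans y1lo loo) (leq_trans ohi y2hi) n1 n2.
suff E : (cnt s.1.1 x.+1)%:R - (cnt s.1.1 o.+1)%:R =
         (cnt s.1.2.1 x.+1)%:R - (cnt s.1.2.1 o.+1)%:R :> R by lra.
rewrite !cntE -!sumrB; apply: eq_bigr => z _; rewrite -!mulrBl !ltnS.
case: (leqP z x) => zx; case: (leqP z o) => zo; rewrite ?subrr ?mul0r //;
  rewrite ce //; move: zx zo; rewrite /o /= => zx zo; lia.
Qed.

(** A Chernoff bound for the closed chain, read on the open one as long as a bond on the far left
    and one on the far right stay silent; each [del] pays for one of these failing. The sign of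
    [theta] decides which tail of the current is covered. *)
Lemma hop_tail_mgf n (A : R) (P : nat -> @config m -> bool) (x lo hi : nat) (del : R) :
  (x <= m)%N -> (lo <= x)%N -> (lo <= ob)%N -> (x <= hi)%N -> (ob < hi)%N ->
  wR + wL <= 1 ->
  (forall N c, P N c -> 0 <= theta * (A - (N%:R - (cnt c x.+1)%:R))) ->
  (1 - (1 - (wR + wL)) ^+ n) ^+ #|left_bonds lo| <= del ->
  (1 - (1 - (wR + wL)) ^+ n) ^+ #|right_bonds hi| <= del ->
  avg (dens o al al be) (hop_tail wR wL o n P) <=
  expR (theta * A) * ((1 + (wR - wL) * (be - al)) ^+ n * expR (kappa * (x%:R - o%:R))) +
  (del + del).
Proof.
move=> xm lox loo xhi ohi w1 HP dl dr.
pose G (c : @config m) := expR (theta * ((cnt c x.+1)%:R - (cnt c o.+1)%:R)).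
pose F (s : @config m * R) := expR (- theta * s.2) * (expR (theta * A) * G s.1).
have key c : hop_tail wR wL o n P c <=
    iter n (open_op (flux_step ob) (@flux_ext R m)) F (c, 0) + (del + del).
  pose s0 : @config m * (@config m * R) * {set 'I_m} := (c, (c, 0), finset.set0).
  (* On states that agree, this dominates the indicator of [P]: either all bonds on one side have
     rung, or the exponential weight is at least one. *)
  pose V (s : @config m * (@config m * R) * {set 'I_m}) : R :=
    F s.1.2 + ((left_bonds lo \subset s.2)%:R + (right_bonds hi \subset s.2)%:R).
  pose Pc (c1 : @config m) : R := (P (cnt c o.+1) c1)%:R.
  have -> : hop_tail wR wL o n P c =
      iter n (open_op joint_step joint_ext) (fun s => Pc s.1.1) s0.
    rewrite (open_op_proj _ _ _ _ (st2 := hop) (ext2 := fun=> id) (f := fun s => s.1.1)) //.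
    by rewrite open_op_closed.
  apply: (@le_trans _ _ (iter n (open_op joint_step joint_ext) V s0)).
    pose rel s1 s2 := s1 = s2 /\ agree (cnt c o.+1) s1.
    apply: (@open_op_le_rel R m wR wL al be wR0 wL0 al01 be01 wm _ _ _ _ _ _ rel).
    - by move=> y d s1 _ [<- H]; split=> //; exact: agree_step.
    - by move=> e s1 _ [<- H]; split=> //; exact: agree_ext.
    - move=> s _ [<- H]; rewrite /V /Pc.
      have F0 : 0 <= F s.1.2 by rewrite !mulr_ge0 ?expR_ge0.
      case Ps : (P _ _); last by rewrite !addr_ge0.
      have [_|nl] := boolP (left_bonds lo \subset s.2).
        by rewrite /= addrCA lerDl addr_ge0.
      have [_|nr] := boolP (right_bonds hi \subset s.2).
        by rewrite /= addrA lerDr addr_ge0.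
      rewrite /= !addr0 /F /G -!expRD -[leLHS]expR0 ler_expR.
      have := HP _ _ Ps; rewrite (agree_cnt H lox loo xhi ohi nl nr).
      by congr (_ <= _); ring.
    - split=> // y1 y2 _ _ _ _; split=> //; by rewrite subrr.
  rewrite open_op_add; apply: lerD.
    by rewrite (open_op_proj _ _ _ _ (st2 := flux_step ob) (ext2 := @flux_ext R m) (f := fun s => s.1.2)).
  rewrite open_op_add.
  have rung (B : {set 'I_m}) k : (1 - (1 - (wR + wL)) ^+ n) ^+ #|B| <= k ->
      iter n (open_op joint_step joint_ext) (fun s => (B \subset s.2)%:R) s0 <= k.
    move=> Bk.
    rewrite (open_op_proj _ _ _ _ (st2 := @rung_step m) (ext2 := fun=> id) (f := fun s => s.2)
      (fun r => (B \subset r)%:R)) // open_op_closed.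
    have := all_rung_le wR0 wL0 al01 be01 wm B n finset.set0 w1.
    by rewrite finset.setD0 => /le_trans; apply.
  by apply: lerD; exact: rung.
apply: (@le_trans _ _ (avg (dens o al al be) (fun c =>
    iter n (open_op (flux_step ob) (@flux_ext R m)) F (c, 0) + (del + del)))).
  apply: ler_sum => c _; apply: ler_wpM2l (key c); apply: prodr_ge0 => z _.
  have [a0 a1] := andP al01; have [b0 b1] := andP be01.
  by rewrite /bern /dens; do !case: ifP => _; rewrite ?subr_ge0 ltW.
rewrite [leLHS]pavgD [X in _ + X]avg_cst lerD2r.
rewrite [leLHS](open_mgf wR wL ob al01 be01 thetaE n (fun c => expR (theta * A) * G c)).
have -> : avg (dens (lsite ob) al al be) (fun c => expR (theta * A) * G c) =
    expR (theta * A) * expR (kappa * (x%:R - o%:R)).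
  by rewrite [LHS]pavgZ -avg_tilt.
by rewrite mulrCA.
Qed.

End TailMgf.

(** * Particle-hole exchange and reflection *)

Section Symmetries.
Context {R : realFieldType} (m : nat) (w1 w2 p : R).
Hypotheses (w10 : 0 <= w1) (w20 : 0 <= w2) (p01 : 0 <= p <= 1)
  (wm : m%:R * (w1 + w2) <= 1).
Implicit Types (y : 'I_m) (d : bool) (c : @config m) (o z a : 'I_m.+1).

Lemma bond_op_swap S (st : 'I_m -> bool -> S -> S) n (V : S -> R) s :
  iter n (bond_op w1 w2 st) V s =
  iter n (bond_op w2 w1 (fun y d => st y (~~ d))) V s.
Proof.
elim: n s => [//|n IH] s; rewrite !iter_bond_op /= IH [w1 + w2]addrC.
by congr (_ + _); apply: eq_bigr => y _; rewrite !IH addrC.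
Qed.

Lemma bond_op_rev S (st : 'I_m -> bool -> S -> S) n (V : S -> R) s :
  iter n (bond_op w1 w2 st) V s =
  iter n (bond_op w2 w1 (fun y d => st (rev_ord y) (~~ d))) V s.
Proof.
elim: n s => [//|n IH] s; rewrite !iter_bond_op /= IH [w1 + w2]addrC.
congr (_ + _); rewrite (reindex_inj rev_ord_inj).
by apply: eq_bigr => y _ /=; rewrite !IH addrC.
Qed.

(** The second class particle remains second class among the holes, and has to stay an occupied
    site; whence the second disjunct. *)
Definition holes (s : @config m * 'I_m.+1) : @config m * 'I_m.+1 :=
  ([ffun z => ~~ s.1 z || (z == s.2)], s.2).

Lemma holes_step y d (s : @config m * 'I_m.+1) : s.1 s.2 ->
  holes (tagged_step y (~~ d) s) = tagged_step y d (holes s).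
Proof.
case: s => c a /= ca; rewrite /holes /tagged_step /=.
have lr := lsite_rsite y; have rl := rsite_lsite y.
have E : move y (~~ d) c a = move y d [ffun z => ~~ c z || (z == a)] a.
  rewrite /move; case: (siteP y a) ca => [->|->|//] ca;
    rewrite !ffunE ca !eqxx ?lr ?rl ?orbF /=.
  - by case: (c (rsite y)); case: d.
  - by rewrite andbT; case: (c (lsite y)); case: d.
congr pair => //; rewrite E {E}; apply/ffunP => z; rewrite ffunE !hopE !ffunE.
rewrite /move; case: (siteP y a) ca => [->|->|a1 a2 _ _] ca /=.
- rewrite !ffunE ca !eqxx ?lr ?rl ?orbF /=.
  by case: (siteP y z) => [->|->|z1 z2 _ _]; case: (c (rsite y)); case: d;
    rewrite /= ?eqxx ?lr ?rl ?z1 ?z2 ?orbF.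
- rewrite !ffunE ca !eqxx ?lr ?rl ?orbF /=.
  by case: (siteP y z) => [->|->|z1 z2 _ _]; case: (c (lsite y)); case: d;
    rewrite /= ?eqxx ?lr ?rl ?z1 ?z2 ?orbF.
have b1 : (lsite y == a) = false by rewrite eq_sym.
have b2 : (rsite y == a) = false by rewrite eq_sym.
case: (siteP y z) => [->|->|//]; rewrite ?b1 ?b2 ?orbF;
  by case: (c (lsite y)); case: (c (rsite y)); case: d.
Qed.

Lemma particle_hole_le n o (x : nat) :
  avg (dens o p 1 p) (fun c => iter n (bond_op w1 w2 tagged_step)
    (fun s => (x < s.2)%N%:R) (c, o)) <=
  avg (dens o (1 - p) 1 (1 - p)) (fun c => iter n (bond_op w2 w1 tagged_step)
    (fun s => (x < s.2)%N%:R) (c, o)).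
Proof.
pose flip c : @config m := [ffun z => if z == o then c z else ~~ c z].
have flipK : involutive flip.
  by move=> c; apply/ffunP => z; rewrite !ffunE; case: eqP => // _; rewrite negbK.
rewrite [leRHS](reindex_inj (inv_inj flipK)) /=; apply: ler_sum => c _.
have -> : \prod_z bern (dens o (1 - p) 1 (1 - p) z) (flip c z) =
          \prod_z bern (dens o p 1 p z) (c z).
  apply: eq_bigr => z _; rewrite ffunE /dens.
  have [->|zo] := eqVneq z o; first by rewrite ltnn.
  by case: ifP; case: (c z) => _; rewrite /bern /=; ring.
case co : (c o); last by rewrite (bigD1 o) //= /dens ltnn eqxx co /bern /= subrr !mul0r.
apply: ler_wpM2l.
  apply: prodr_ge0 => z _; have [p0 p1] := andP p01.
  by rewrite /bern /dens; do !case: ifP => _; rewrite ?subr_ge0.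
rewrite bond_op_swap.
have wm' : m%:R * (w2 + w1) <= 1 by rewrite addrC.
pose rel (s1 s2 : @config m * 'I_m.+1) := s1.1 s1.2 /\ s2 = holes s1.
apply: (@bond_op_le_rel R m w2 w1 w20 w10 wm' _ _ _ _ rel).
- move=> y d s1 _ [s1o ->]; split; last by rewrite holes_step.
  exact: move_occupied.
- by move=> s1 _ [_ ->].
- split=> //; congr pair; apply/ffunP => z; rewrite !ffunE /=.
  by case: eqP => [->|_]; rewrite ?co ?orbT ?orbF.
Qed.

Definition mirror (s : @config m * 'I_m.+1) : @config m * 'I_m.+1 :=
  ([ffun z => s.1 (rev_ord z)], rev_ord s.2).

Lemma rev_lsite y : rev_ord (lsite y) = rsite (rev_ord y).
Proof. by apply/val_inj; rewrite /= /bump /=; have := ltn_ord y; lia. Qed.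

Lemma rev_rsite y : rev_ord (rsite y) = lsite (rev_ord y).
Proof. by apply/val_inj; rewrite /= /bump /=; have := ltn_ord y; lia. Qed.

Lemma mirror_step y d s :
  mirror (tagged_step (rev_ord y) (~~ d) s) = tagged_step y d (mirror s).
Proof.
case: s => c a; rewrite /mirror /tagged_step /=; congr pair.
  apply/ffunP => z; rewrite ffunE !hopE !ffunE rev_lsite rev_rsite.
  have -> : (rev_ord z == lsite (rev_ord y)) = (z == rsite y).
    by rewrite -rev_rsite (inj_eq rev_ord_inj).
  have -> : (rev_ord z == rsite (rev_ord y)) = (z == lsite y).
    by rewrite -rev_lsite (inj_eq rev_ord_inj).
  by case: (siteP y z) => //; case: d => /=; rewrite ?[c (rsite _) && _]andbC
   ?[c (rsite _) || _]orbC.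
rewrite /move !ffunE rev_lsite rev_rsite.
have -> : (rev_ord a == lsite y) = (a == rsite (rev_ord y)).
  by rewrite -(inj_eq rev_ord_inj) rev_ordK rev_lsite.
have -> : (rev_ord a == rsite y) = (a == lsite (rev_ord y)).
  by rewrite -(inj_eq rev_ord_inj) rev_ordK rev_rsite.
rewrite orbC [c _ && _]andbC; case: ifP => // _.
by case: (_ && _); case: d; rewrite /= ?rev_lsite ?rev_rsite rev_ordK.
Qed.

Lemma reflection_le n o (x : nat) : (x <= m)%N -> rev_ord o = o ->
  avg (dens o p 1 p) (fun c => iter n (bond_op w1 w2 tagged_step)
    (fun s => (s.2 < x)%N%:R) (c, o)) <=
  avg (dens o p 1 p) (fun c => iter n (bond_op w2 w1 tagged_step)
    (fun s => (m - x < s.2)%N%:R) (c, o)).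
Proof.
move=> xm ro.
have flipK : involutive (fun c => [ffun z => c (rev_ord z)] : @config m).
  by move=> c; apply/ffunP => z; rewrite !ffunE rev_ordK.
rewrite [leRHS](reindex_inj (inv_inj flipK)) /=; apply: ler_sum => c _.
have -> : \prod_z bern (dens o p 1 p z) ([ffun z0 => c (rev_ord z0)] z) =
          \prod_z bern (dens o p 1 p z) (c z).
  rewrite (reindex_inj rev_ord_inj); apply: eq_bigr => z _ /=.
  rewrite ffunE rev_ordK; congr bern.
  rewrite /dens -{2}ro (inj_eq rev_ord_inj); case: eqVneq => [->|zo].
    by rewrite ro ltnn.
  by case: ifP; case: ifP.
apply: ler_wpM2l.
  apply: prodr_ge0 => z _; have [p0 p1] := andP p01.
  by rewrite /bern /dens; do !case: ifP => _; rewrite ?subr_ge0.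
rewrite bond_op_rev.
have wm' : m%:R * (w2 + w1) <= 1 by rewrite addrC.
pose rel (s1 s2 : @config m * 'I_m.+1) := s2 = mirror s1.
apply: (@bond_op_le_rel R m w2 w1 w20 w10 wm' _ _ _ _ rel).
- by move=> y d s1 _ ->; rewrite /rel mirror_step.
- move=> s1 _ -> /=; rewrite ler_nat; case: (ltnP s1.2 x) => // h.
  by rewrite (_ : (m - x < _)%N) //=; have := ltn_ord s1.2; lia.
- by rewrite /rel /mirror [rev_ord _]ro.
Qed.

End Symmetries.

(** * Exponents *)

Section Exponent.
Context {R : realType}.
Implicit Types (A xi b s x y k c u lam : R).

(** With [theta] and [kappa] written as logarithms, the Chernoff bound for a current at level [A] is
    the exponential of the difference of [cramer] between the two reservoir densities. Its critical
    points solve [A = b * (s * (1 - s)) - xi * s], the mean current at density [s]. *)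
Definition cramer A xi b s : R := A * ln s - (A + xi) * ln (1 - s) - b * s.

Lemma is_derive_cramer A xi b s : 0 < s < 1 ->
  is_derive s 1 (cramer A xi b) ((A + xi * s - b * (s * (1 - s))) / (s * (1 - s))).
Proof.
move=> /andP[s0 s1].
have h1 : is_derive s 1 (@ln R) s^-1 by exact: is_derive1_ln.
have h2 : is_derive s 1 (fun z : R => ln (1 - z)) (- (1 - s)^-1).
  have -> : - (1 - s)^-1 = (1 - s)^-1 * (0 - 1) by rewrite sub0r mulrN1.
  apply: (@is_derive1_comp _ (@ln R) (fun z : R => 1 - z)).
  by apply: is_derive1_ln; rewrite subr_gt0.
rewrite /cramer; apply: is_derive_eq.
rewrite -![_ *: _]/(_ * _); field.
by rewrite !gt_eqF ?subr_gt0.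
Qed.

Lemma cramer_mvt A xi b x y : 0 < x -> x < y -> y < 1 ->
  exists2 c, x < c < y & cramer A xi b y - cramer A xi b x =
    (A + xi * c - b * (c * (1 - c))) / (c * (1 - c)) * (y - x).
Proof.
move=> x0 xy y1.
have D z : z \in `[x, y]%R -> is_derive z 1 (cramer A xi b)
   ((A + xi * z - b * (z * (1 - z))) / (z * (1 - z))).
  rewrite in_itv /= => /andP[xz zy]; apply: is_derive_cramer.
  by rewrite (lt_le_trans x0 xz) (le_lt_trans zy y1).
have D' z : z \in `]x, y[%R -> is_derive z 1 (cramer A xi b)
   ((A + xi * z - b * (z * (1 - z))) / (z * (1 - z))).
  by move=> zI; apply: D; exact: (subset_itv_oo_cc zI).
have C : {within `[x, y], continuous (cramer A xi b)}%classic.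
  by apply: derivable_within_continuous => z zI; have [] := D z zI.
have [c cI E] := MVT xy D' C.
by exists c; rewrite // in_itv /= in cI.
Qed.

Lemma inv_var_ge4 c : 0 < c < 1 -> 4 <= (c * (1 - c))^-1.
Proof.
move=> /andP[c0 c1]; have p : 0 < c * (1 - c) by rewrite mulr_gt0 ?subr_gt0.
rewrite -[leRHS]mul1r ler_pdivlMr //.
have : 0 <= (c - 2^-1) ^+ 2 by exact: sqr_ge0.
by rewrite expr2; lra.
Qed.

(* With [b = gamma t] and [s = lam - y], the numerator of the derivative of
   [cramer A xi b] is [A - phi (lam - y)], where
   [phi (lam - y) = phi lam + u y - b y^2] when [xi = b (1 - 2 lam) + u]. *)
Lemma cramer_num A lam b u y :
  let s := lam - y in let xi := b * (1 - 2 * lam) + u in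
  A + xi * s - b * (s * (1 - s)) =
  A + xi * lam - b * (lam * (1 - lam)) - (u * y - b * y ^+ 2).
Proof. by rewrite /=; ring. Qed.

(** The unit of density is [u / b], reduced by [lam / 16] so that a shift by [4 * eps] keeps the
    density above [lam / 2] and the quadratic correction to the mean current stays below half of its
    linear part. *)
Lemma eps_facts lam b u : 0 < lam < 1 -> 0 < b -> 0 < u -> u <= 2 * b ->
  let eps := lam / 16 * u / b in
  [/\ 0 < eps, 4 * eps <= lam / 2 & b * eps <= u / 16].
Proof.
move=> /andP[l0 l1] b0 u0 ub eps.
have e0 : 0 < eps by rewrite /eps !mulr_gt0 ?invr_gt0 // divr_gt0 ?ltr0n.
have be : b * eps = lam / 16 * u by rewrite /eps mulrCA mulfV ?mulr1 // gt_eqF.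
have bl : b * eps <= u / 16.
  rewrite be mulrAC ler_wpM2r ?invr_ge0 ?ler0n //.
  by rewrite -[leRHS]mul1r ler_wpM2r // ltW.
split=> //; rewrite -(ler_pM2l b0) mulrCA be.
by have : lam * u <= lam * (2 * b) by [rewrite ler_wpM2l // ltW]; lra.
Qed.

Section Choice.
Variables (lam b u eps : R).
Hypotheses (lam01 : 0 < lam < 1) (b0 : 0 < b) (u0 : 0 < u)
  (e0 : 0 < eps) (el : 4 * eps <= lam / 2) (be : b * eps <= u / 16).
Local Notation xi := (b * (1 - 2 * lam) + u).
Local Notation rho := (lam - 2 * eps).
Local Notation lam' := (lam - 4 * eps).
Local Notation a := (b * (rho * (1 - rho)) - xi * rho).

(** The mean current at density [lam - y] varies as [u * y - b * y ^+ 2], since the threshold lies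
    at distance [u] from the characteristic of [lam]; the quadratic term removes at most half of the
    slope on the range in use. *)
Lemma slope y1 y2 : 0 <= y1 -> y1 <= y2 -> y2 <= 4 * eps ->
  u / 2 * (y2 - y1) <= (u * y2 - b * y2 ^+ 2) - (u * y1 - b * y1 ^+ 2).
Proof.
move=> y10 y12 y2e.
have -> : (u * y2 - b * y2 ^+ 2) - (u * y1 - b * y1 ^+ 2) =
  (u - b * (y1 + y2)) * (y2 - y1) by ring.
apply: ler_wpM2r; first by rewrite subr_ge0.
have h : b * (y1 + y2) <= 8 * (b * eps) by rewrite mulrCA ler_pM2l //; lra.
have := be; lra.
Qed.

(** [a] is the mean current at [rho], so [rho] is critical and the function increases towards [lam].
    The stretch up to [lam - eps] is only needed to be nonnegative; on the last stretch, of length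
    [eps], the numerator is at least [u * eps / 2] and the variance at most [1 / 4]. *)
Lemma cramer_upper : cramer a xi b rho - cramer a xi b lam <= - (2 * u * eps ^+ 2).
Proof.
have [l0 l1] := andP lam01; have h1 := b0; have h2 := u0; have h3 := e0; have h4 := el; have h5 := be.
have num y : a + xi * (lam - y) - b * ((lam - y) * (1 - (lam - y))) =
    (u * (2 * eps) - b * (2 * eps) ^+ 2) - (u * y - b * y ^+ 2).
  by rewrite cramer_num; ring.
have [|||c1 /andP[c1a c1b] E1] := @cramer_mvt a xi b rho (lam - eps); try lra.
have [|||c2 /andP[c2a c2b] E2] := @cramer_mvt a xi b (lam - eps) lam; try lra.
have F1 : 0 <= cramer a xi b (lam - eps) - cramer a xi b rho.
  rewrite E1 mulr_ge0 //; last by lra.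
  have -> : c1 = lam - (lam - c1) by ring.
  rewrite mulr_ge0 ?invr_ge0 ?mulr_ge0 //; try lra.
  rewrite num; have : u / 2 * (2 * eps - (lam - c1)) <=
    (u * (2 * eps) - b * (2 * eps) ^+ 2) - (u * (lam - c1) - b * (lam - c1) ^+ 2).
    by apply: slope; lra.
  apply: le_trans; rewrite mulr_ge0 //; lra.
have F2 : 2 * u * eps ^+ 2 <= cramer a xi b lam - cramer a xi b (lam - eps).
  rewrite E2 (_ : 2 * u * eps ^+ 2 = u / 2 * eps * 4 * (lam - (lam - eps))); last by field.
  apply: ler_wpM2r; first by lra.
  have -> : c2 = lam - (lam - c2) by ring.
  apply: ler_pM; rewrite ?mulr_ge0 //; try lra.
    rewrite num; have : u / 2 * (2 * eps - (lam - c2)) <=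
      (u * (2 * eps) - b * (2 * eps) ^+ 2) - (u * (lam - c2) - b * (lam - c2) ^+ 2).
      by apply: slope; lra.
    apply: le_trans; rewrite ler_wpM2l //; lra.
  by apply: inv_var_ge4; lra.
lra.
Qed.

(** Raising the level by [k] moves the critical point away from [rho], which may lose
    [u * eps ^+ 2 / 2] on the stretch next to [rho]. The bound on [k] keeps this at half of the gain
    [u * eps ^+ 2] made on the stretch next to [lam']. *)
Lemma cramer_lower k : 0 <= k -> k <= u * eps * (lam * (1 - lam)) / 4 ->
  cramer (a + k) xi b rho - cramer (a + k) xi b lam' <= - (u * eps ^+ 2 / 2).
Proof.
move=> k0 ku.
have [l0 l1] := andP lam01; have h1 := b0; have h2 := u0; have h3 := e0; have h4 := el; have h5 := be.
have num y : a + k + xi * (lam - y) - b * ((lam - y) * (1 - (lam - y))) =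
    k - ((u * y - b * y ^+ 2) - (u * (2 * eps) - b * (2 * eps) ^+ 2)).
  by rewrite cramer_num; ring.
have ue : 0 <= u * eps by rewrite mulr_ge0 // ltW.
have k4 : k <= u * eps / 4.
  apply: le_trans ku _; rewrite ler_wpM2r ?invr_ge0 ?ler0n // -[leRHS]mulr1.
  rewrite ler_wpM2l //; have : lam * (1 - lam) <= 1 * 1 by apply: ler_pM; lra.
  lra.
have [|||c1 /andP[c1a c1b] E1] := @cramer_mvt (a + k) xi b (lam - 3 * eps) rho; try lra.
have [|||c2 /andP[c2a c2b] E2] := @cramer_mvt (a + k) xi b lam' (lam - 3 * eps); try lra.
have F1 : cramer (a + k) xi b rho - cramer (a + k) xi b (lam - 3 * eps) <= u * eps ^+ 2 / 2.
  rewrite E1.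
  rewrite (_ : u * eps ^+ 2 / 2 = u * eps / 2 * (lam - 2 * eps - (lam - 3 * eps))); last by ring.
  apply: ler_wpM2r; first by lra.
  have c0 : 0 < c1 * (1 - c1) by rewrite mulr_gt0 //; lra.
  rewrite ler_pdivrMr //.
  apply: (@le_trans _ _ k).
    have -> : c1 = lam - (lam - c1) by ring.
    rewrite num; have : u / 2 * ((lam - c1) - 2 * eps) <=
      (u * (lam - c1) - b * (lam - c1) ^+ 2) - (u * (2 * eps) - b * (2 * eps) ^+ 2).
      by apply: slope; lra.
    have : 0 <= u / 2 * ((lam - c1) - 2 * eps) by rewrite mulr_ge0 //; lra.
    lra.
  apply: le_trans ku _.
  rewrite (_ : _ / 4 = u * eps / 2 * (lam / 2 * (1 - lam))); last by field.
  apply: ler_wpM2l; first by lra.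
  by apply: ler_pM; lra.
have F2 : cramer (a + k) xi b (lam - 3 * eps) - cramer (a + k) xi b lam' <= - (u * eps ^+ 2).
  rewrite E2.
  rewrite (_ : - (u * eps ^+ 2) = - (u * eps / 4 * 4) * (lam - 3 * eps - (lam - 4 * eps))); last by field.
  apply: ler_wpM2r; first by lra.
  rewrite -[leLHS]opprK lerN2 -mulNr; apply: ler_pM; rewrite ?divr_ge0 //.
    have -> : c2 = lam - (lam - c2) by ring.
    rewrite num; have : u / 2 * ((lam - c2) - 2 * eps) <=
      (u * (lam - c2) - b * (lam - c2) ^+ 2) - (u * (2 * eps) - b * (2 * eps) ^+ 2).
      by apply: slope; lra.
    have : u / 2 * eps <= u / 2 * ((lam - c2) - 2 * eps) by rewrite ler_wpM2l //; lra.
    lra.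
  by apply: inv_var_ge4; lra.
lra.
Qed.

End Choice.
End Exponent.

(** * The right tail for the finite chain *)

Section ChainTail.
Context {R : realType}.

Lemma card_left_bonds m lo : (lo <= m)%N -> #|left_bonds m lo| = lo.
Proof.
move=> lom; rewrite /left_bonds cardsE -sum1_card.
by rewrite (big_ord_narrow lom) sum1_card card_ord.
Qed.

Lemma card_right_bonds m hi : (hi <= m)%N -> #|right_bonds m hi| = (m - hi)%N.
Proof.
move=> him; have -> : right_bonds m hi = ~: left_bonds m hi.
  by apply/setP => y; rewrite !inE leqNgt.
by have := cardsC (left_bonds m hi); rewrite card_left_bonds // card_ord; lia.
Qed.

Lemma mgf_cramer (A xi b w al be : R) n : 0 < al < 1 -> 0 < be < 1 -> 0 <= w <= 1 ->
  w * n%:R = b ->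
  expR ((ln al - ln be + (ln (1 - be) - ln (1 - al))) * A) *
    ((1 + w * (be - al)) ^+ n * expR ((ln (1 - be) - ln (1 - al)) * xi)) <=
  expR (cramer A xi b al - cramer A xi b be).
Proof.
move=> /andP[a0 a1] /andP[b0 b1] /andP[w0 w1] wn.
have P : (1 + w * (be - al)) ^+ n <= expR (b * (be - al)).
  rewrite -wn mulrAC expRM_natr; apply: lerXn2r; rewrite ?nnegrE ?expR_ge0 ?expR_ge1Dx //.
  have : w * (al - be) <= 1 * 1 by rewrite -[leRHS]mulr1; nra.
  lra.
apply: (@le_trans _ _ (expR ((ln al - ln be + (ln (1 - be) - ln (1 - al))) * A) *
    (expR (b * (be - al)) * expR ((ln (1 - be) - ln (1 - al)) * xi)))).
  by rewrite ler_wpM2l ?expR_ge0 // ler_wpM2r ?expR_ge0.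
rewrite -!expRD ler_expR /cramer le_eqVlt; apply/orP; left; apply/eqP; ring.
Qed.

Lemma theta_ln (al be : R) : 0 < al < 1 -> 0 < be < 1 ->
  expR (ln al - ln be + (ln (1 - be) - ln (1 - al))) = al * (1 - be) / (be * (1 - al)).
Proof.
move=> /andP[a0 a1] /andP[b0 b1].
rewrite expRD !expRB !lnK ?posrE ?subr_gt0 //.
by field; rewrite !gt_eqF ?subr_gt0.
Qed.

Lemma kappa_ln (al be : R) : 0 < al < 1 -> 0 < be < 1 ->
  expR (ln (1 - be) - ln (1 - al)) = (1 - be) / (1 - al).
Proof. by move=> /andP[a0 a1] /andP[b0 b1]; rewrite expRB !lnK ?posrE ?subr_gt0. Qed.

Lemma bond_op_ge0 m (wR wL : R) S (st : 'I_m -> bool -> S -> S) (V : S -> R) n s :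
  0 <= wR -> 0 <= wL -> m%:R * (wR + wL) <= 1 -> (forall s, 0 <= V s) ->
  0 <= iter n (bond_op wR wL st) V s.
Proof.
move=> r0 l0 wm V0; rewrite -(bond_op_cst wR wL st 0 n s).
exact: bond_op_le.
Qed.

Lemma hop_tail_cramer m (wR wL al be A xi b : R) (ob : 'I_m) n
    (P : nat -> @config m -> bool) (x lo hi : nat) (del : R) :
  0 <= wL -> wL <= wR -> 0 < al < 1 -> 0 < be < 1 -> (m + 2)%:R * (wR + wL) <= 1 ->
  (wR - wL) * n%:R = b -> x%:R - ob%:R = xi ->
  (lo <= x)%N -> (lo <= ob)%N -> (x <= hi)%N -> (ob < hi)%N -> (hi <= m)%N ->
  (forall N c, P N c ->
     0 <= (ln al - ln be + (ln (1 - be) - ln (1 - al))) * (A - (N%:R - (cnt c x.+1)%:R))) ->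
  (1 - (1 - (wR + wL)) ^+ n) ^+ lo <= del ->
  (1 - (1 - (wR + wL)) ^+ n) ^+ (m - hi) <= del ->
  avg (dens (lsite ob) al al be) (hop_tail wR wL (lsite ob) n P) <=
  expR (cramer A xi b al - cramer A xi b be) + (del + del).
Proof.
move=> wL0 wLR al01 be01 wm bE xE lox loo xhi ohi him HP dl dr.
have wR0 : 0 <= wR := le_trans wL0 wLR.
have [a0 a1] := andP al01; have [b0 b1] := andP be01.
(* The reservoirs have total rate at most [2 * (wR + wL)], which accounts for [m + 2] in place of
   [m]. *)
have wm2 : m%:R * (wR + wL) + \sum_e res_rate wR wL al be e <= 1.
  apply: le_trans wm; rewrite natrD mulrDl lerD2l sum_bool_pair /res_rate /=.
  have h1 : wR * al <= wR * 1 by rewrite ler_wpM2l // ltW.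
  have h2 : wL * (1 - al) <= wL * 1 by rewrite ler_wpM2l //; lra.
  have h3 : wL * be <= wL * 1 by rewrite ler_wpM2l // ltW.
  have h4 : wR * (1 - be) <= wR * 1 by rewrite ler_wpM2l //; lra.
  lra.
have w1 : wR + wL <= 1.
  apply: le_trans wm; rewrite -[leLHS]mul1r ler_wpM2r ?addr_ge0 //.
  by rewrite (_ : 1 = 1%:R) // ler_nat addn2.
have lom : (lo <= m)%N := leq_trans lox (leq_trans xhi him).
have := @hop_tail_mgf R m wR wL al be _ _ ob wR0 wL0 al01 be01 wm2 (theta_ln al01 be01)
  (kappa_ln al01 be01) n A P x lo hi del (leq_trans xhi him) lox loo xhi ohi w1 HP.
rewrite card_left_bonds // card_right_bonds // => /(_ dl dr) /le_trans; apply.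
rewrite lerD2r (_ : nat_of_ord (lsite ob) = ob) // xE.
apply: mgf_cramer => //; first by rewrite subr_ge0 wLR /=; lra.
Qed.

Lemma expr_le_expR (q : R) k : 0 <= q -> q ^+ k <= expR (- (1 - q) * k%:R).
Proof.
move=> q0; rewrite expRM_natr lerXn2r ?nnegrE ?expR_ge0 //.
by apply: le_trans (expR_ge1Dx _); rewrite opprB addrC subrK.
Qed.

Theorem chain_right_tail (r l lam : R) : 0 <= l -> l < r -> 0 < lam < 1 ->
  exists C c : R, [/\ 0 < C, 0 < c &
  forall (m n : nat) (h u b del : R) (ob : 'I_m) (x lo hi : nat),
    0 < h -> (m + 2)%:R * (h * r + h * l) <= 1 -> (h * r - h * l) * n%:R = b ->
    0 < u -> u <= 2 * b -> x%:R - ob%:R = b * (1 - 2 * lam) + u ->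
    (lo <= x)%N -> (lo <= ob)%N -> (x <= hi)%N -> (ob < hi)%N -> (hi <= m)%N ->
    (1 - (1 - (h * r + h * l)) ^+ n) ^+ lo <= del ->
    (1 - (1 - (h * r + h * l)) ^+ n) ^+ (m - hi) <= del ->
    avg (dens (lsite ob) lam 1 lam) (fun c => iter n
       (bond_op (h * r) (h * l) tagged_step) (fun s => (x < s.2)%N%:R) (c, lsite ob)) <=
    C * expR (- (c * u ^+ 3) / b ^+ 2) + C * del].
Proof.
move=> l0 lr lam01; have [p0 p1] := andP lam01.
have r0 : 0 < r := le_lt_trans l0 lr.
pose q := l / r.
have q0 : 0 <= q by rewrite /q divr_ge0 // ltW.
have q1 : q < 1 by rewrite /q ltr_pdivrMr // mul1r.
have qE0 : q = l / r by []; clearbody q.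
pose c0 := (1 - q) * (lam * (1 - lam)) / 4.
(* [expR 1] pays for truncating [K] to an integer; [2 / lam] and [(1 - lam)^-1] bound the cost
   [rho^-1] and [(1 - rho)^-1] of freeing the origin. *)
pose C0 := (1 - q)^-1 * (expR 1 + 2 * (2 / lam + (1 - lam)^-1)).
have c00 : 0 < c0 by rewrite /c0 divr_gt0 ?ltr0n // !mulr_gt0 ?subr_gt0.
have C00 : 0 < C0.
  by rewrite /C0 mulr_gt0 ?invr_gt0 ?subr_gt0 // addr_gt0 ?expR_gt0 // mulr_gt0 //
    addr_gt0 ?invr_gt0 ?subr_gt0 // divr_gt0.
exists C0, (c0 * (lam / 16) ^+ 2); split=> //.
  by rewrite mulr_gt0 // exprn_gt0 // divr_gt0 ?ltr0n.
move=> m n h u b del ob x lo hi h0 wm bE u0 ub xE lox loo xhi ohi him dl dr.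
have b0 : 0 < b by lra.
have [e0 el be] := eps_facts lam01 b0 u0 ub; set eps := lam / 16 * u / b in e0 el be.
pose rho := lam - 2 * eps; pose lam' := lam - 4 * eps.
have rho01 : 0 < rho < 1 by rewrite /rho; lra.
have lam'01 : 0 < lam' < 1 by rewrite /lam'; lra.
have rl : rho < lam by rewrite /rho; lra.
have l'r : lam' < rho by rewrite /rho /lam'; lra.
have [rho0 rho1] := andP rho01; have [l'0 l'1] := andP lam'01.
have rho0' := ltW rho0.
have rho1' : 0 <= 1 - rho by rewrite subr_ge0 ltW.
set xi := b * (1 - 2 * lam) + u in xE.
pose a := b * (rho * (1 - rho)) - xi * rho.
(* The largest number of second class particles that [cramer_lower] tolerates. It is of order
   [u * eps], and as [eps <= 1] the power [q ^+ k] is no worse than the current terms, of exponent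
   [u * eps ^+ 2]. *)
pose K := u * eps * (lam * (1 - lam)) / 4.
have [e0' u0' p0' p1'] : [/\ 0 <= eps, 0 <= u, 0 <= lam & 0 <= 1 - lam].
  by split; rewrite ?subr_ge0 ltW.
have K0 : 0 <= K by apply: divr_ge0; [apply: mulr_ge0; exact: mulr_ge0|exact: ler0n].
pose k := Num.truncn K.
have /andP[kK Kk] := truncn_itv K0; rewrite -/k in kK Kk.
have wL0 : 0 <= h * l by rewrite mulr_ge0 // ltW.
have wLR : h * l < h * r by rewrite ltr_pM2l.
have wm1 : m%:R * (h * r + h * l) <= 1.
  by apply: le_trans wm; rewrite ler_wpM2r ?ler_nat ?leq_addr // addr_ge0 // (le_trans wL0) // ltW.
have qE : q = h * l / (h * r) by rewrite qE0; field; rewrite !gt_eqF.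
have lnlt (s t : R) : 0 < s -> s < t -> ln s < ln t by move=> s0 st; rewrite ltr_ln ?posrE // (lt_trans s0).
have th2 : ln rho - ln lam + (ln (1 - lam) - ln (1 - rho)) < 0.
  have h1 : ln rho - ln lam < 0 by rewrite subr_lt0 lnlt.
  have h2 : ln (1 - lam) - ln (1 - rho) < 0.
    by rewrite subr_lt0 lnlt ?subr_gt0 // ltrD2l ltrN2.
  by have := ltrD h1 h2; rewrite addr0.
have th1 : 0 < ln rho - ln lam' + (ln (1 - lam') - ln (1 - rho)).
  have h1 : 0 < ln rho - ln lam' by rewrite subr_gt0 lnlt.
  have h2 : 0 < ln (1 - lam') - ln (1 - rho).
    by rewrite subr_gt0 lnlt ?subr_gt0 // ltrD2l ltrN2.
  exact: addr_gt0.
have U := @hop_tail_cramer m (h * r) (h * l) rho lam a xi b ob n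
  (fun N c => a <= N%:R - (cnt c x.+1)%:R) x lo hi del wL0 (ltW wLR) rho01 lam01 wm bE xE
  lox loo xhi ohi him.
have {}U : avg (dens (lsite ob) rho rho lam) (hop_tail (h * r) (h * l) (lsite ob) n
    (fun N c => a <= N%:R - (cnt c x.+1)%:R)) <= expR (- (2 * u * eps ^+ 2)) + (del + del).
  apply: le_trans (U _ dl dr) _ => [N c Nc|].
    by rewrite mulr_le0 ?subr_le0 // ltW.
  by rewrite lerD2r ler_expR; exact: cramer_upper.
have V := @hop_tail_cramer m (h * r) (h * l) rho lam' (a + k%:R) xi b ob n
  (fun N c => N%:R - (cnt c x.+1)%:R < a + k%:R) x lo hi del wL0 (ltW wLR) rho01 lam'01 wm bE xE
  lox loo xhi ohi him.
have {}V : avg (dens (lsite ob) rho rho lam') (hop_tail (h * r) (h * l) (lsite ob) n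
    (fun N c => N%:R - (cnt c x.+1)%:R < a + k%:R)) <= expR (- (u * eps ^+ 2 / 2)) + (del + del).
  apply: le_trans (V _ dl dr) _ => [N c Nc|].
    by rewrite mulr_ge0 ?subr_ge0 // ltW.
  by rewrite lerD2r ler_expR; exact: cramer_lower.
have ht0 P c : 0 <= hop_tail (h * r) (h * l) (lsite ob) n P c.
  by apply: bond_op_ge0 => //; rewrite (le_trans wL0) // ltW.
have d01 (al ka be' : R) : 0 <= al <= 1 -> 0 <= ka <= 1 -> 0 <= be' <= 1 ->
    forall z, 0 <= dens (lsite ob) al ka be' z <= 1.
  by move=> ? ? ? z; rewrite /dens; do !case: ifP.
have U' := avg_le_density (o := lsite ob) (p := dens (lsite ob) rho 1 lam)
  (p' := dens (lsite ob) rho rho lam) (k := rho^-1) (ht0 _).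
have V' := avg_le_density (o := lsite ob) (p := dens (lsite ob) rho 0 lam')
  (p' := dens (lsite ob) rho rho lam') (k := (1 - rho)^-1) (ht0 _).
have dn (al ka be' : R) z : z != lsite ob ->
    dens (lsite ob) al ka be' z = dens (lsite ob) al rho be' z.
  by rewrite /dens => /negbTE ->.
have {}U' P : avg (dens (lsite ob) rho 1 lam) (hop_tail (h * r) (h * l) (lsite ob) n P) <=
    rho^-1 * avg (dens (lsite ob) rho rho lam) (hop_tail (h * r) (h * l) (lsite ob) n P).
  apply: U' => [z|z zo|s]; [by apply: d01; rewrite ?lexx ?ler01 //= ?ltW|exact: dn|].
  rewrite /dens ltnn eqxx; case: s; rewrite /bern /= ?mulVf ?gt_eqF // subrr.
  by rewrite mulr_ge0 // invr_ge0.
have {}V' P : avg (dens (lsite ob) rho 0 lam') (hop_tail (h * r) (h * l) (lsite ob) n P) <=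
    (1 - rho)^-1 * avg (dens (lsite ob) rho rho lam') (hop_tail (h * r) (h * l) (lsite ob) n P).
  apply: V' => [z|z zo|s]; [by apply: d01; rewrite ?lexx ?ler01 //= ?ltW|exact: dn|].
  rewrite /dens ltnn eqxx; case: s; rewrite /bern /= ?subr0 ?mulVf ?gt_eqF ?subr_gt0 //.
  by rewrite mulr_ge0 // invr_ge0.
have S := @tagged_split R m (h * r) (h * l) q (lsite ob) wL0 wLR qE wm1 lam rho lam' n x k a.
have {}S : (1 - q) * avg (dens (lsite ob) lam 1 lam) (fun c => iter n
       (bond_op (h * r) (h * l) tagged_step) (fun s => (x < s.2)%N%:R) (c, lsite ob)) <=
    q ^+ k + (rho^-1 * (expR (- (2 * u * eps ^+ 2)) + (del + del)) +
      (1 - rho)^-1 * (expR (- (u * eps ^+ 2 / 2)) + (del + del))).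
  apply: le_trans (S _ _) _; [by rewrite ltW //= ltW|by rewrite !ltW|].
  rewrite lerD2l; apply: lerD.
    by apply: le_trans (U' _) _; rewrite ler_wpM2l // invr_ge0.
  by apply: le_trans (V' _) _; rewrite ler_wpM2l // invr_ge0.
pose Z := u * eps ^+ 2.
have Z0 : 0 <= Z by rewrite /Z mulr_ge0 ?exprn_ge0 ?ltW.
have c04 : c0 <= 1 / 4.
  rewrite /c0 ler_wpM2r ?invr_ge0 ?ler0n // -[leRHS]mulr1.
  apply: ler_pM; rewrite ?gerBl ?subr_ge0 ?(ltW q1) ?mulr_ge0 //.
  by rewrite -[leRHS]mulr1; apply: ler_pM; rewrite ?gerBl ?(ltW p1).
have EZ : - (c0 * (lam / 16) ^+ 2 * u ^+ 3) / b ^+ 2 = - (c0 * Z).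
  by rewrite /Z /eps; field; rewrite gt_eqF.
rewrite EZ.
have B1 : q ^+ k <= expR 1 * expR (- (c0 * Z)).
  apply: le_trans (expr_le_expR k q0) _; rewrite -expRD ler_expR.
  have : c0 * Z <= (1 - q) * K.
    rewrite (_ : (1 - q) * K = c0 * (u * eps)); last by rewrite /K /c0; ring.
    rewrite ler_wpM2l ?(ltW c00) // /Z ler_wpM2l ?(ltW u0) // expr2 -[leRHS]mulr1.
    by rewrite ler_wpM2l ?(ltW e0) //; lra.
  have : (1 - q) * K <= (1 - q) * (k%:R + 1) by rewrite ler_wpM2l ?subr_ge0 ?natr1 ?ltW.
  lra.
have B2 : expR (- (2 * u * eps ^+ 2)) <= expR (- (c0 * Z)).
  by rewrite ler_expR lerN2 -mulrA -/Z ler_wpM2r //; lra.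
have B3 : expR (- (u * eps ^+ 2 / 2)) <= expR (- (c0 * Z)).
  by rewrite ler_expR lerN2 -/Z mulrC ler_wpM2l //; lra.
have del0 : 0 <= del.
  have w1 : h * r + h * l <= 1.
    apply: le_trans wm; rewrite -[leLHS]mul1r ler_wpM2r ?addr_ge0 ?(ltW (le_lt_trans wL0 wLR)) //.
    by rewrite (_ : 1 = 1%:R) // ler_nat addn2.
  apply: le_trans dl; apply: exprn_ge0; rewrite subr_ge0 exprn_ile1 ?subr_ge0 //.
  by rewrite lerBlDr lerDl addr_ge0 // (ltW (le_lt_trans wL0 wLR)).
have I1 : rho^-1 <= 2 / lam.
  have -> : 2 / lam = (lam / 2)^-1 by field; rewrite gt_eqF.
  by rewrite lef_pV2 ?posrE // ?divr_gt0 // /rho; lra.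
have I2 : (1 - rho)^-1 <= (1 - lam)^-1.
  by rewrite lef_pV2 ?posrE ?subr_gt0 // lerD2l lerN2 ltW.
set W := expR (- (c0 * Z)) in B1 B2 B3 *.
have W0 : 0 <= W by exact: expR_ge0.
have q1' : 0 < 1 - q by rewrite subr_gt0.
rewrite -(ler_pM2l q1'); apply: le_trans S _.
have -> : (1 - q) * (C0 * W + C0 * del) =
    expR 1 * W + (2 / lam + (1 - lam)^-1) * (2 * W) + expR 1 * del +
    ((2 / lam) * (del + del) + (1 - lam)^-1 * (del + del)).
  by rewrite /C0; field; rewrite !gt_eqF ?subr_gt0.
have T1 : rho^-1 * (expR (- (2 * u * eps ^+ 2)) + (del + del)) <= 2 / lam * (W + (del + del)).
  by apply: ler_pM; [rewrite invr_ge0|rewrite !addr_ge0 ?expR_ge0|exact: I1|rewrite lerD2r].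
have T2 : (1 - rho)^-1 * (expR (- (u * eps ^+ 2 / 2)) + (del + del)) <=
    (1 - lam)^-1 * (W + (del + del)).
  by apply: ler_pM; [rewrite invr_ge0|rewrite !addr_ge0 ?expR_ge0|exact: I2|rewrite lerD2r].
have T3 : 0 <= expR 1 * del by rewrite mulr_ge0 ?expR_ge0.
have T4 : 0 <= 2 / lam * W by rewrite !mulr_ge0 // invr_ge0.
have T5 : 0 <= (1 - lam)^-1 * W by rewrite mulr_ge0 // invr_ge0.
apply: le_trans (lerD B1 (lerD T1 T2)) _.
clear -T3 T4 T5; lra.
Qed.

End ChainTail.

(** * Discretised clocks *)

Section SingleClock.
Context {R : realFieldType} (rho : R).
Hypothesis rho0 : 0 <= rho.
Implicit Types (l : seq bool) (E : nat -> R) (j : nat).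

(* Bit lists record, most recent slot first, the slots of length [rho] in which a
   renewal process rings; [age] is the number of slots since the last ring. *)
Definition rings l : nat := count id l.
Definition age l : nat := find id l.

(** The grid restarts at each ring, every waiting time being rounded up to whole slots on its own.
    By memorylessness the slots are then exactly independent; the price is that slot times exceed
    true times by up to one slot per ring. Waiting times after the running one are left free. *)
Fixpoint slot_itv l j : interval R :=
  match l with
  | [::] => if j == 0%N then `]0, +oo[ else `]-oo, +oo[
  | true :: l' =>
      if j == rings l' then `](age l')%:R * rho, (age l').+1%:R * rho]
      else if j == (rings l').+1 then `]0, +oo[ else slot_itv l' j
  | false :: l' =>
      if j == rings l' then `](age l').+1%:R * rho, +oo[ else slot_itv l' j
  end.

Definition fits E l : Prop := forall j, E j \in slot_itv l j.

Lemma slot_itv_rings l : slot_itv l (rings l) = `](age l)%:R * rho, +oo[.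
Proof.
elim: l => [|[] l IH] /=; first by rewrite mul0r.
- by rewrite /rings /= add1n eqxx gtn_eqF //= mul0r.
- by rewrite /rings /= add0n eqxx.
Qed.

Lemma slot_itv_gt l j : (rings l < j)%N -> slot_itv l j = `]-oo, +oo[.
Proof.
elim: l => [|[] l IH] /=; first by case: j.
- rewrite /rings /= add1n => lj; rewrite !gtn_eqF //; last exact: ltnW.
  by apply: IH; exact: ltnW.
- by rewrite /rings /= add0n => lj; rewrite gtn_eqF // IH.
Qed.

Lemma fits_behead E b l : fits E (b :: l) -> fits E l.
Proof.
move=> H j; have := H j; case: b {H} => /=.
- case: eqP => [->|_]; first by rewrite slot_itv_rings !in_itv /= andbT => /andP[].
  case: eqP => [-> _|_ //]; by rewrite slot_itv_gt // in_itv.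
- case: eqP => [->|_ //]; rewrite slot_itv_rings !in_itv /= !andbT.
  by apply: le_lt_trans; rewrite ler_wpM2r // ler_nat.
Qed.

Lemma fits_cons E l : (forall j, 0 < E j) -> fits E l ->
  fits E ((E (rings l) <= (age l).+1%:R * rho) :: l).
Proof.
move=> E0 H j; have Hr := H (rings l); rewrite slot_itv_rings in_itv andbT /= in Hr.
case: leP => h /=.
- case: eqP => [->|_]; first by rewrite in_itv /= Hr h.
  by case: eqP => [_|_]; [rewrite in_itv /= E0|exact: H].
- by case: eqP => [->|_]; [rewrite in_itv /= h|exact: H].
Qed.

Lemma rings_size l : (rings l <= size l)%N. Proof. exact: count_size. Qed.

(** Rounding up adds at most one slot to each completed waiting time, so [rings l] slots bound the
    whole discretisation error. *)
Lemma fits_sum E l : fits E l ->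
  ((size l)%:R - (age l)%:R - (rings l)%:R) * rho <= \sum_(j < rings l) E j <=
  ((size l)%:R - (age l)%:R) * rho.
Proof.
elim: l => [|b l IH] H; first by rewrite big_ord0 !subrr mul0r lexx.
have /andP[I1 I2] := IH (fits_behead H).
have Hr := H (rings l).
case: b H Hr => H /=; rewrite eqxx /rings /age /= -/(rings l) -/(age l) ?add1n ?add0n.
- rewrite in_itv /= => /andP[h1 h2]; rewrite big_ord_recr /= subr0 -!natr1 in h2 *.
  by apply/andP; split; lra.
- by move=> _; rewrite -!natr1; apply/andP; split; lra.
Qed.

Lemma fits_rho0 E l : rho = 0 -> fits E l -> rings l = 0%N.
Proof.
move=> r0; elim: l => [//|[] l IH] H.
- have := H (rings l); rewrite /= eqxx in_itv /= r0 !mulr0 => /andP[h1].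
  by rewrite leNgt h1.
- by rewrite /rings /= add0n; apply: IH; exact: fits_behead H.
Qed.

End SingleClock.

(** * The graphical construction against its discretised history *)

Definition box_pos (N i : nat) : int := i%:Z - N%:Z.
(* The clock moving particles over the bond [(y, y + 1)] sits at its left end for right
   jumps and at its right end for left jumps. *)
Definition clock_pos (N y : nat) (d : bool) : int :=
  if d then box_pos N y else box_pos N y.+1.

Lemma block_interior (a b z n : nat) : (a < z <= b)%N -> (b < n)%N -> (0 < z)%N /\ (z < n)%N.
Proof.
move=> /andP[az zb] bn; split; first exact: leq_ltn_trans az.
exact: leq_ltn_trans bn.
Qed.

Lemma block_bond (a b z y : nat) : (a < z <= b)%N -> y != a -> y != b ->
  (z == y) || (z == y.+1) -> (a < y <= b)%N /\ (a < y.+1 <= b)%N.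
Proof. by lia. Qed.

Section Graphical.
Context {R : realType} {disp : measure_display} {Omega : measurableType disp}.
Variables (N : nat) (rR rL h T : R) (K : nat) (Y : asep_index -> Omega -> R) (w : Omega).
Local Notation m := (N.*2).
Local Notation event := (option ('I_m * bool)).
Local Notation rate := (clock_rate rR rL).

Definition ring (c : 'I_m * bool) (k : nat) : R :=
  ring_time rR rL Y w (clock_pos N c.1 c.2) c.2 k.
Definition waits (c : 'I_m * bool) (j : nat) : R := Y (inr (clock_pos N c.1 c.2, c.2, j)) w.
Definition bits (c : 'I_m * bool) (l : seq event) : seq bool := map (fun e => e == Some c) l.

Definition apply_event {S} (st : 'I_m -> bool -> S -> S) (e : event) (s : S) : S :=
  if e is Some (y, d) then st y d s else s.
Definition run {S} (st : 'I_m -> bool -> S -> S) (l : seq event) (s : S) : S :=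
  foldr (apply_event st) s l.

Hypothesis waits_gt0 : forall x d j, 0 < Y (inr (x, d, j)) w.
Hypothesis h0 : 0 < h.
Hypothesis rate0 : forall d, 0 <= rate d.

Definition compatible (l : seq event) := forall c, fits (rate c.2 * h) (waits c) (bits c l).
Definition nrings c l := rings (bits c l).

Lemma ringE c k : ring c k = (\sum_(i < k.+1) waits c i) / rate c.2.
Proof. by []. Qed.

Lemma ring_lt c k k' : 0 < rate c.2 -> (k < k')%N -> ring c k < ring c k'.
Proof.
move=> r0; elim: k' => // k' IH; rewrite ltnS leq_eqVlt => kk'.
have step j : ring c j < ring c j.+1.
  by rewrite !ringE ltr_pM2r ?invr_gt0 // [ltRHS]big_ord_recr /= ltrDl waits_gt0.
by case/orP: kk' => [/eqP -> //|/IH /lt_trans]; apply; exact: step.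
Qed.

Lemma ring_le c k k' : 0 < rate c.2 -> (k <= k')%N -> ring c k <= ring c k'.
Proof. by move=> r0; rewrite leq_eqVlt => /orP[/eqP -> //|/(ring_lt r0)/ltW]. Qed.

Lemma ring_gt0 c k : 0 < rate c.2 -> 0 < ring c k.
Proof.
move=> r0; apply: lt_le_trans (ring_le r0 (leq0n k)).
by rewrite ringE big_ord_recr big_ord0 /= add0r divr_gt0 // waits_gt0.
Qed.

Lemma compatible_ring_le l c k : compatible l -> 0 < rate c.2 -> (k < nrings c l)%N ->
  ring c k <= h * (size l)%:R.
Proof.
move=> H r0 kn; have rh : 0 <= rate c.2 * h by rewrite mulr_ge0 // ltW.
have /andP[_ I] := fits_sum rh (H c).
rewrite -/(nrings c l) in I; case: (nrings c l) kn I => [//|n]; rewrite ltnS => kn I.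
apply: le_trans (ring_le r0 kn) _; rewrite ringE ler_pdivrMr //.
apply: le_trans I _; rewrite size_map.
rewrite (_ : h * _ * _ = (size l)%:R * (rate c.2 * h)); last by ring.
by rewrite ler_wpM2r // lerBlDr lerDl.
Qed.

Lemma compatible_ring_gt l c : compatible l -> 0 < rate c.2 ->
  h * ((size l)%:R - (nrings c l)%:R) < ring c (nrings c l).
Proof.
move=> H r0; have rh : 0 <= rate c.2 * h by rewrite mulr_ge0 // ltW.
have /andP[I _] := fits_sum rh (H c).
have := H c (nrings c l); rewrite slot_itv_rings in_itv andbT /= => J.
rewrite ringE ltr_pdivlMr // big_ord_recr /=.
move: I; rewrite size_map /nrings => I; lra.
Qed.

Lemma nrings_rate0 l c : compatible l -> rate c.2 = 0 -> nrings c l = 0%N.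
Proof.
move=> H r0; have rh : 0 <= rate c.2 * h by rewrite mulr_ge0 // ltW.
by apply: (fits_rho0 rh _ (H c)); rewrite r0 mul0r.
Qed.

(** At these times exactly the rings recorded in [l] have happened. Histories and true times are
    compared only there, as slot times run ahead of ring times by amounts that depend on the
    clock. *)
Definition good_time l t := forall c, 0 < rate c.2 ->
  (forall k, (k < nrings c l)%N -> ring c k <= t) /\ t < ring c (nrings c l).

Lemma nrings_cons c e l : nrings c (e :: l) = ((e == Some c) + nrings c l)%N.
Proof. by []. Qed.

Variable eta : R -> int -> bool.
Variable init : int -> bool.
Hypothesis etaP : follows_asep rR rL Y w init eta.

Local Notation pos := (box_pos N).

Lemma box_pos_succ i : pos i + 1 = pos i.+1.
Proof. by rewrite /box_pos -addn1 PoszD; ring. Qed.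

Lemma no_ring l s t (c : 'I_m * bool) : good_time l s -> good_time l t ->
  ~ rings_in rR rL Y w (clock_pos N c.1 c.2) c.2 s t.
Proof.
move=> gs gt [r0 [k /andP[sk kt]]].
have [gs1 _] := gs c r0; have [_ gt2] := gt c r0.
have [kl|kl] := ltnP k (nrings c l).
  by have := gs1 k kl; rewrite leNgt => /negP; apply.
have := lt_le_trans gt2 (ring_le r0 kl); rewrite ltNge => /negP; apply.
exact: kt.
Qed.

Lemma eta_const (z : nat) s t : 0 <= s -> s <= t -> (0 < z)%N -> (z < m)%N ->
  (forall c : 'I_m * bool, (c.1 = z :> nat \/ c.1 = z.-1 :> nat) ->
     ~ rings_in rR rL Y w (clock_pos N c.1 c.2) c.2 s t) ->
  eta t (pos z) = eta s (pos z).
Proof.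
move=> s0 st z0 zm H; have [_ [P _]] := etaP; apply: P => //.
- exact: (H (Ordinal zm, true) (or_introl erefl)).
- have zm' : (z.-1 < m)%N by apply: leq_ltn_trans zm; exact: leq_pred.
  have := H (Ordinal zm', false) (or_intror erefl).
  by rewrite /clock_pos /= prednK.
- have zm' : (z.-1 < m)%N by apply: leq_ltn_trans zm; exact: leq_pred.
  have := H (Ordinal zm', true) (or_intror erefl).
  by rewrite /clock_pos /= -{2}(prednK z0) -box_pos_succ addrK.
- have := H (Ordinal zm, false) (or_introl erefl).
  by rewrite /clock_pos /= box_pos_succ.
Qed.

Lemma ring_effect (c : 'I_m * bool) k : 0 < rate c.2 ->
  let t := ring c k in let y := c.1 in exists s, [/\ 0 <= s, s < t,
    (forall r, s <= r < t -> eta r (pos y) = eta s (pos y) /\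
                             eta r (pos y.+1) = eta s (pos y.+1)) &
    eta t (pos y) = (if c.2 then eta s (pos y) && eta s (pos y.+1)
                     else eta s (pos y) || eta s (pos y.+1)) /\
    eta t (pos y.+1) = (if c.2 then eta s (pos y) || eta s (pos y.+1)
                     else eta s (pos y) && eta s (pos y.+1))].
Proof.
move=> r0 t y; have [_ [_ [PR PL]]] := etaP.
have ra : rings_at rR rL Y w (clock_pos N y c.2) c.2 t by split=> //; exists k.
case: c @t @y r0 ra => y [] /= r0 ra.
- have [s [/andP[s0 st] [Hs Hj]]] := PR _ _ ra; exists s; rewrite -box_pos_succ.
  split=> //; move: Hj; rewrite /clock_pos /jump.
  by case: (eta s (pos y)); case: (eta s (pos y + 1)) => /= -[-> ->].
- have [s [/andP[s0 st] [Hs Hj]]] := PL _ _ ra; exists s.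
  move: Hs Hj; rewrite /clock_pos /= -box_pos_succ addrK => Hs Hj.
  split=> // [r /Hs[]//|]; move: Hj; rewrite /jump.
  by case: (eta s (pos y)); case: (eta s (pos y + 1)) => /= -[-> ->].
Qed.

(* Rings of different clocks, and the final time, are separated by more than the
   discretisation error [K.+1 * h] of the ring times. *)
Hypothesis few : forall c, 0 < rate c.2 -> T + 1 < ring c K.
Hypothesis sep : forall c c' k k', 0 < rate c.2 -> 0 < rate c'.2 -> c != c' ->
  (k <= K)%N -> (k' <= K)%N -> ring c k <= T + 1 -> ring c' k' <= T + 1 ->
  K.+1%:R * h < `|ring c k - ring c' k'|.

Lemma nrings_le l c : compatible l -> 0 < rate c.2 -> h * (size l)%:R <= T + 1 ->
  (nrings c l <= K)%N.
Proof.
move=> H r0 hl; rewrite leqNgt; apply/negP => Kl.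
have := le_lt_trans (compatible_ring_le H r0 Kl) (le_lt_trans hl (few r0)).
by rewrite ltxx.
Qed.

Variables (y1 y2 : 'I_m) (c0 : @config m).
Hypothesis silent : forall y d, y = y1 \/ y = y2 -> 0 < rate d -> T < ring (y, d) 0%N.
Hypothesis init_box : forall z : 'I_m.+1, (y1 < z <= y2)%N -> init (pos z) = c0 z.

Lemma compatible_behead e l : compatible (e :: l) -> compatible l.
Proof. by move=> H c; apply: fits_behead (H c); rewrite mulr_ge0 // ltW. Qed.

(** Induction on the recorded events: the state at a good time is the one right after the last
    recorded ring, which acts on the state at a good time of the shorter list. The silent bonds [y1]
    and [y2] shut the block off from the infinite line. *)
Lemma run_agree l t : compatible l -> h * (size l)%:R <= T + 1 -> 0 <= t <= T ->
  good_time l t -> forall z : 'I_m.+1, (y1 < z <= y2)%N ->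
  eta t (pos z) = run hop l c0 z.
Proof.
elim: l t => [|[[y d]|] l IH] t H hl /andP[t0 tT] gt z zb; last first.
- have hl' : h * (size l)%:R <= T + 1.
    by apply: le_trans hl; rewrite ler_pM2l // ler_nat.
  by apply: IH => //; [exact: compatible_behead H|rewrite t0 tT].
- set c : 'I_m * bool := (y, d); set k := nrings c l; set t1 := ring c k.
  have H' := compatible_behead H.
  have hl' : h * (size l)%:R <= T + 1.
    by apply: le_trans hl; rewrite ler_pM2l // ler_nat.
  have r0 : 0 < rate c.2.
    rewrite lt_neqAle rate0 andbT eq_sym; apply/eqP => r0.
    by have := nrings_rate0 H r0; rewrite nrings_cons eqxx.
  have kK : (k <= K)%N by exact: nrings_le.
  have [gc1 gc2] := gt c r0; rewrite nrings_cons eqxx add1n -/k in gc1 gc2.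
  have t1t : t1 <= t by exact: gc1.
  have t10 : 0 < t1 by exact: ring_gt0.
  have t1T : t1 <= T := le_trans t1t tT.
  have t1low : h * (size l)%:R - h * K%:R < t1.
    apply: le_lt_trans (compatible_ring_gt H' r0); rewrite -/k mulrBr lerD2l lerN2.
    by rewrite ler_pM2l // ler_nat.
  pose del := K.+1%:R * h.
  have del0 : 0 < del by rewrite /del mulr_gt0.
  have delE : del = h * K%:R + h by rewrite /del -natr1; ring.
  have nr c' : c' != c -> nrings c' ((Some c) :: l) = nrings c' l.
    by move=> c'c; rewrite nrings_cons (inj_eq (@Some_inj _)) eq_sym (negbTE c'c).
  (* The rounding error of [t1] is less than [K.+1] slots, the separation imposed by [sep]. So a
     ring recorded before [t1] cannot come after it in true time, and precedes it by more than
     [del]. *)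
  have early c' j : c' != c -> 0 < rate c'.2 -> (j < nrings c' l)%N -> ring c' j < t1 - del.
    move=> c'c r0' jl; have [gc'1 _] := gt c' r0'; rewrite nr // in gc'1.
    have jt := gc'1 _ jl; have jh := compatible_ring_le H' r0' jl.
    have jK : (j <= K)%N by apply: leq_trans (ltnW jl) _; exact: nrings_le.
    have t1T1 : t1 <= T + 1 by apply: le_trans t1T _; rewrite lerDl.
    have jT1 : ring c' j <= T + 1 by exact: le_trans jh hl'.
    have := sep r0' r0 c'c jK kK jT1 t1T1; rewrite -/t1 -/del ltr_normr => /orP[S|S].
      exfalso; move: S; rewrite delE; apply/negP; rewrite -leNgt.
      rewrite lerBlDr; apply: le_trans jh _; rewrite ltrBlDr in t1low.
      by apply: le_trans (ltW t1low) _; rewrite addrAC [t1 + _]addrC lerDl ltW.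
    by rewrite ltrBrDl -ltrBrDr -opprB.
  have late c' j : c' != c -> 0 < rate c'.2 -> (nrings c' l <= j)%N -> t1 < ring c' j.
    move=> c'c r0' jl; have [_ gc'2] := gt c' r0'; rewrite nr // in gc'2.
    by apply: le_lt_trans t1t _; apply: lt_le_trans gc'2 _; exact: ring_le.
  have [s [s0 st1 sconst [sl sr]]] := @ring_effect c k r0.
  rewrite -/t1 /= in s0 st1 sconst sl sr.
  pose prev := if k is k'.+1 then ring c k' else 0.
  have prevlt : prev < t1.
    by rewrite /prev /t1; case: (k) => [|k']; [exact: ring_gt0|exact: ring_lt].
  (* A good time of [l] shortly before [t1]: not before the other recorded rings nor the previous
     ring of the same clock, and late enough for the bond to keep its state until [t1]. *)
  pose s' := Num.max (Num.max (t1 - del) s) prev.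
  have s't1 : s' < t1 by rewrite /s' !gt_max prevlt st1 !andbT gtrBl.
  have s'1 : t1 - del <= s' by rewrite /s' !le_max lexx.
  have s'2 : s <= s' by rewrite /s' !le_max lexx orbT.
  have s'3 : prev <= s' by rewrite /s' le_max lexx orbT.
  have s'0 : 0 <= s' := le_trans s0 s'2.
  have gs' : good_time l s'.
    move=> c' r0'; have [->|c'c] := eqVneq c' c.
      split=> // j jk; apply: le_trans s'3; rewrite /prev -/k in jk *.
      by case: (k) jk => // k' jk; exact: ring_le.
    split=> [j jl|]; first by apply: le_trans s'1; apply/ltW; exact: early.
    by apply: lt_trans s't1 _; exact: late.
  have gt1 : good_time (Some c :: l) t1.
    move=> c' r0'; have [->|c'c] := eqVneq c' c.
      rewrite nrings_cons eqxx add1n -/k; split; last exact: ring_lt.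
      by move=> j; rewrite ltnS => jk; exact: ring_le.
    rewrite nr //; split=> [j jl|]; last exact: late.
    by apply/ltW; apply: lt_trans (early _ _ c'c r0' jl) _; rewrite gtrBl.
  have inter z' : (y1 < z' <= y2)%N -> (0 < z')%N /\ (z' < m)%N.
    by move=> /block_interior; apply; exact: ltn_ord.
  have [z0 zm] := inter _ zb.
  rewrite (@eta_const z t1 t) //; [|exact: ltW|by move=> c' _; exact: (no_ring gt1 gt)].
  have yy1 : y != y1.
    apply: contraTneq t1T => yy; rewrite -ltNge; apply: lt_le_trans (ring_le r0 (leq0n k)).
    by apply: silent => //; left.
  have yy2 : y != y2.
    apply: contraTneq t1T => yy; rewrite -ltNge; apply: lt_le_trans (ring_le r0 (leq0n k)).
    by apply: silent => //; right.
  have IHs' := IH s' H' hl' _ gs'.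
  have s'T : 0 <= s' <= T by rewrite s'0 (le_trans (ltW s't1)).
  have back (z' : 'I_m.+1) : z' = lsite y \/ z' = rsite y ->
      (y1 < lsite y <= y2)%N -> (y1 < rsite y <= y2)%N ->
      eta s (pos z') = run hop l c0 z'.
    move=> z'E b1 b2; have [h1 h2] : eta s' (pos y) = eta s (pos y) /\
        eta s' (pos y.+1) = eta s (pos y.+1) by apply: sconst; rewrite s'2.
    by case: z'E => ->; rewrite -IHs' //= ?h1 ?h2.
  have blk : z = lsite y \/ z = rsite y ->
      (y1 < lsite y <= y2)%N /\ (y1 < rsite y <= y2)%N.
    move=> zE; have zy : (z == y :> nat) || (z == y.+1 :> nat) by case: zE => ->; rewrite eqxx ?orbT.
    have n1 : (y != y1 :> nat) by []; have n2 : (y != y2 :> nat) by [].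
    by rewrite /= /bump leq0n add1n; exact: block_bond zb n1 n2 zy.
  rewrite /= hopE; case: (siteP y z) zb blk => [->|->|za zc z1 z2] zb blk.
  - have [b1 b2] := blk (or_introl erefl).
    rewrite -(back _ (or_introl erefl) b1 b2) -(back _ (or_intror erefl) b1 b2).
    exact: sl.
  - have [b1 b2] := blk (or_intror erefl).
    rewrite -(back _ (or_introl erefl) b1 b2) -(back _ (or_intror erefl) b1 b2).
    exact: sr.
  - rewrite -IHs' // (@eta_const z s' t1) //; first exact: ltW.
    move=> c' c'z [r0' [j /andP[j1 j2]]].
    have c'c : c' != c.
      apply/eqP => c'E; move: c'z z1 z2; rewrite c'E /= => -[->|yE]; first by rewrite eqxx.
      by rewrite yE prednK // eqxx.
    have [jl|jl] := ltnP j (nrings c' l).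
      have := lt_trans (early _ _ c'c r0' jl) (le_lt_trans s'1 j1).
      by rewrite ltxx.
    by have := lt_le_trans (late _ _ c'c r0' jl) j2; rewrite ltxx.
- have [z0 zm] : (0 < z)%N /\ (z < m)%N by exact: block_interior zb (ltn_ord y2).
  rewrite (@eta_const z 0 t) //; first by have [-> _] := etaP; exact: init_box.
  move=> c _; apply: (@no_ring [::]) => // c' r0; split=> //; exact: ring_gt0.
Qed.

End Graphical.

Section SecondClass.
Context {R : realType} {disp : measure_display} {Omega : measurableType disp}.
Variables (N : nat) (rR rL h T : R) (K : nat) (Y : asep_index -> Omega -> R) (w : Omega).
Local Notation m := (N.*2).
Local Notation event := (option ('I_m * bool)).
Local Notation rate := (clock_rate rR rL).
Local Notation pos := (box_pos N).
Local Notation ring := (@ring _ _ _ N rR rL Y w).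

Lemma run_tagged_fst (l : seq event) (c : @config m) a :
  (run tagged_step l (c, a)).1 = run hop l c.
Proof. by elim: l => [//|[[y d]|] l IH] //=; rewrite IH. Qed.

Lemma run_tagged_occupied (l : seq event) (c : @config m) a : c a ->
  run hop l c (run tagged_step l (c, a)).2.
Proof.
move=> ca; elim: l => [//|[[y d]|] l IH] //=; rewrite run_tagged_fst.
exact: move_occupied.
Qed.

Lemma run_del (l : seq event) (c : @config m) a : c a ->
  run hop l (del c a) = del (run hop l c) (run tagged_step l (c, a)).2.
Proof.
move=> ca; elim: l => [//|[[y d]|] l IH] //=; rewrite IH hop_del ?run_tagged_fst //.
exact: run_tagged_occupied.
Qed.

Lemma run_tagged_block (l : seq event) (c : @config m) (a : 'I_m.+1) (y1 y2 : 'I_m) :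
  (forall y d, y = y1 \/ y = y2 -> Some (y, d) \notin l) -> (y1 < a <= y2)%N ->
  (y1 < (run tagged_step l (c, a)).2 <= y2)%N.
Proof.
elim: l => [//|[[y d]|] l IH] H ab /=; last first.
  by apply: IH => // y d /(H y d); rewrite in_cons negb_or => /andP[].
have {}IH : (y1 < (run tagged_step l (c, a)).2 <= y2)%N.
  by apply: IH => // y' d' /(H y' d'); rewrite in_cons negb_or => /andP[].
have ny y' : y' = y1 \/ y' = y2 -> y != y' :> nat.
  move=> /(H y' d); rewrite in_cons negb_or => /andP[+ _].
  by apply: contraNneq => /val_inj ->.
have n1 := ny _ (or_introl erefl); have n2 := ny _ (or_intror erefl).
have B z : (z == y :> nat) || (z == y.+1 :> nat) -> (y1 < z <= y2)%N ->
    (y1 < lsite y <= y2)%N /\ (y1 < rsite y <= y2)%N.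
  by rewrite /= /bump leq0n add1n => zy zb; exact: block_bond zb n1 n2 zy.
rewrite /move; case: (siteP y _) IH => [->|->|//] /B; rewrite /= /bump leq0n add1n ?eqxx ?orbT;
  by move=> /(_ isT)[? ?]; case: (_ (+) _).
Qed.

Hypothesis waits_gt0 : forall x d j, 0 < Y (inr (x, d, j)) w.
Hypothesis h0 : 0 < h.
Hypothesis rate0 : forall d, 0 <= rate d.
Hypothesis few : forall c, 0 < rate c.2 -> T + 1 < ring c K.
Hypothesis sep : forall c c' k k', 0 < rate c.2 -> 0 < rate c'.2 -> c != c' ->
  (k <= K)%N -> (k' <= K)%N -> ring c k <= T + 1 -> ring c' k' <= T + 1 ->
  K.+1%:R * h < `|ring c k - ring c' k'|.
Hypothesis sepT : forall c k, 0 < rate c.2 -> (k <= K)%N -> ring c k <= T + 1 ->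
  K.+1%:R * h < `|ring c k - T|.
Variables (y1 y2 : 'I_m).
Hypothesis silent : forall y d, y = y1 \/ y = y2 -> 0 < rate d -> T < ring (y, d) 0%N.

(** The [K] slots beyond time [T] make up for the rounding: every ring before [T] is recorded. Those
    recorded wrongly would lie just after [T], which [sepT] excludes. *)
Lemma second_class_position (l : seq event) (o : 'I_m.+1) (c0 : @config m)
    (eta1 eta2 : R -> int -> bool) (q : int) :
  0 <= T -> compatible rR rL h Y w l -> h * (size l)%:R = T + h * K%:R -> h * K%:R <= 1 ->
  (y1 < o <= y2)%N -> o = N :> nat -> c0 o ->
  (forall z : 'I_m.+1, z != o -> c0 z = occ0 Y w (pos z)) ->
  follows_asep rR rL Y w (fun y => if y == 0 then false else occ0 Y w y) eta1 ->
  follows_asep rR rL Y w (fun y => if y == 0 then true else occ0 Y w y) eta2 ->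
  (forall y : int, eta1 T y != eta2 T y <-> y = q) ->
  q = pos (run tagged_step l (c0, o)).2.
Proof.
move=> T0 H hl hK oy oN co c0E P1 P2 Hq.
have hl1 : h * (size l)%:R <= T + 1 by rewrite hl lerD2l.
have gT : good_time rR rL Y w l T.
  move=> c r0; have nK := nrings_le waits_gt0 h0 rate0 few H r0 hl1.
  split=> [k kn|].
    have kT := compatible_ring_le waits_gt0 h0 rate0 H r0 kn.
    have kK : (k <= K)%N by apply: leq_trans (ltnW kn) nK.
    have := sepT r0 kK (le_trans kT hl1); rewrite ltr_normr => /orP[S|S].
      exfalso; move: S; apply/negP; rewrite -leNgt lerBlDr; apply: le_trans kT _.
      by rewrite hl addrC lerD2r -natr1 mulrDl mul1r mulrC lerDl ltW.
    by apply/ltW; rewrite -subr_gt0 -opprB; apply: lt_trans S; rewrite mulr_gt0.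
  apply: le_lt_trans (compatible_ring_gt h0 rate0 H r0).
  by rewrite mulrBr hl -addrA lerDl subr_ge0 ler_pM2l // ler_nat.
have pos0 (z : 'I_m.+1) : (pos z == 0) = (z == o).
  by rewrite /box_pos subr_eq0 eqz_nat -val_eqE /= oN.
have A eta init (c1 : @config m) : follows_asep rR rL Y w init eta ->
    (forall z : 'I_m.+1, init (pos z) = c1 z) ->
    forall z : 'I_m.+1, (y1 < z <= y2)%N -> eta T (pos z) = run hop l c1 z.
  move=> P Hi; apply: (run_agree waits_gt0 h0 rate0 P few sep silent) => //.
  by rewrite T0 lexx.
set a := (run tagged_step l (c0, o)).2.
have ab : (y1 < a <= y2)%N.
  apply: run_tagged_block => // y d yE; apply/negP => yl.
  have nz : (0 < nrings (y, d) l)%N.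
    by rewrite /nrings /rings -has_count; apply/hasP; exists true => //;
      apply/mapP; exists (Some (y, d)); rewrite ?eqxx.
  have r0 : 0 < rate d.
    rewrite lt_neqAle rate0 andbT eq_sym; apply/eqP => r0.
    by rewrite (nrings_rate0 h0 rate0 H (c := (y, d))) in nz.
  have [G _] := gT (y, d) r0.
  by have := le_lt_trans (G _ nz) (silent yE r0); rewrite ltxx.
symmetry; apply/Hq.
rewrite (A _ _ (del c0 o) P1) //; last first.
  move=> z; rewrite pos0 delE; case: eqVneq => [_|zo]; first by rewrite andbF.
  by rewrite andbT c0E.
rewrite (A _ _ c0 P2) //; last first.
  by move=> z; rewrite pos0; case: eqVneq => [->|zo]; rewrite ?co // c0E.
by rewrite run_del // delE eqxx andbF run_tagged_occupied.
Qed.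

End SecondClass.

Local Open Scope classical_set_scope.
Local Open Scope ring_scope.

Section Extend.
Context {R : realType} {disp : measure_display} {Omega : measurableType disp}.
Variables (N : nat) (rR rL h T : R) (K : nat) (Y : asep_index -> Omega -> R) (w : Omega).
Local Notation m := (N.*2).
Local Notation event := (option ('I_m * bool)).
Local Notation rate := (clock_rate rR rL).
Local Notation ring := (@ring _ _ _ N rR rL Y w).
Local Notation compatible := (compatible rR rL h Y w).
Hypothesis waits_gt0 : forall x d j, 0 < Y (inr (x, d, j)) w.
Hypothesis h0 : 0 < h.
Hypothesis rate0 : forall d, 0 <= rate d.
Hypothesis few : forall c : 'I_m * bool, 0 < rate c.2 -> T + 1 < ring c K.
Hypothesis sep : forall (c c' : 'I_m * bool) k k', 0 < rate c.2 -> 0 < rate c'.2 -> c != c' ->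
  (k <= K)%N -> (k' <= K)%N -> ring c k <= T + 1 -> ring c' k' <= T + 1 ->
  K.+1%:R * h < `|ring c k - ring c' k'|.

(** Two clocks firing in one slot would ring within [K.+1] slots of each other in true time, against
    [sep]; the slot is therefore described by a single event or by [None]. *)
Lemma compatible_extend (l : seq event) : compatible l -> h * (size l).+1%:R <= T + 1 ->
  exists e, compatible (e :: l).
Proof.
move=> H hl; have hl' : h * (size l)%:R <= T + 1.
  by apply: le_trans hl; rewrite ler_pM2l // ler_nat.
pose fires (c : 'I_m * bool) :=
  waits Y w c (nrings c l) <= (age (bits c l)).+1%:R * (rate c.2 * h).
have fits' c : fits (rate c.2 * h) (waits Y w c) (fires c :: bits c l).
  by apply: fits_cons; [move=> j; exact: waits_gt0|exact: H].
have fire c : fires c -> [/\ 0 < rate c.2, (nrings c l <= K)%N,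
    h * (size l)%:R - h * K%:R < ring c (nrings c l) &
    ring c (nrings c l) <= h * (size l).+1%:R].
  move=> fc; have r0 : 0 < rate c.2.
    rewrite lt_neqAle rate0 andbT eq_sym; apply/eqP => r0; move: fc.
    by rewrite /fires r0 mul0r mulr0 leNgt waits_gt0.
  have kK := nrings_le waits_gt0 h0 rate0 few H r0 hl'; split=> //.
    apply: le_lt_trans (compatible_ring_gt h0 rate0 H r0).
    by rewrite mulrBr lerD2l lerN2 ler_pM2l // ler_nat.
  have rh : 0 <= rate c.2 * h by rewrite mulr_ge0 // ltW.
  have F := fits' c; rewrite fc in F; have /andP[_] := fits_sum rh F.
  rewrite ringE ler_pdivrMr // /age /= subr0 size_map /rings /= add1n => F'.
  apply: le_trans F' _.
  by rewrite le_eqVlt; apply/orP; left; apply/eqP; ring.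
have uniq_fire c c' : fires c -> fires c' -> c = c'.
  move=> /fire[r0 kK c1 c2] /fire[r0' kK' c'1 c'2]; apply/eqP/negPn/negP => cc'.
  have := sep r0 r0' cc' kK kK' (le_trans c2 hl) (le_trans c'2 hl).
  apply/negP; rewrite -leNgt -natr1 mulrDl mul1r; rewrite -natr1 mulrDr mulr1 in c2 c'2.
  rewrite ler_norml; apply/andP; split; rewrite mulrC; lra.
have [ex|nf] := pselect (exists c, fires c); last first.
  exists None => c; have := fits' c; rewrite /bits /=.
  suff -> : fires c = false by [].
  by apply/negP => fc; apply: nf; exists c.
move: ex => [c fc]; exists (Some c) => c'; have := fits' c'; rewrite /bits /=.
suff -> : fires c' = (Some c == Some c') by [].
rewrite (inj_eq (@Some_inj _)); apply/idP/eqP => [fc'|<- //].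
exact: uniq_fire.
Qed.

End Extend.

(** * Probabilities of discretised histories *)

Section FiniteMeasure.
Context {R : realType} {disp : measure_display} {Omega : measurableType disp}.
Variable P : probability Omega R.

Lemma measure_cover_le (I : eqType) (s : seq I) (A : I -> set Omega) (B : set Omega) :
  measurable B -> (forall i, measurable (A i)) ->
  (forall w, B w -> exists2 i, i \in s & A i w) ->
  (P B <= \sum_(i <- s) P (A i))%E.
Proof.
elim: s B => [|i s IH] B mB mA H.
  have -> : B = set0 by apply/seteqP; split=> // w /H[].
  by rewrite measure0 big_nil.
rewrite big_cons; apply: (@le_trans _ _ (P (A i `|` (B `\` A i)))).
  apply: le_measure; rewrite ?inE //; first by apply: measurableU => //; exact: measurableD.
  by move=> w Bw; have [|] := pselect (A i w); [left|right].
apply: le_trans (measureU2 _ _ _) _ => //; first exact: measurableD.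
rewrite leeD2l // IH //; first exact: measurableD.
move=> w [/H[j]]; rewrite in_cons => /orP[/eqP -> //|js Aj _]; by exists j.
Qed.

Lemma indep_fin (I : eqType) (X : I -> Omega -> R) (J : finType) (f : J -> I)
    (B : J -> set R) : mutually_independent P X -> injective f ->
  (forall t, measurable (B t)) ->
  measurable (\bigcap_(t in [set: J]) (X (f t) @^-1` B t)) /\
  P (\bigcap_(t in [set: J]) (X (f t) @^-1` B t)) = (\prod_t P (X (f t) @^-1` B t))%E.
Proof.
move=> [mX ind] fI mB; split.
  apply: fin_bigcap_measurable => [|t _]; first exact: finite_finset.
  by rewrite -[X in measurable X]setTI; apply: mX.
pose B' i := if [pick t | f t == i] is Some t then B t else setT.
have B'f t : B' (f t) = B t.
  rewrite /B'; case: pickP => [t' /eqP/fI -> //|/(_ t)]; by rewrite eqxx.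
have := ind [seq f t | t <- enum J]; rewrite map_inj_uniq ?enum_uniq // => /(_ isT B').
rewrite big_map -big_enum /= (eq_bigr (fun t => P (X (f t) @^-1` B t))); last first.
  by move=> t _; rewrite B'f.
move=> <-; last by move=> i; rewrite /B'; case: pickP => // _; exact: measurableT.
congr (P _); apply/seteqP; split=> w H i /=.
  by move=> /mapP[t _ ->]; rewrite B'f; exact: H.
move=> _; have := H (f i); rewrite B'f; apply.
by apply: map_f; rewrite mem_enum.
Qed.

End FiniteMeasure.

Lemma big_option (T : Type) (idx : T) (op : Monoid.com_law idx) (I : finType)
    (F : option I -> T) :
  \big[op/idx]_e F e = op (F None) (\big[op/idx]_i F (Some i)).
Proof.
rewrite (bigD1 None) //=; congr (op _ _); rewrite (reindex_omap Some id) => [|[]//].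
by apply: eq_bigl => i; rewrite /= eqxx.
Qed.

Section Exponential.
Context {R : realType} {disp : measure_display} {Omega : measurableType disp}.
Variables (P : probability Omega R) (X : Omega -> R).
Hypotheses (mX : measurable_fun setT X) (eX : std_exponential_rv P X).

Lemma measurable_preim (A : set R) : measurable A -> measurable (X @^-1` A).
Proof. by move=> mA; rewrite -[X in measurable X]setTI; exact: mX. Qed.

Lemma expo_gt (a : R) : 0 <= a -> P (X @^-1` [set` `]a, +oo[]) = (expR (- a))%:E.
Proof.
move=> a0; have -> : X @^-1` [set` `]a, +oo[] = ~` [set w | X w <= a].
  by apply/seteqP; split=> w /=; rewrite in_itv /= andbT ltNge => /negP.
rewrite probability_setC; first by rewrite eX // -EFinB; congr (_%:E); ring.
have -> : [set w | X w <= a] = X @^-1` [set` `]-oo, a]].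
  by apply/seteqP; split=> w /=; rewrite in_itv.
by apply: measurable_preim; exact: measurable_itv.
Qed.

Lemma expo_itv (a b : R) : 0 <= a -> a <= b ->
  P (X @^-1` [set` `]a, b]]) = (expR (- a) - expR (- b))%:E.
Proof.
move=> a0 ab; have -> : X @^-1` [set` `]a, b]] =
    (X @^-1` [set` `]a, +oo[]) `\` (X @^-1` [set` `]b, +oo[]).
  apply/seteqP; split=> w /=; rewrite !in_itv /= !andbT.
    by move=> /andP[aX Xb]; split=> //; apply/negP; rewrite -leNgt.
  by move=> [-> /negP]; rewrite -leNgt.
have mb : measurable (X @^-1` [set` `]b, +oo[]) by apply: measurable_preim; exact: measurable_itv.
have ma : measurable (X @^-1` [set` `]a, +oo[]) by apply: measurable_preim; exact: measurable_itv.
rewrite measureD //; last first.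
  exact: le_lt_trans (probability_le1 P ma) (ltry _).
rewrite setIidr.
  by rewrite EFinB; congr (_ - _)%E; apply: expo_gt => //; exact: le_trans ab.
by move=> w /=; rewrite !in_itv /= !andbT; exact: le_lt_trans.
Qed.

Definition slot_weight (rho : R) (ringing : bool) : R :=
  if ringing then 1 - expR (- rho) else expR (- rho).

(** Memorylessness: a waiting time that has exceeded [age l] slots exceeds one more with probability
    [expR (- rho)]. A new bit only changes the factor of the running waiting time. *)
Lemma slot_itv_cons rho (s : bool) l j : 0 <= rho ->
  P (X @^-1` [set` slot_itv rho (s :: l) j]) =
  (P (X @^-1` [set` slot_itv rho l j]) *
   (if j == rings l then slot_weight rho s else 1)%:E)%E.
Proof.
move=> r0; have a0 k : 0 <= k%:R * rho by rewrite mulr_ge0.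
have expS : expR (- ((age l).+1%:R * rho)) = expR (- ((age l)%:R * rho)) * expR (- rho).
  by rewrite -expRD -natr1; congr expR; ring.
have ll : (age l)%:R * rho <= (age l).+1%:R * rho by rewrite ler_wpM2r // ler_nat.
case: s => /=; case: eqP => [->|_]; rewrite ?mule1 //.
- rewrite slot_itv_rings expo_itv // expo_gt // -EFinM; congr (_%:E).
  by rewrite expS; ring.
- case: eqP => [->|//]; rewrite slot_itv_gt // expo_gt // oppr0 expR0.
  have -> : X @^-1` [set` `]-oo, +oo[] = setT by apply/seteqP; split=> w //= _; rewrite in_itv.
  by rewrite probability_setT.
- by rewrite slot_itv_rings !expo_gt // -EFinM expS.
Qed.

Lemma slot_itv_nil rho j : P (X @^-1` [set` slot_itv rho [::] j]) = 1%E.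
Proof.
rewrite /=; case: eqP => _; first by rewrite expo_gt // oppr0 expR0.
have -> : X @^-1` [set` `]-oo, +oo[] = setT by apply/seteqP; split=> w //= _; rewrite in_itv.
by rewrite probability_setT.
Qed.

End Exponential.

Definition clock_index (N : nat) (c : 'I_(N.*2) * bool) (j : nat) : asep_index :=
  inr (clock_pos N c.1 c.2, c.2, j).

Lemma box_pos_inj N : injective (box_pos N).
Proof. by move=> i j /addIr []. Qed.

Lemma clock_index_inj N (c c' : 'I_(N.*2) * bool) j j' :
  clock_index c j = clock_index c' j' -> c = c' /\ j = j'.
Proof.
case: c c' => [y d] [y' d'] [/= + dd jj]; rewrite -dd => yy; split=> //.
congr (_, _); apply: val_inj.
by case: d yy {dd} => /box_pos_inj // [].
Qed.

Section Cells.
Context {R : realType} {disp : measure_display} {Omega : measurableType disp}.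
Variables (P : probability Omega R) (N : nat) (rR rL h b : R) (n : nat).
Variable (Y : asep_index -> Omega -> R).
Local Notation m := (N.*2).
Local Notation event := (option ('I_m * bool)).
Local Notation rate := (clock_rate rR rL).
Local Notation pos := (box_pos N).
Hypotheses (h0 : 0 <= h) (rate0 : forall d, 0 <= rate d).
Hypothesis data : asep_data P b Y.
Variable (o : 'I_m.+1).
Hypothesis oN : o = N :> nat.

Definition matches (c : @config m) (w : Omega) := forall z : 'I_m.+1, z != o ->
  c z = occ0 Y w (pos z).
Definition cell (c : @config m) (l : seq event) : set Omega :=
  [set w | matches c w /\ compatible rR rL h Y w l].

Local Notation J := ('I_m.+1 + ('I_m * bool) * 'I_n.+1)%type.
Definition cell_index (t : J) : asep_index :=
  match t with
  | inl z => inl (pos z)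
  | inr (c, j) => clock_index c j
  end.
Definition cell_side (c : @config m) (l : seq event) (t : J) : set R :=
  match t with
  | inl z => if z == o then setT else if c z then [set 1] else ~` [set 1]
  | inr (e, j) => [set` slot_itv (rate e.2 * h) (bits e l) j]
  end.

Lemma cell_index_inj : injective cell_index.
Proof.
move=> [z|[c j]] [z'|[c' j']] //=; first by case=> /box_pos_inj /val_inj ->.
by move=> /clock_index_inj[-> /val_inj ->].
Qed.

(** At most [n] slots contain at most [n] rings, so waiting times of index beyond [n] are
    unconstrained and finitely many coordinates describe the cell. *)
Lemma cellE c l : (size l <= n)%N ->
  cell c l = \bigcap_(t in [set: J]) (Y (cell_index t) @^-1` cell_side c l t).
Proof.
move=> ln; apply/seteqP; split=> w.
- move=> [M C] [z|[e j]] _ /=; last exact: C.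
  case: eqP => [//|/eqP/M]; rewrite /occ0 => ->.
  by case: eqP.
- move=> H; split=> [z zo|e j].
    have := H (inl z) I; rewrite /= (negbTE zo) /occ0.
    by case: (c z) => /=; [move=> ->; rewrite eqxx|move/eqP/negbTE ->].
  have [jn|nj] := ltnP j n.+1; first exact: (H (inr (e, Ordinal jn)) I).
  rewrite slot_itv_gt ?in_itv //; apply: leq_ltn_trans nj.
  by apply: leq_trans (rings_size _) _; rewrite size_map.
Qed.

Lemma measurable_cell_side c l t : measurable (cell_side c l t).
Proof.
case: t => [z|[e j]] /=; last exact: measurable_itv.
case: ifP => // _; case: ifP => _; first exact: measurable_set1.
by apply: measurableC; exact: measurable_set1.
Qed.

Lemma measurable_cell c l : (size l <= n)%N -> measurable (cell c l).
Proof.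
move=> ln; rewrite (cellE _ ln); have [ind _] := data.
exact: (indep_fin ind cell_index_inj (measurable_cell_side c l)).1.
Qed.

(** The product runs over all clocks of the box, including those that do not ring. Slots with two
    rings have no event, so the weights add up to at most one. *)
Definition event_weight (e : event) : R :=
  \prod_c slot_weight (rate c.2 * h) (e == Some c).

Lemma pos_neq0 (z : 'I_m.+1) : z != o -> pos z != 0.
Proof. by rewrite /box_pos subr_eq0 eqz_nat -val_eqE /= oN. Qed.

Lemma cell_prob c l : (size l <= n)%N ->
  P (cell c l) = ((\prod_(z | z != o) bern b (c z)) * \prod_(e <- l) event_weight e)%:E.
Proof.
move=> ln; rewrite (cellE _ ln); have [ind [Hb He]] := data; have [mY _] := ind.
have {}He e j : std_exponential_rv P (Y (clock_index e j)) by exact: He.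
rewrite (indep_fin ind cell_index_inj (measurable_cell_side c l)).2.
rewrite big_sumType /= EFinM; congr (_ * _)%E.
  rewrite (bigD1 o) //= eqxx preimage_setT probability_setT mul1e.
  rewrite -prodEFin; apply: eq_bigr => z zo; rewrite (negbTE zo).
  have [H1 _] := Hb _ (pos_neq0 zo).
  have E1 : Y (inl (pos z)) @^-1` [set 1] = [set w | Y (inl (pos z)) w = 1] by [].
  case: (c z) => /=; first by rewrite E1.
  rewrite -preimage_setC E1 probability_setC ?H1 //.
  by rewrite -E1; apply: measurable_preim => //; exact: measurable_set1.
elim: l ln => [|e l IH] ln.
  by rewrite big_nil big1 // => -[e j] _; rewrite slot_itv_nil.
rewrite big_cons mulrC EFinM -IH ?(ltnW ln) // /event_weight.
rewrite (eq_bigr (fun t : ('I_m * bool) * 'I_n.+1 =>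
    (P (Y (cell_index (inr t)) @^-1` cell_side c l (inr t)) *
     (if t.2 == rings (bits t.1 l) :> nat then slot_weight (rate t.1.2 * h) (e == Some t.1)
      else 1)%:E)%E)); last first.
  by move=> [e' j] _; rewrite /= slot_itv_cons ?mulr_ge0.
rewrite big_split /=; congr (_ * _)%E.
rewrite -(pair_bigA _ (fun (e' : 'I_m * bool) (j : 'I_n.+1) =>
  (if j == rings (bits e' l) :> nat then slot_weight (rate e'.2 * h) (e == Some e')
   else 1)%:E)) /= -prodEFin.
apply: eq_bigr => e' _.
have rl : (rings (bits e' l) < n.+1)%N.
  by rewrite ltnS (leq_trans (rings_size _)) // size_map ltnW.
rewrite (bigD1 (Ordinal rl)) //= eqxx big1 ?mule1 // => j jr.
by rewrite -[X in if X then _ else _]/(val j == val (Ordinal rl)) val_eqE (negbTE jr).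
Qed.

Definition event_op {S} (st : 'I_m -> bool -> S -> S) (V : S -> R) (s : S) : R :=
  \sum_(e : event) event_weight e * V (apply_event st e s).

Lemma slot_weight_ge0 (rho : R) s : 0 <= rho -> 0 <= slot_weight rho s.
Proof.
move=> r0; rewrite /slot_weight; case: s; last exact: expR_ge0.
by rewrite subr_ge0 -expR0 ler_expR oppr_le0.
Qed.

Lemma event_weight_ge0 e : 0 <= event_weight e.
Proof. by apply: prodr_ge0 => c _; rewrite slot_weight_ge0 // mulr_ge0. Qed.

(** Within [G] a cell is covered by its extensions by one slot, so subadditivity reproduces one step
    of [event_op]. The event [G] may depend on all clocks: it only serves to guarantee the cover. *)
Lemma cell_recursion (G : set Omega) (F : @config m * 'I_m.+1 -> R) c l k :
  measurable G -> (forall s, 0 <= F s) ->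
  (forall w (l : seq event), G w -> (size l < n)%N -> compatible rR rL h Y w l ->
    exists e, compatible rR rL h Y w (e :: l)) ->
  (forall w (l : seq event), G w -> size l = n -> compatible rR rL h Y w l -> matches c w ->
    1 <= F (run tagged_step l (c, o))) ->
  (size l + k)%N = n ->
  (P (cell c l `&` G) <= ((\prod_(z | z != o) bern b (c z)) * \prod_(e <- l) event_weight e *
     iter k (event_op tagged_step) F (run tagged_step l (c, o)))%:E)%E.
Proof.
move=> mG F0 ext fin; elim: k l => [|k IH] l ln.
  rewrite addn0 in ln; have mc : measurable (cell c l) by apply: measurable_cell; rewrite ln.
  have pl : (0%E <= ((\prod_(z | z != o) bern b (c z)) * \prod_(e <- l) event_weight e)%:E :> \bar R)%E.
    by rewrite -cell_prob ?ln.
  have [->|/set0P[w [[wm wc] Gw]]] := eqVneq (cell c l `&` G) set0.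
    by rewrite measure0 lee_fin mulr_ge0.
  apply: (@le_trans _ _ (P (cell c l))).
    by apply: le_measure; rewrite ?inE //; exact: measurableI.
  rewrite cell_prob ?ln // lee_fin ler_peMr //; exact: fin Gw ln wc wm.
have ln' e : (size (e :: l : seq event) + k)%N = n by rewrite /= addSn -addnS.
have lsn : (size l < n)%N by rewrite -ln addnS ltnS leq_addr.
apply: (@le_trans _ _ (\sum_(e <- enum {: event}) P (cell c (e :: l) `&` G))%E).
  apply: measure_cover_le => [||w [[wm wc] Gw]].
  - by apply: measurableI => //; apply: measurable_cell; exact: ltnW.
  - by move=> e; apply: measurableI => //; exact: measurable_cell.
  - have [e ce] := ext w l Gw lsn wc; exists e; first by rewrite mem_enum.
    by split.
rewrite big_enum /=; apply: (@le_trans _ _ (\sum_(e : event)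
   ((\prod_(z | z != o) bern b (c z)) * \prod_(e' <- e :: l) event_weight e' *
     iter k (event_op tagged_step) F (run tagged_step (e :: l) (c, o)))%:E)%E).
  by apply: lee_sum => e _; exact: IH.
rewrite sumEFin lee_fin /= /event_op mulr_sumr; apply: ler_sum => e _.
by rewrite big_cons le_eqVlt; apply/orP; left; apply/eqP; ring.
Qed.

Lemma good_prob (G : set Omega) (F : @config m * 'I_m.+1 -> R) :
  measurable G -> (forall s, 0 <= F s) ->
  (forall w (l : seq event), G w -> (size l < n)%N -> compatible rR rL h Y w l ->
    exists e, compatible rR rL h Y w (e :: l)) ->
  (forall w, G w -> @compatible R disp Omega N rR rL h Y w [::]) ->
  (forall w (l : seq event) (c : @config m), G w -> size l = n -> compatible rR rL h Y w l ->
    matches c w -> c o -> 1 <= F (run tagged_step l (c, o))) ->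
  (P G <= (avg (dens o b 1 b) (fun c => iter n (event_op tagged_step) F (c, o)))%:E)%E.
Proof.
move=> mG F0 ext wpos fin.
pose s := [seq c : @config m <- enum {: @config m} | c o].
apply: (@le_trans _ _ (\sum_(c <- s) P (cell c [::] `&` G))%E).
  apply: measure_cover_le => [//|c|w Gw].
    by apply: measurableI => //; exact: measurable_cell.
  pose c : @config m := [ffun z => if z == o then true else occ0 Y w (pos z)].
  exists c; first by rewrite mem_filter mem_enum /c ffunE eqxx.
  split=> //; split; last exact: wpos.
  by move=> z zo; rewrite /c ffunE (negbTE zo).
rewrite big_filter big_enum_cond /=.
apply: (@le_trans _ _ (\sum_(c : @config m | c o) ((\prod_(z | z != o) bern b (c z)) *
  iter n (event_op tagged_step) F (c, o))%:E)%E).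
  apply: lee_sum => c co; have := @cell_recursion G F c [::] n mG F0 ext.
  rewrite big_nil mulr1; apply=> // w l Gw ln wc wm; exact: fin Gw ln wc wm co.
rewrite sumEFin lee_fin /avg /pavg [leRHS](bigID (fun c : @config m => c o)) /=.
rewrite -[leLHS]addr0; apply: lerD.
  apply: ler_sum => c co; rewrite le_eqVlt; apply/orP; left; apply/eqP; congr (_ * _).
  rewrite [RHS](bigD1 o) //= /dens ltnn eqxx co /= mul1r.
  apply: eq_bigr => z zo; congr (bern _ _).
  by rewrite (negbTE zo); case: ifP.
rewrite big1 // => c co; rewrite (bigD1 o) //= /dens ltnn eqxx (negbTE co) /=.
by rewrite subrr !mul0r.
Qed.

(** A slot and a step of the chain differ to second order in the total rate [x]: silence weighs
    [expR (- x)] instead of [1 - x], and a ring at most [h] times its rate. The resulting factor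
    stays bounded when [k * x ^+ 2] does. *)
Lemma event_op_le S (st : 'I_m -> bool -> S -> S) (V : S -> R) k s :
  let x := m%:R * (h * rR + h * rL) in
  x <= 2^-1 -> (forall s, 0 <= V s) ->
  iter k (event_op st) V s <= (1 + 2 * x ^+ 2) ^+ k * iter k (bond_op (h * rR) (h * rL) st) V s.
Proof.
move=> x x2 V0; have [hR hL] : 0 <= h * rR /\ 0 <= h * rL.
  by rewrite !mulr_ge0 // ?(rate0 true) ?(rate0 false).
have x0 : 0 <= x by rewrite mulr_ge0 // addr_ge0.
have wS c : event_weight (Some c) <= h * rate c.2.
  rewrite /event_weight (bigD1 c) //= eqxx mulrC.
  apply: (@le_trans _ _ (slot_weight (rate c.2 * h) true)).
    rewrite ler_piMl ?slot_weight_ge0 ?mulr_ge0 //; apply: numdomain.Num.Theory.prodr_ile1 => c' _.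
    rewrite slot_weight_ge0 ?mulr_ge0 //= /slot_weight.
    case: ifP => _; first by rewrite gerBl expR_ge0.
    by rewrite -expR0 ler_expR oppr_le0 mulr_ge0.
  by have := expR_ge1Dx (- (rate c.2 * h)); rewrite /slot_weight; lra.
have wN : event_weight None <= (1 + 2 * x ^+ 2) * (1 - x).
  have -> : event_weight None = expR (- x).
    rewrite /event_weight /slot_weight /=.
    rewrite -(pair_bigA _ (fun (y : 'I_m) (d : bool) => expR (- (rate d * h)))) /=.
    under eq_bigr do rewrite big_bool /= -expRD.
    rewrite prodr_const card_ord -expRM_natl; congr expR.
    by rewrite /x /clock_rate; ring.
  have e1 := expR_ge1Dx x; have e2 : expR (- x) * (1 + x) <= 1.
    by rewrite -[leRHS](expRxMexpNx_1 x) [leLHS]mulrC ler_wpM2r ?expR_ge0.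
  have -> : expR (- x) = (expR (- x) * (1 + x)) / (1 + x).
    by rewrite mulfK // gt_eqF // ltr_wpDr.
  rewrite ler_pdivrMr ?ltr_wpDr //; apply: le_trans e2 _.
  have y1 : x ^+ 2 <= 2^-1.
    by rewrite expr2; apply: le_trans (ler_wpM2l x0 x2) _; lra.
  have y2 : 0 <= x ^+ 2 * (1 - 2 * x ^+ 2) by rewrite mulr_ge0 ?exprn_ge0 // subr_ge0; lra.
  rewrite -subr_ge0 (_ : _ - 1 = x ^+ 2 * (1 - 2 * x ^+ 2)) //; ring.
elim: k s => [|k IH] s; first by rewrite /= mul1r.
rewrite iterS /event_op big_option /=.
rewrite exprS -mulrA; set W := iter k (bond_op _ _ _) V.
have Wp t : 0 <= W t.
  have wm : m%:R * (h * rR + h * rL) <= 1 by rewrite -/x (le_trans x2) // invf_le1 // ler1n.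
  have := @bond_op_le R m (h * rR) (h * rL) hR hL wm _ st (fun=> 0) V k t V0.
  by rewrite bond_op_cst.
set A := (1 + 2 * x ^+ 2); have A1 : 1 <= A by rewrite lerDl mulr_ge0 // exprn_ge0.
set Ak := A ^+ k; have Ak0 : 0 <= Ak by rewrite exprn_ge0 // (le_trans ler01).
apply: (@le_trans _ _ (A * (1 - x) * (Ak * W s) +
   \sum_c h * rate c.2 * (Ak * W (st c.1 c.2 s)))).
  apply: lerD.
    apply: le_trans (ler_wpM2l (event_weight_ge0 _) (IH s)) _.
    by rewrite ler_wpM2r // mulr_ge0.
  apply: ler_sum => -[y d] _ /=.
  apply: le_trans (ler_wpM2l (event_weight_ge0 _) (IH _)) _.
  by rewrite ler_wpM2r ?mulr_ge0 //; exact: (wS (y, d)).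
rewrite [X in _ <= A * (Ak * X)]/= /bond_op -/x -/W.
rewrite !mulrDr; apply: lerD; first by rewrite le_eqVlt; apply/orP; left; apply/eqP; ring.
rewrite -(pair_bigA _ (fun (y : 'I_m) (d : bool) => h * rate d * (Ak * W (st y d s)))) /=.
rewrite !mulr_sumr; apply: ler_sum => y _; rewrite big_bool /=.
set B1 := h * rR * _; set B2 := h * rL * _.
have B10 : 0 <= B1 by rewrite /B1 mulr_ge0 // mulr_ge0.
have B20 : 0 <= B2 by rewrite /B2 mulr_ge0 // mulr_ge0.
rewrite (_ : A * _ = A * (B1 + B2)); last by rewrite /B1 /B2; ring.
by rewrite ler_peMl // addr_ge0.
Qed.

End Cells.

(** * Exceptional events *)

Section OuterBound.
Context {R : realType} {disp : measure_display} {Omega : measurableType disp}.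
Variable P : probability Omega R.

(** Exceptional events are existential statements about ring times; they are bounded through
    measurable covers instead of being shown measurable. *)
Definition outer_le (A : set Omega) (p : R) :=
  exists M, [/\ measurable M, A `<=` M & (P M <= p%:E)%E].

Lemma outer_le_sub A B p q : A `<=` B -> p <= q -> outer_le B p -> outer_le A q.
Proof.
move=> AB pq [M [mM BM PM]]; exists M; split=> //; first exact: subset_trans BM.
by apply: le_trans PM _; rewrite lee_fin.
Qed.

Lemma outer_le_cover (I : eqType) (s : seq I) (A : I -> set Omega) (p : I -> R) B :
  (forall i, i \in s -> outer_le (A i) (p i)) ->
  (forall w, B w -> exists2 i, i \in s & A i w) -> outer_le B (\sum_(i <- s) p i).
Proof.
elim: s B => [|i s IH] B H c.
  exists set0; split; [exact: measurable0|by move=> w /c[]|].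
  by rewrite measure0 big_nil.
have [M [mM AM PM]] := H i (mem_head _ _).
have [|w [Bw Aw]|M' [mM' BM' PM']] := IH (B `\` A i).
- by move=> j js; apply: H; rewrite in_cons js orbT.
- have [j] := c w Bw; rewrite in_cons => /orP[/eqP ji Aj|js Aj]; last by exists j.
  by case: Aw; rewrite -ji.
exists (M `|` M'); split; first exact: measurableU.
- move=> w Bw; have [Aw|nA] := pselect (A i w); first by left; exact: AM.
  by right; apply: BM'; split.
- rewrite big_cons EFinD; apply: le_trans (measureU2 _ mM mM') _; exact: leeD.
Qed.

Lemma outer_leU A B p q : outer_le A p -> outer_le B q -> outer_le (A `|` B) (p + q).
Proof.
move=> HA HB; have := @outer_le_cover bool [:: true; false] (fun i => if i then A else B)
  (fun i => if i then p else q) (A `|` B).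
rewrite !big_cons big_nil addr0; apply=> [[]//|w [Aw|Bw]]; first by exists true.
by exists false.
Qed.

Lemma outer_le_fin (I : finType) (A : I -> set Omega) (p : R) B :
  (forall i, outer_le (A i) p) -> (forall w, B w -> exists i, A i w) ->
  outer_le B (#|I|%:R * p).
Proof.
move=> H c; rewrite mulr_natl -sumr_const -big_enum /=.
by apply: outer_le_cover (fun i _ => H i) _ => w /c[i Ai]; exists i; rewrite ?mem_enum.
Qed.

Lemma outer_le_rect (I : eqType) (X : I -> Omega -> R) (J : finType) (f : J -> I)
    (B : J -> set R) (p : J -> R) : mutually_independent P X -> injective f ->
  (forall t, measurable (B t)) -> (forall t, (P (X (f t) @^-1` B t) <= (p t)%:E)%E) ->
  outer_le [set w | forall t, B t (X (f t) w)] (\prod_t p t).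
Proof.
move=> ind fI mB Hp; have [mI PI] := indep_fin ind fI mB.
exists (\bigcap_(t in [set: J]) (X (f t) @^-1` B t)); split=> // [w H t _|]; first exact: H.
rewrite PI -prodEFin.
suff /andP[] : (0 <= \prod_t P (X (f t) @^-1` B t) <= \prod_t (p t)%:E)%E by [].
apply: (big_ind2 (fun x y => 0 <= x <= y)%E) => [|x1 y1 x2 y2 /andP[? ?] /andP[? ?]|t _].
- by rewrite lee01 lexx.
- by rewrite mule_ge0 // lee_pmul.
- by rewrite measure_ge0 Hp.
Qed.

End OuterBound.

Section Anticoncentration.
Context {R : realType} {disp : measure_display} {Omega : measurableType disp}.
Variable P : probability Omega R.

Lemma expo_itv_le (X : Omega -> R) (a b : R) : measurable_fun setT X ->
  std_exponential_rv P X -> a <= b -> (P (X @^-1` [set` `]a, b]]) <= (b - a)%:E)%E.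
Proof.
move=> mX eX ab; have mab : measurable (X @^-1` [set` `]a, b]]).
  by apply: measurable_preim => //; exact: measurable_itv.
have [b0|b0] := ltP b 0.
  have m0 : measurable [set w | X w <= 0].
    have -> : [set w | X w <= 0] = X @^-1` [set` `]-oo, 0]].
      by apply/seteqP; split=> w /=; rewrite in_itv.
    by apply: measurable_preim => //; exact: measurable_itv.
  apply: (@le_trans _ _ (P [set w | X w <= 0])).
    apply: le_measure; rewrite ?inE // => w /=; rewrite in_itv /= => /andP[_ wb].
    by rewrite (le_trans wb) // ltW.
  by rewrite eX // oppr0 expR0 subrr lee_fin subr_ge0.
have [a0|a0] := leP 0 a.
  rewrite expo_itv // lee_fin.
  have e1 := expR_ge1Dx (a - b).
  have e2 : expR (- a) * (1 - expR (a - b)) <= 1 - expR (a - b).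
    rewrite ler_piMl ?subr_ge0 -?[leRHS]expR0 ?ler_expR //; lra.
  have e3 : expR (- b) = expR (- a) * expR (a - b) by rewrite -expRD; congr expR; ring.
  rewrite e3; lra.
have m0 : measurable [set w | X w <= b].
  have -> : [set w | X w <= b] = X @^-1` [set` `]-oo, b]].
    by apply/seteqP; split=> w /=; rewrite in_itv.
  by apply: measurable_preim => //; exact: measurable_itv.
apply: (@le_trans _ _ (P [set w | X w <= b])).
  by apply: le_measure; rewrite ?inE // => w /=; rewrite in_itv /= => /andP[_ wb].
rewrite eX // lee_fin; have := expR_ge1Dx (- b); lra.
Qed.

Lemma grid_cell (M : nat) (eta x : R) : 0 < x -> x <= M%:R * eta ->
  exists k : 'I_M, k%:R * eta < x <= k.+1%:R * eta.
Proof.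
elim: M => [|M IH] x0 xM; first by move: xM; rewrite mul0r leNgt x0.
have [h|h] := leP x (M%:R * eta).
  by have [k kx] := IH x0 h; exists (widen_ord (leqnSn M) k).
by exists ord_max; rewrite /= h.
Qed.

(* The other variables are frozen on a fine grid; [X i0] must then fall in a short interval. *)
Lemma anticoncentration (I : eqType) (X : I -> Omega -> R) (i0 : I) (J : finType) (f : J -> I)
    (a : J -> R) (z l B : R) : mutually_independent P X ->
  std_exponential_rv P (X i0) -> (forall j, std_exponential_rv P (X (f j))) ->
  injective f -> (forall j, f j != i0) -> 0 < l -> 0 < B ->
  outer_le P [set w | `|X i0 w + \sum_j a j * X (f j) w - z| <= l /\
                      forall j, 0 < X (f j) w <= B] (5%:R * l).
Proof.
move=> ind e0 ef fI fi0 l0 B0; have [mX _] := ind.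
pose A : R := \sum_j `|a j|; have A0 : 0 <= A by apply: sumr_ge0.
(* The grid is fine enough for freezing the variables [X (f j)] to change the weighted sum by at
   most [l]. *)
pose M := (Num.bound (A * B / l)).+1.
have M0 : 0 < M%:R :> R by rewrite ltr0n.
pose eta := B / M%:R; have eta0 : 0 < eta by rewrite divr_gt0.
have Aeta : A * eta <= l.
  rewrite /eta mulrA ler_pdivrMr // -ler_pdivrMl // mulrC.
  apply: ltW; apply: (lt_le_trans (archi_boundP _)); first by
    rewrite divr_ge0 ?(ltW l0) // mulr_ge0 // ltW.
  by rewrite /M ler_nat leqnSn.
pose S (g : {ffun J -> 'I_M}) := \sum_j a j * ((g j)%:R * eta).
pose f' (t : option J) := if t is Some j then f j else i0.
(* Tolerance [l] and freezing error [l] ask for [2 * l] on both sides; one more [l] on the left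
   absorbs the open end. As the exponential density is at most one, the length [5 * l] bounds the
   probability. *)
pose side (g : {ffun J -> 'I_M}) (t : option J) : set R := if t is Some j
  then [set` `](g j)%:R * eta, (g j).+1%:R * eta]]
  else [set` `]z - S g - 3 * l, z - S g + 2 * l]].
pose pr (g : {ffun J -> 'I_M}) (t : option J) : R := if t is Some j
  then expR (- ((g j)%:R * eta)) - expR (- ((g j).+1%:R * eta)) else 5 * l.
have cov : outer_le P [set w | exists g, forall t, side g t (X (f' t) w)]
    (\sum_(g <- enum {: {ffun J -> 'I_M}}) \prod_t pr g t).
  apply: (outer_le_cover (A := fun g => [set w | forall t, side g t (X (f' t) w)])) =>
    [g _|w [g Hg]]; last by exists g; rewrite ?mem_enum.
  apply: outer_le_rect => //.
  + by move=> [j|] [j'|] //= => [/fI ->//|/eqP|/eqP]; [|rewrite eq_sym]; rewrite (negbTE (fi0 _)).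
  + by move=> [j|]; exact: measurable_itv.
  + move=> [j|] /=.
      rewrite expo_itv //; first by rewrite mulr_ge0 // ltW.
      by rewrite ler_wpM2r ?(ltW eta0) // ler_nat.
    apply: le_trans (expo_itv_le _ _ _) _ => //; first by lra.
    by rewrite lee_fin; lra.
apply: outer_le_sub cov.
- move=> w /= [H0 H1].
  have cellj j : exists k : 'I_M, k%:R * eta < X (f j) w <= k.+1%:R * eta.
    have /andP[x0 xB] := H1 j; apply: grid_cell => //.
    by rewrite /eta mulrC divfK // gt_eqF.
  pose g : {ffun J -> 'I_M} := [ffun j => xchoose (cellj j)].
  have gP j : (g j)%:R * eta < X (f j) w <= (g j).+1%:R * eta.
    by rewrite ffunE; exact: xchooseP (cellj j).
  exists g => -[j|] /=; first by rewrite in_itv; exact: gP.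
  have dS : `|\sum_j a j * X (f j) w - S g| <= l.
    apply: le_trans Aeta; rewrite /S /A -sumrB mulr_suml.
    apply: le_trans (ler_norm_sum _ _ _) _; apply: ler_sum => j _.
    rewrite -mulrBr normrM ler_wpM2l //; have /andP[g1 g2] := gP j.
    rewrite ger0_norm ?subr_ge0 ?(ltW g1) //.
    by move: g2; rewrite -natr1; lra.
  move: H0 dS; rewrite !ler_norml in_itv /=.
  move: (\sum_j _) (S g) => u v; move=> /andP[h1 h2] /andP[h3 h4].
  apply/andP; split; lra.
- rewrite big_enum /=; under eq_bigr do rewrite big_option /=.
  rewrite -mulr_sumr; apply: ler_piMr; first by rewrite mulr_ge0 // ltW.
  rewrite -(bigA_distr_bigA (fun (j : J) (k : 'I_M) =>
    expR (- (k%:R * eta)) - expR (- (k.+1%:R * eta)))).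
  have tele : \sum_(k < M) (expR (- (k%:R * eta)) - expR (- (k.+1%:R * eta))) =
      1 - expR (- (M%:R * eta)).
    elim: (M) => [|k IH]; first by rewrite big_ord0 mul0r oppr0 expR0 subrr.
    by rewrite big_ord_recr /= IH; ring.
  apply: numdomain.Num.Theory.prodr_ile1 => j _; rewrite tele.
  rewrite gerBl expR_ge0 andbT subr_ge0 -expR0 ler_expR oppr_le0 mulr_ge0 //.
  exact: ltW.
Qed.

End Anticoncentration.

Section BadEvents.
Context {R : realType} {disp : measure_display} {Omega : measurableType disp}.
Variables (P : probability Omega R) (N : nat) (rR rL b : R).
Variable (Y : asep_index -> Omega -> R).
Local Notation m := (N.*2).
Local Notation clock := ('I_m * bool)%type.
Local Notation rate := (clock_rate rR rL).
Hypotheses (rate0 : forall d, 0 <= rate d).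
Hypothesis data : asep_data P b Y.

Let ind : mutually_independent P Y. Proof. by case: data. Qed.
Let mY i : measurable_fun setT (Y i). Proof. by case: ind. Qed.
Let eY (c : clock) j : std_exponential_rv P (Y (clock_index c j)).
Proof. by case: data => _ [_ H]; exact: H. Qed.

Definition all_waits_gt0 (w : Omega) := forall x d j, 0 < Y (inr (x, d, j)) w.

Lemma waits_gt0_ae : P.-negligible [set w | ~ all_waits_gt0 w].
Proof.
pose F (n : nat) : set Omega :=
  if unpickle n is Some (x, d, j) then [set w | Y (inr (x, d, j)) w <= 0] else set0.
apply: (@negligibleS _ _ _ _ (\bigcup_n F n)).
  move=> w /= /existsNP[x /existsNP[d /existsNP[j /negP]]]; rewrite -leNgt => H.
  move: (pickle (x, d, j)) (pickleK (x, d, j)) => n nE.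
  by exists n; rewrite // /F nE.
apply: negligible_bigcup => n; rewrite /F; case: (unpickle n) => [[[x d] j]|]; last first.
  exact: negligible_set0.
exists [set w | Y (inr (x, d, j)) w <= 0]; split=> //.
  have -> : [set w | Y (inr (x, d, j)) w <= 0] = Y (inr (x, d, j)) @^-1` [set` `]-oo, 0]].
    by apply/seteqP; split=> w /=; rewrite in_itv.
  by apply: measurable_preim => //; exact: measurable_itv.
by case: data => _ [_ H]; rewrite [LHS](H x d j 0 (lexx 0)) oppr0 expR0 subrr.
Qed.

Lemma expo_le (c : clock) j a : 0 <= a ->
  P (Y (clock_index c j) @^-1` [set` `]-oo, a]]) = (1 - expR (- a))%:E.
Proof.
move=> a0; rewrite -(eY c j a0); congr (P _).
Qed.

(** The event is split by whether the right clock of each bond rings: [g i] true leaves the left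
    clock free, false forces it to ring. The two weights of a bond add up to the probability that
    one of its clocks rings. *)
Lemma silent_fail (T : R) k (f : 'I_k -> 'I_m) : 0 <= T -> injective f ->
  outer_le P [set w | forall i, exists d, waits Y w (f i, d) 0 <= T * rate d]
    ((1 - expR (- (T * (rR + rL)))) ^+ k).
Proof.
move=> T0 fI; have a0 d : 0 <= T * rate d by rewrite mulr_ge0.
pose itv (s d : bool) : interval R := if d then (if s then `]-oo, T * rR] else `]T * rR, +oo[)
  else (if s then `]-oo, +oo[ else `]-oo, T * rL]).
pose pr (s d : bool) : R := if d then (if s then 1 - expR (- (T * rR)) else expR (- (T * rR)))
  else (if s then 1 else 1 - expR (- (T * rL))).
pose idx (t : 'I_k * bool) : asep_index := clock_index (f t.1, t.2) 0.
have idxI : injective idx.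
  by move=> [i d] [i' d'] /clock_index_inj[[/fI -> ->]].
have cov : outer_le P
   [set w | exists g : {ffun 'I_k -> bool}, forall t : 'I_k * bool,
     Y (idx t) w \in itv (g t.1) t.2]
   (\sum_(g <- enum {: {ffun 'I_k -> bool}}) \prod_(t : 'I_k * bool) pr (g t.1) t.2).
  apply: (outer_le_cover (A := fun g : {ffun 'I_k -> bool} =>
      [set w | forall t : 'I_k * bool, [set` itv (g t.1) t.2] (Y (idx t) w)])) =>
      [g _|w [g Hg]]; last by exists g; rewrite ?mem_enum.
  apply: (outer_le_rect (B := fun t : 'I_k * bool => [set` itv (g t.1) t.2]) ind idxI) =>
    [t|]; first exact: measurable_itv.
  move=> [i d]; rewrite /itv /pr /idx /=; case: d; case: (g i).
  - by rewrite expo_le // (a0 true).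
  - by rewrite (expo_gt _ (eY _ _)) // (a0 true).
  - have -> : Y (clock_index (f i, false) 0) @^-1` [set` `]-oo, +oo[] = setT.
      by apply/seteqP; split=> w //= _; rewrite in_itv.
    by rewrite probability_setT.
  - by rewrite expo_le // (a0 false).
apply: outer_le_sub cov => [w H|].
  exists [ffun i => waits Y w (f i, true) 0 <= T * rR] => -[i d]; rewrite ffunE /idx /=.
  have [d' Hd] := H i; rewrite /itv; case: d; case: leP => h; rewrite in_itv //= ?h //.
  by case: d' Hd => // /(lt_le_trans h); rewrite ltxx.
rewrite big_enum /= (eq_bigr (fun g : {ffun 'I_k -> bool} =>
  \prod_i (pr (g i) true * pr (g i) false))); last first.
  move=> g _; rewrite -(pair_bigA _ (fun i d => pr (g i) d)) /=.
  by apply: eq_bigr => i _; rewrite big_bool.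
rewrite -(bigA_distr_bigA (fun (i : 'I_k) s => pr s true * pr s false)) prodr_const card_ord.
rewrite big_bool /= /pr le_eqVlt; apply/orP; left; apply/eqP; congr (_ ^+ _).
have -> : expR (- (T * (rR + rL))) = expR (- (T * rR)) * expR (- (T * rL)).
  by rewrite -expRD; congr expR; ring.
ring.
Qed.

Lemma few_fail (T : R) K : 0 <= T ->
  outer_le P [set w | exists c : clock, 0 < rate c.2 /\
      forall j, (j <= K)%N -> waits Y w c j <= rate c.2 * T]
    (#|{: clock}|%:R * (1 - expR (- (T * (rR + rL)))) ^+ K.+1).
Proof.
move=> T0.
apply: (outer_le_fin (A := fun c : clock => [set w | 0 < rate c.2 /\
      forall j, (j <= K)%N -> waits Y w c j <= rate c.2 * T])) => [c|w [c Hc]]; last by exists c.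
have cov : outer_le P [set w | forall j : 'I_K.+1,
    [set` `]-oo, rate c.2 * T]] (Y (clock_index c j) w)]
    (\prod_(j < K.+1) (1 - expR (- (rate c.2 * T)))).
  apply: (outer_le_rect (f := fun j : 'I_K.+1 => clock_index c j)
    (B := fun=> [set` `]-oo, rate c.2 * T]]) ind).
  - by move=> j j' /clock_index_inj[_ /val_inj].
  - by move=> j; exact: measurable_itv.
  - by move=> j; rewrite expo_le // mulr_ge0.
apply: outer_le_sub cov => [w [_ H] j /=|]; first by rewrite in_itv; apply: H; rewrite -ltnS.
rewrite prodr_const card_ord; apply: lerXn2r; rewrite ?nnegrE ?subr_ge0 -?[leRHS]expR0 ?ler_expR.
- by rewrite oppr_le0 mulr_ge0.
- by rewrite oppr_le0 mulr_ge0 // addr_ge0 ?(rate0 true) ?(rate0 false).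
- rewrite lerD2l lerN2 ler_expR lerN2 mulrC ler_wpM2l //.
  by have := rate0 true; have := rate0 false; rewrite /clock_rate; case: ifP; lra.
Qed.

(** The variable left free is the first waiting time of [c]: it enters the [k]-th ring with
    coefficient [(rate c.2)^-1] and is independent of everything else in the comparison. *)
Lemma ring_anticoncentration (c : clock) k (J : finType) (f : J -> clock * nat)
    (a : J -> R) (z B del : R) : 0 < rate c.2 -> injective f -> (forall j, (f j).1 != c) ->
  0 < del -> 0 < B ->
  outer_le P [set w | [/\ all_waits_gt0 w, forall j, (j <= k)%N -> waits Y w c j <= B,
      forall j, waits Y w (f j).1 (f j).2 <= B &
      `|ring rR rL Y w c k - (\sum_j a j * waits Y w (f j).1 (f j).2 + z)| <= del]]
    (5%:R * (rate c.2 * del)).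
Proof.
move=> r0 fI fc d0 B0; pose J' := ('I_k + J)%type.
pose f' (t : J') : asep_index := match t with inl i => clock_index c i.+1
  | inr j => clock_index (f j).1 (f j).2 end.
pose a' (t : J') : R := if t is inr j then - (rate c.2 * a j) else 1.
have H := @anticoncentration R _ _ P _ Y (clock_index c 0) J' f' a' (rate c.2 * z)
  (rate c.2 * del) B ind (eY c 0).
apply: outer_le_sub (H _ _ _ _ _) => //.
- move=> w [w0 wc wf wd] /=; split.
    rewrite big_sumType /=.
    apply: le_trans (_ : rate c.2 * `|ring rR rL Y w c k -
      (\sum_j a j * waits Y w (f j).1 (f j).2 + z)| <= _); last first.
      by rewrite ler_pM2l.
    rewrite -[in leRHS](gtr0_norm r0) -normrM ringE mulrBr [_ * (_ / _)]mulrC divfK ?gt_eqF //.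
    rewrite le_eqVlt; apply/orP; left; apply/eqP; congr (`|_|).
    rewrite big_ord_recl /= mulrDr mulr_sumr.
    under [\sum_(i < k) 1 * _]eq_bigr do rewrite mul1r.
    rewrite (eq_bigr (fun j => - (rate c.2 * (a j * waits Y w (f j).1 (f j).2)))); last first.
      by move=> j _; rewrite mulNr mulrA.
    by rewrite sumrN opprD !addrA.
  move=> [i|j] /=; apply/andP; split; [exact: w0|exact: wc|exact: w0|exact: wf].
- by move=> [i|j]; exact: eY.
- move=> [i|j] [i'|j'] //= /clock_index_inj[].
  + by move=> _ [/val_inj ->].
  + by move=> e; have := fc j'; rewrite -e eqxx.
  + by move=> e; have := fc j; rewrite e eqxx.
  + by move=> e1 e2; congr inr; apply: fI; rewrite [f j]surjective_pairing e1 e2 -surjective_pairing.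
- move=> [i|j] /=; apply/eqP => /clock_index_inj[] //.
  by move=> e; have := fc j; rewrite e eqxx.
- by rewrite mulr_gt0.
Qed.

Lemma sum_le_each (n : nat) (E : nat -> R) (B : R) : (forall j, 0 < E j) ->
  \sum_(j < n.+1) E j <= B -> forall j, (j <= n)%N -> E j <= B.
Proof.
move=> E0 EB j jn; apply: le_trans EB; have jn1 : (j < n.+1)%N by [].
rewrite (bigD1 (Ordinal jn1)) //= lerDl; apply: sumr_ge0 => i _; exact: ltW.
Qed.

Lemma waits_le_ring w (c : clock) k (T : R) : all_waits_gt0 w -> 0 < rate c.2 ->
  ring rR rL Y w c k <= T -> forall j, (j <= k)%N -> waits Y w c j <= rate c.2 * T.
Proof.
move=> w0 r0; rewrite ringE ler_pdivrMr // mulrC => H.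
by apply: sum_le_each => // j; exact: w0.
Qed.

Lemma sep_fail (T del : R) K : 0 < T -> 0 < del ->
  outer_le P [set w | all_waits_gt0 w /\ exists c c' : clock, exists k k' : nat,
    [/\ 0 < rate c.2, 0 < rate c'.2, c != c', (k <= K)%N & (k' <= K)%N] /\
    [/\ ring rR rL Y w c k <= T, ring rR rL Y w c' k' <= T &
     `|ring rR rL Y w c k - ring rR rL Y w c' k'| <= del]]
   (#|{: (clock * clock) * ('I_K.+1 * 'I_K.+1)}|%:R * (5%:R * ((rR + rL) * del))).
Proof.
move=> T0 d0; have [hR hL] := (rate0 true, rate0 false); rewrite /= in hR hL.
have rs d : rate d <= rR + rL by case: d; rewrite /=; lra.
apply: (outer_le_fin (A := fun t : (clock * clock) * ('I_K.+1 * 'I_K.+1) => [set w | 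
    all_waits_gt0 w /\ [/\ 0 < rate t.1.1.2, 0 < rate t.1.2.2, t.1.1 != t.1.2,
       ring rR rL Y w t.1.1 t.2.1 <= T & ring rR rL Y w t.1.2 t.2.2 <= T /\
     `|ring rR rL Y w t.1.1 t.2.1 - ring rR rL Y w t.1.2 t.2.2| <= del]]));
  last first.
  move=> w [w0 [c [c' [k [k' [[r0 r0' cc' kK kK'] [c1 c2 c3]]]]]]].
  by exists ((c, c'), (Ordinal (kK : (k < K.+1)%N), Ordinal (kK' : (k' < K.+1)%N))).
move=> [[c c'] [k k']] /=; rewrite -/(nat_of_ord _).
have [r0|nr] := boolP ((0 < rate c.2) && (0 < rate c'.2) && (c' != c)); last first.
  exists set0; split; [exact: measurable0| |].
    by move=> w [_ [r1 r2 cc' _ _]]; move: nr; rewrite r1 r2 eq_sym cc'.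
  by rewrite measure0 lee_fin !mulr_ge0 ?addr_ge0 // ltW.
have {r0} [r0 r0' cc'] : [/\ 0 < rate c.2, 0 < rate c'.2 & c' != c] by move: r0 => /andP[/andP[]].
have B0 : 0 < (rR + rL) * T by rewrite mulr_gt0 // (lt_le_trans r0).
have H := @ring_anticoncentration c k 'I_k'.+1 (fun j => (c', nat_of_ord j))
  (fun=> (rate c'.2)^-1) 0 ((rR + rL) * T) del r0 _ _ d0 B0.
apply: outer_le_sub (H _ _) => //.
- move=> w [w0 [_ _ _ c1 [c2 c3]]]; split=> //.
  + move=> j jk; apply: le_trans (waits_le_ring w0 r0 c1 jk) _.
    by rewrite ler_wpM2r // ltW.
  + move=> j /=; apply: le_trans (waits_le_ring w0 r0' c2 _) _; first by rewrite -ltnS.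
    by rewrite ler_wpM2r // ltW.
  + by rewrite addr0 /= -mulr_sumr mulrC -ringE.
- by rewrite ler_wpM2l // ler_wpM2r // ltW.
- by move=> j j' [/val_inj].
Qed.

Lemma sepT_fail (T T' del : R) K : 0 < T' -> 0 < del ->
  outer_le P [set w | all_waits_gt0 w /\ exists (c : clock) (k : nat),
    [/\ 0 < rate c.2, (k <= K)%N, ring rR rL Y w c k <= T' &
     `|ring rR rL Y w c k - T| <= del]]
   (#|{: clock * 'I_K.+1}|%:R * (5%:R * ((rR + rL) * del))).
Proof.
move=> T0 d0; have [hR hL] := (rate0 true, rate0 false); rewrite /= in hR hL.
have rs d : rate d <= rR + rL by case: d; rewrite /=; lra.
apply: (outer_le_fin (A := fun t : clock * 'I_K.+1 => [set w | 
    all_waits_gt0 w /\ [/\ 0 < rate t.1.2, ring rR rL Y w t.1 t.2 <= T' &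
     `|ring rR rL Y w t.1 t.2 - T| <= del]])); last first.
  move=> w [w0 [c [k [r0 kK c1 c2]]]].
  by exists (c, Ordinal (kK : (k < K.+1)%N)).
move=> [c k] /=.
have [r0|nr] := boolP (0 < rate c.2); last first.
  exists set0; split; [exact: measurable0| |].
    by move=> w [_ []].
  by rewrite measure0 lee_fin !mulr_ge0 ?addr_ge0 // ltW.
have B0 : 0 < (rR + rL) * T' by rewrite mulr_gt0 // (lt_le_trans r0).
have H := @ring_anticoncentration c k void (fun j => match j with end)
  (fun=> 0) T ((rR + rL) * T') del r0 _ _ d0 B0.
apply: outer_le_sub (H _ _) => //.
- move=> w [w0 [_ c1 c2]]; split=> //.
  + move=> j jk; apply: le_trans (waits_le_ring w0 r0 c1 jk) _.
    by rewrite ler_wpM2r // ltW.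
  + by rewrite big1 ?add0r // => -[].
- by rewrite ler_wpM2l // ler_wpM2r // ltW.
Qed.

End BadEvents.

Lemma exists_expr_le (R : realType) (q A e : R) : 0 <= q < 1 -> 0 <= A -> 0 < e ->
  exists K0, forall K, (K0 <= K)%N -> A * q ^+ K <= e.
Proof.
move=> /andP[q0 q1] A0 e0.
have c : (GRing.exp q : R^nat) @ \oo --> 0 by apply: cvg_expr; rewrite ger0_norm.
have e1 : 0 < e / (A + 1) by rewrite divr_gt0 // ltr_wpDl.
have /cvgrPdist_le /(_ _ e1)[K0 _ H] := c.
exists K0 => K KK; have := H K KK; rewrite sub0r normrN ger0_norm ?exprn_ge0 // => h.
have A1 : 0 < A + 1 by rewrite ltr_wpDl.
rewrite ler_pdivlMr // in h; apply: le_trans h.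
by rewrite mulrC ler_wpM2l ?exprn_ge0 // lerDl.
Qed.

(** * From the chain to the process on the line *)

Section Transfer.
Context {R : realType} {disp : measure_display} {Omega : measurableType disp}.
Variables (P : probability Omega R) (N : nat) (rR rL b T : R).
Variables (Y : asep_index -> Omega -> R) (Q : R -> Omega -> int).
Local Notation m := (N.*2).
Local Notation rate := (clock_rate rR rL).
Local Notation clock := ('I_m * bool)%type.
Hypotheses (rR0 : 0 <= rR) (rL0 : 0 <= rL) (s0 : 0 < rR + rL) (T0 : 0 < T).
Hypothesis b01 : 0 < b < 1.
Hypothesis data : asep_data P b Y.
Hypothesis QP : second_class_process P rR rL Y Q.
Variable (o : 'I_m.+1).
Hypothesis oN : o = N :> nat.

Let rate0 d : 0 <= rate d. Proof. by case: d. Qed.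

Lemma measurable_position (p : pred int) : measurable [set w | p (Q T w)].
Proof.
have -> : [set w | p (Q T w)] = \bigcup_y if p y then [set w | Q T w = y] else set0.
  apply/seteqP; split=> [w pw|w [y _]] /=; first by exists (Q T w); rewrite //= pw.
  by case: ifP => // py /= ->.
apply: countable_bigcupT_measurable => [|y]; first exact: countableP.
by case: ifP => _; [exact: (QP.1 T y)|exact: measurable0].
Qed.

Lemma avg_le (n : nat) p (F G : @config n -> R) : (forall z, 0 <= p z <= 1) ->
  (forall c, F c <= G c) -> avg p F <= avg p G.
Proof.
move=> p01 FG; apply: pavg_le => [z c|c _]; last exact: FG.
by have /andP[? ?] := p01 z; rewrite /bern; case: c; rewrite ?subr_ge0.
Qed.

Definition silent_fail_set (k : nat) (f : 'I_k -> 'I_m) :=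
  [set w | forall i, exists d, waits Y w (f i, d) 0 <= T * rate d].

Lemma not_silent_fail k (f : 'I_k -> 'I_m) w : ~ silent_fail_set f w ->
  exists i, forall d, 0 < rate d -> T < ring rR rL Y w (f i, d) 0.
Proof.
move=> /existsNP[i Hi]; exists i => d rd.
rewrite ringE big_ord_recr big_ord0 /= add0r ltr_pdivlMr // ltNge; apply/negP => h.
by apply: Hi; exists d.
Qed.

Lemma negligible_outer (A : set Omega) : P.-negligible A -> outer_le P A 0.
Proof. by move=> [M [mM M0 AM]]; exists M; rewrite M0. Qed.

Lemma dens_itv z : 0 <= dens o b 1 b z <= 1.
Proof.
have /andP[b0 b1] := b01.
by rewrite /dens; case: ifP => _; [|case: ifP => _]; rewrite ?ler01 ?lexx // !ltW.
Qed.

(** The order of choices matters: [K] bounds the number of rings of any clock up to [T + 1] whatever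
    [h] is, and for fixed [K] only finitely many pairs of rings have to be separated, which small
    [h] achieves. The first factor [2] is the total loss in [event_op_le], the second counts the two
    sides on which a silent bond is sought. *)
Lemma chain_transfer (p : pred int) (e : R) : 0 < e ->
  exists K (eta : R), 0 < eta /\ forall (h : R) n, 0 < h -> h <= eta ->
    h * n%:R = T + h * K%:R ->
    (P [set w | p (Q T w)] <=
     (2%:R * avg (dens o b 1 b) (fun c => iter n (bond_op (h * rR) (h * rL) tagged_step)
        (fun s => (p (box_pos N s.2))%:R) (c, o)) +
      2%:R * (1 - expR (- (T * (rR + rL)))) ^+ N + e)%:E)%E.
Proof.
move=> e0; set s := rR + rL; have T1 : 0 < T + 1 by rewrite addr_gt0.
pose q1 : R := 1 - expR (- ((T + 1) * s)).
have q101 : 0 <= q1 < 1.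
  by rewrite subr_ge0 -[leRHS]expR0 ler_expR oppr_le0 ltrBlDr ltrDl expR_gt0 andbT mulr_ge0 ?ltW.
have [K HK] := @exists_expr_le R q1 #|{: clock}|%:R (e / 2) q101
  (ler0n _ _) (divr_gt0 e0 (ltr0Sn _ _)).
pose C1 : R := #|{: (clock * clock) * ('I_K.+1 * 'I_K.+1)}|%:R * (5%:R * (s * K.+1%:R)).
pose C2 : R := #|{: clock * 'I_K.+1}|%:R * (5%:R * (s * K.+1%:R)).
have C10 : 0 <= C1 by rewrite !mulr_ge0 // ltW.
have C20 : 0 <= C2 by rewrite !mulr_ge0 // ltW.
pose x1 : R := m%:R * s; have x10 : 0 <= x1 by rewrite mulr_ge0 // ltW.
(* In this order: separation fails with probability at most [e / 2]; the extra [K] slots last at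
   most [1]; the total rate [x] is at most [1 / 2]; and [(1 + 2 * x ^+ 2) ^+ n] is at most [2]. *)
pose eta1 : R := e / (2 * (C1 + C2 + 1)).
pose eta2 : R := (K.+1%:R)^-1.
pose eta3 : R := (2 * x1 + 1)^-1.
pose eta4 : R := (4 * (T + 1) * x1 ^+ 2 + 1)^-1.
have D3 : 0 < 2 * x1 + 1 by rewrite ltr_wpDl // mulr_ge0.
have D4 : 0 < 4 * (T + 1) * x1 ^+ 2 + 1 by rewrite ltr_wpDl // !mulr_ge0 ?exprn_ge0 // ltW.
have D1 : 0 < 2 * (C1 + C2 + 1) by rewrite mulr_gt0 // ltr_wpDl // addr_ge0.
exists K, (Num.min (Num.min eta1 eta2) (Num.min eta3 eta4)); split.
  by rewrite !lt_min divr_gt0 //= !invr_gt0 D3 D4 ltr0Sn.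
move=> h n h0; rewrite !le_min => /andP[/andP[h1 h2] /andP[h3 h4]] hn.
have hK : h * K%:R <= 1.
  have : h * K.+1%:R <= 1 by rewrite -ler_pdivlMr // mul1r.
  by apply: le_trans; rewrite ler_pM2l // ler_nat.
have hn1 : h * n%:R <= T + 1 by rewrite hn lerD2l.
pose del := K.+1%:R * h; have del0 : 0 < del by rewrite mulr_gt0.
(* The [N] bonds on each side of the origin; one silent bond per side isolates the block. *)
pose fL (i : 'I_N) : 'I_m := cast_ord (addnn N) (lshift N i).
pose fR (i : 'I_N) : 'I_m := cast_ord (addnn N) (rshift N i).
have fLI : injective fL by move=> i j /cast_ord_inj /lshift_inj.
have fRI : injective fR by move=> i j /cast_ord_inj /rshift_inj.
have BL := silent_fail rate0 data (ltW T0) fLI.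
have BR := silent_fail rate0 data (ltW T0) fRI.
have Bf := few_fail N rate0 data K (ltW T1).
have Bs := sep_fail N rate0 data K T1 del0.
have BT := sepT_fail N rate0 data T K T1 del0.
have B0 := negligible_outer (waits_gt0_ae data).
have B1 := negligible_outer QP.2.
have [M [mM BM PM]] := outer_leU B0 (outer_leU B1 (outer_leU BL (outer_leU BR
  (outer_leU Bf (outer_leU Bs BT))))).
have {PM} PM : (P M <= (2%:R * (1 - expR (- (T * s))) ^+ N + e)%:E)%E.
  apply: le_trans PM _; rewrite lee_fin -/s !add0r.
  have := HK K.+1 (leqnSn K); rewrite /q1 => E1.
  have E2 : (C1 + C2) * h <= e / 2.
    have : h * (2 * (C1 + C2 + 1)) <= e by rewrite -ler_pdivlMr.
    have : 0 <= h * 1 by rewrite mulr1 ltW.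
    by move: C10 C20; set A := C1; set B := C2 => ? ?; lra.
  have -> : #|{: (clock * clock) * ('I_K.+1 * 'I_K.+1)}|%:R * (5%:R * (s * del)) = C1 * h.
    by rewrite /C1 /del; ring.
  have -> : #|{: clock * 'I_K.+1}|%:R * (5%:R * (s * del)) = C2 * h.
    by rewrite /C2 /del; ring.
  set q := (1 - _) ^+ N; move: E1 E2; set E := _ * (1 - _) ^+ K.+1 => E1 E2.
  lra.
pose G := [set w | p (Q T w)] `\` M.
have mA := measurable_position p.
have mG : measurable G by exact: measurableD.
apply: (@le_trans _ _ (P G + P M)%E).
  apply: (@le_trans _ _ (P (G `|` M))); last exact: measureU2.
  apply: le_measure; rewrite ?inE //; first exact: measurableU.
  by move=> w pw; have [|] := pselect (M w); [right|left].
rewrite -addrA EFinD; apply: leeD => //.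
have notB (B : set Omega) w : G w -> B `<=` M -> ~ B w by move=> [_ nM] BM' Bw; apply/nM/BM'.
move: BM; rewrite !subUset => -[M0 [M1 [ML [MR [Mf [Ms MT]]]]]].
have wpos w : G w -> all_waits_gt0 Y w by move=> Gw; apply: contrapT; exact: notB Gw M0.
have few w : G w -> forall c : clock, 0 < rate c.2 -> T + 1 < ring rR rL Y w c K.
  move=> Gw c rc; rewrite ltNge; apply/negP => cK; apply: (notB _ _ Gw Mf).
  exists c; split=> // j jK; exact: (waits_le_ring (wpos w Gw) rc cK).
have sep w : G w -> forall (c c' : clock) k k', 0 < rate c.2 -> 0 < rate c'.2 -> c != c' ->
    (k <= K)%N -> (k' <= K)%N -> ring rR rL Y w c k <= T + 1 ->
    ring rR rL Y w c' k' <= T + 1 ->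
    K.+1%:R * h < `|ring rR rL Y w c k - ring rR rL Y w c' k'|.
  move=> Gw c c' k k' rc rc' cc' kK kK' c1 c2; rewrite ltNge; apply/negP => c3.
  by apply: (notB _ _ Gw Ms); split; [exact: wpos|exists c, c', k, k'].
have sepT w : G w -> forall (c : clock) k, 0 < rate c.2 -> (k <= K)%N ->
    ring rR rL Y w c k <= T + 1 -> K.+1%:R * h < `|ring rR rL Y w c k - T|.
  move=> Gw c k rc kK c1; rewrite ltNge; apply/negP => c3.
  by apply: (notB _ _ Gw MT); split; [exact: wpos|exists c, k].
apply: le_trans (@good_prob _ _ _ P N rR rL h b n Y (ltW h0) rate0 data o oN G
  (fun s => (p (box_pos N s.2))%:R) mG _ _ _ _) _.
- by move=> ?; rewrite ler0n.
- move=> w l Gw ln C; apply: (compatible_extend (wpos w Gw) h0 rate0 (few w Gw) (sep w Gw) C).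
  by apply: le_trans hn1; rewrite ler_pM2l // ler_nat.
- move=> w Gw c j /=; case: eqP => [->|_]; last by rewrite in_itv.
  by rewrite in_itv andbT; exact: wpos.
- move=> w l c Gw ln C cw co.
  have [eta1' [eta2' [P1 [P2 Hq]]]] := contrapT (notB _ _ Gw M1).
  have [i1 S1] := not_silent_fail (notB _ _ Gw ML).
  have [i2 S2] := not_silent_fail (notB _ _ Gw MR).
  have silent y d : y = fL i1 \/ y = fR i2 -> 0 < rate d -> T < ring rR rL Y w (y, d) 0.
    by case=> ->; [exact: S1|exact: S2].
  have hl : h * (size l)%:R = T + h * K%:R by rewrite ln.
  have bo : (fL i1 < o <= fR i2)%N by rewrite /= oN ltn_ord leq_addr.
  have := second_class_position (wpos w Gw) h0 rate0 (few w Gw) (sep w Gw) (sepT w Gw)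
    silent (ltW T0) C hl hK bo oN co cw P1 P2 (Hq T (ltW T0)).
  by case: Gw => /= pQ _ <-; rewrite pQ.
- rewrite lee_fin; set x := m%:R * (h * rR + h * rL).
  have xE : x = h * x1 by rewrite /x /x1 /s; ring.
  have hR : 0 <= h * rR by rewrite mulr_ge0 // ltW.
  have hL : 0 <= h * rL by rewrite mulr_ge0 // ltW.
  have x2 : x <= 2^-1.
    rewrite xE; apply: le_trans (ler_wpM2r x10 h3) _; rewrite /eta3 mulrC ler_pdivrMr //; lra.
  have x0 : 0 <= x by rewrite xE mulr_ge0 // ltW.
  have E2 : (1 + 2%:R * x ^+ 2) ^+ n <= 2%:R.
    apply: (@le_trans _ _ (expR (n%:R * (2%:R * x ^+ 2)))).
      rewrite expRM_natl; apply: lerXn2r; rewrite ?nnegrE ?expR_ge0 ?expR_ge1Dx //.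
      by rewrite addr_ge0 // mulr_ge0 // exprn_ge0.
    have nx : n%:R * (2%:R * x ^+ 2) <= 2^-1.
      have -> : n%:R * (2%:R * x ^+ 2) = (h * n%:R) * (2%:R * x1 ^+ 2 * h).
        by rewrite xE; ring.
      apply: le_trans (ler_wpM2r _ hn1) _; first by rewrite !mulr_ge0 ?exprn_ge0 // ltW.
      have c0 : 0 <= (T + 1) * (2 * x1 ^+ 2) by rewrite !mulr_ge0 ?exprn_ge0 // ltW.
      rewrite mulrA; apply: le_trans (ler_wpM2l c0 h4) _.
      rewrite /eta4 ler_pdivrMr //; lra.
    apply: (@le_trans _ _ (expR 2^-1)); first by rewrite ler_expR.
    have := expR_ge1Dx (- (2^-1 : R)); rewrite expRN => e1.
    have e2 : 0 < expR (2^-1 : R) := expR_gt0 _.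
    by rewrite -(@ler_pM2l _ (2^-1 * (expR 2^-1)^-1)) ?mulr_gt0 ?invr_gt0 //
      -mulrA mulVf ?gt_eqF // mulr1; lra.
  have wm : m%:R * (h * rR + h * rL) <= 1 by rewrite -/x (le_trans x2) // invf_le1 // ler1n.
  have -> F : 2%:R * avg (dens o b 1 b) F = avg (dens o b 1 b) (fun c => 2%:R * F c).
    by rewrite /avg pavgZ.
  apply: avg_le dens_itv _ => c.
  apply: le_trans (event_op_le (ltW h0) rate0 tagged_step n (c, o) x2 _) _.
    by move=> ?; rewrite ler0n.
  apply: ler_wpM2r => //.
  by have := @bond_op_le R m _ _ hR hL wm _ tagged_step (fun=> 0) (fun s => (p (box_pos N s.2))%:R)
    n (c, o) (fun=> ler0n _ _); rewrite bond_op_cst.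
Qed.

End Transfer.

(** * Tail bounds *)

Lemma mesh (R : realType) (T eta : R) (K : nat) : 0 < T -> 0 < eta ->
  exists h n, [/\ 0 < h, h <= eta & h * n%:R = T + h * K%:R].
Proof.
move=> T0 e0; pose k := (Num.bound (T / eta)).+1.
have k0 : 0 < k%:R :> R by rewrite ltr0n.
exists (T / k%:R), (k + K)%N; split; first by rewrite divr_gt0.
  rewrite ler_pdivrMr // -ler_pdivrMl // mulrC; apply: ltW.
  apply: lt_le_trans (archi_boundP _) _; first by rewrite divr_ge0 // ltW.
  by rewrite /k ler_nat leqnSn.
by rewrite natrD mulrDr divfK // gt_eqF.
Qed.

Lemma expR_lower (R : realType) (y : R) n : 0 <= y <= 2^-1 ->
  expR (- (2 * y * n%:R)) <= (1 - y) ^+ n.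
Proof.
move=> /andP[y0 y2]; rewrite -mulNr expRM_natr; apply: lerXn2r; rewrite ?nnegrE ?expR_ge0 //.
  lra.
have e1 : expR (- (2 * y)) * (1 + 2 * y) <= 1.
  rewrite -[leRHS](expRxMexpNx_1 (2 * y)) [leLHS]mulrC ler_wpM2r ?expR_ge0 //.
  exact: expR_ge1Dx.
have p1 : 0 < 1 + 2 * y by lra.
rewrite -(ler_pM2r p1); apply: le_trans e1 _.
have : 0 <= y * (1 - 2 * y) by rewrite mulr_ge0 //; lra.
lra.
Qed.

(** [D] bonds on each side of the origin leave room for the threshold, and [K0] further ones serve
    to find a silent bond. *)
Lemma int_offset (xi : int) (K0 : nat) : exists x : nat,
  let D := (absz xi).+1 in let N := (K0 + D)%N in
  [/\ x%:Z = N%:Z + xi, (N - D <= x)%N & (x <= N + D)%N].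
Proof. by exists (absz ((K0 + (absz xi).+1)%N%:Z + xi)) => /=; split; lia. Qed.

Section ChainBound.
Context {R : realType} (rR rL : R).
Hypotheses (rR0 : 0 <= rR) (rRL : rR < rL).
Local Notation g := (rL - rR).

(** [E] is a free target for the errors of the finite box; the box depends on it while [C] and [c]
    do not. It is later taken equal to the exponential bound itself. *)
Lemma chain_bound (lam : R) : 0 < lam < 1 ->
  exists C c : R, [/\ 0 < C, 0 < c & forall (T u E : R) (xi : int),
    1 <= T -> 8 <= u <= T * g ->
    g * (1 - 2 * lam) * T + u - 1 <= xi%:~R <= g * (1 - 2 * lam) * T + u -> 0 < E ->
    exists N x : nat, [/\ x%:Z = N%:Z + xi, (x <= N.*2)%N,
      (1 - expR (- (T * (rR + rL)))) ^+ N <= E &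
      forall K, exists eta : R, 0 < eta /\ forall (h : R) n (o : 'I_(N.*2).+1),
        o = N :> nat -> 0 < h -> h <= eta -> h * n%:R = T + h * K%:R ->
        (N.*2)%:R * (h * rL + h * rR) <= 1 /\
        avg (dens o lam 1 lam) (fun c => iter n
           (bond_op (h * rL) (h * rR) tagged_step) (fun s => (x < s.2)%N%:R) (c, o)) <=
        C * expR (- (c * u ^+ 3) / (T * g) ^+ 2) + C * E]].
Proof.
move=> lam01; have [C [c [C0 c0 H]]] := chain_right_tail rR0 rRL lam01.
exists C, (c / 16); split=> // [|T u E xi T1 /andP[u8 uT] /andP[x1 x2] E0].
  by rewrite divr_gt0.
have g0 : 0 < g by rewrite subr_gt0.
have s0 : 0 < rR + rL by rewrite ltr_wpDl // (le_lt_trans rR0).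
set s := rR + rL in s0 *.
(* The factor [2] is lost in [expR_lower] and [T + 1] bounds [h * n]. This one rate controls silent
   bonds both for the chain and in continuous time. *)
pose q2 : R := 1 - expR (- (2 * s * (T + 1))).
have q201 : 0 <= q2 < 1.
  rewrite subr_ge0 -[leRHS]expR0 ler_expR oppr_le0 ltrBlDr ltrDl expR_gt0 andbT.
  by rewrite !mulr_ge0 ?(ltW s0) //; lra.
have [K0 HK0] := exists_expr_le q201 ler01 E0.
pose D := (absz xi).+1; pose N := (K0 + D)%N.
have DN : (D <= N)%N by exact: leq_addl.
have [x [xE xlo xhi]] := int_offset xi K0; rewrite -/D -/N in xE xlo xhi.
have q2N k : (K0 <= k)%N -> q2 ^+ k <= E by move=> /HK0; rewrite mul1r.
exists N, x; split=> //.
- by apply: leq_trans xhi _; rewrite -addnn leq_add2l.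
- apply: le_trans (q2N N (leq_addr _ _)); apply: lerXn2r; rewrite ?nnegrE //.
  + rewrite subr_ge0 -[leRHS]expR0 ler_expR oppr_le0 mulr_ge0 ?(ltW s0) //; lra.
  + by case/andP: q201.
  + rewrite lerD2l lerN2 ler_expR lerN2 mulrC.
    have := ltW s0; nra.
move=> K; pose A : R := (N.*2 + 2)%:R * s + 2 * s + K%:R * (g + 1) + 1.
have [a1 a2 a3] : [/\ 0 <= (N.*2 + 2)%:R * s, 0 <= s & 0 <= K%:R * (g + 1)].
  by split; [rewrite mulr_ge0 // ltW|exact: ltW|rewrite mulr_ge0 // ltW // ltr_wpDr].
have A0 : 0 < A by rewrite /A; lra.
exists A^-1; split=> [|h n o oN h0 hA hn]; first by rewrite invr_gt0.
have hA1 : h * A <= 1 by rewrite -ler_pdivlMr // div1r.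
have [b1 b2 b3] : [/\ 0 <= h * ((N.*2 + 2)%:R * s), 0 <= h * s & 0 <= h * (K%:R * (g + 1))].
  by split; rewrite mulr_ge0 // ltW.
have hs2 : 0 <= h * s <= 2^-1 by rewrite b2 /=; rewrite /A in hA1; lra.
have hK0 : 0 <= h * K%:R by rewrite mulr_ge0 // ltW.
have hKg0 : 0 <= h * K%:R * g by rewrite mulr_ge0 // ltW.
have hKg : h * K%:R * g <= 1 by rewrite /A in hA1; lra.
have hK1 : h * K%:R <= 1 by rewrite /A in hA1; lra.
have hm : (N.*2 + 2)%:R * (h * rL + h * rR) <= 1.
  have -> : (N.*2 + 2)%:R * (h * rL + h * rR) = h * ((N.*2 + 2)%:R * s) by rewrite /s; ring.
  rewrite /A in hA1; lra.
have wS0 : 0 <= h * rL + h * rR.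
  by have -> : h * rL + h * rR = h * s by rewrite /s; ring.
split; first by apply: le_trans hm; rewrite ler_wpM2r // ler_nat leq_addr.
have Nm : (N < N.*2)%N by rewrite -addnn -[ltnLHS]addn0 ltn_add2l /N /D addnS.
have oE : o = lsite (Ordinal Nm) by apply: val_inj; exact: oN.
pose bb := (h * rL - h * rR) * n%:R.
have bbE : bb = g * T + h * K%:R * g.
  have -> : bb = g * (h * n%:R) by rewrite /bb; ring.
  by rewrite hn; ring.
(* The excess as seen by the chain, whose time [bb] is longer than [g * T] by at most [1]. This and
   the rounding of [xi] cost at most [2] in all, a quarter of [u] as soon as [8 <= u]. *)
pose u' := xi%:~R - bb * (1 - 2 * lam).
have [l0 l1] := andP lam01.
have du : `|h * K%:R * g * (1 - 2 * lam)| <= 1.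
  rewrite normrM ger0_norm //; apply: mulr_ile1 => //.
  rewrite ler_norml; apply/andP; split; lra.
have u'E : u' = xi%:~R - g * (1 - 2 * lam) * T - h * K%:R * g * (1 - 2 * lam).
  by rewrite /u' bbE; ring.
have [d1 d2] : -1 <= h * K%:R * g * (1 - 2 * lam) /\ h * K%:R * g * (1 - 2 * lam) <= 1.
  by move: du; rewrite ler_norml => /andP.
have u'1 : 3 / 4 * u <= u' by rewrite u'E; lra.
have u'2 : u' <= u + 1 by rewrite u'E; lra.
have bb1 : T * g <= bb by rewrite bbE; lra.
have bb2 : bb <= 2 * (T * g).
  by rewrite bbE; lra.
have Tg0 : 0 < T * g by lra.
have bound : (1 - (1 - (h * rL + h * rR)) ^+ n) ^+ (N - D) <= E.
  have ND : (K0 <= N - D)%N by rewrite /N addnK.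
  apply: le_trans (q2N _ ND); apply: lerXn2r; rewrite ?nnegrE.
  + rewrite subr_ge0; apply: exprn_ile1; rewrite ?subr_ge0.
      by have -> : h * rL + h * rR = h * s by [rewrite /s; ring]; lra.
    by rewrite gerBl.
  + by case/andP: q201.
  + rewrite lerD2l lerN2; have -> : h * rL + h * rR = h * s by rewrite /s; ring.
    apply: le_trans (expR_lower n hs2); rewrite ler_expR lerN2.
    have -> : 2 * (h * s) * n%:R = 2 * s * (h * n%:R) by ring.
    by rewrite hn ler_wpM2l ?mulr_ge0 // lerD2l.
rewrite oE; apply: le_trans (H N.*2 n h u' bb E (Ordinal Nm) x (N - D)%N (N + D)%N
  h0 hm erefl _ _ _ xlo _ xhi _ _ bound _) _ => //.
- lra.
- lra.
- rewrite /u' [RHS]addrC subrK /=.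
  have -> : xi = x%:Z - N%:Z by rewrite xE addrC addKr.
  by rewrite rmorphB /= -!pmulrn.
- exact: leq_subr.
- by rewrite /= /D addnS ltnS leq_addr.
- by rewrite -addnn leq_add2l.
- by have -> : (N.*2 - (N + D) = N - D)%N by rewrite -addnn subnDl.
rewrite lerD2r ler_pM2l // ler_expR !mulNr lerN2.
have bb0 : 0 < bb by lra.
rewrite ler_pdivrMr ?exprn_gt0 // [leRHS]mulrAC ler_pdivlMr ?exprn_gt0 //.
have U : u ^+ 3 * (27 / 64) <= u' ^+ 3.
  have -> : u ^+ 3 * (27 / 64) = (3 / 4 * u) ^+ 3 by field.
  by apply: lerXn2r; rewrite ?nnegrE //; lra.
have B : bb ^+ 2 <= 4 * (T * g) ^+ 2.
  have -> : 4 * (T * g) ^+ 2 = (2 * (T * g)) ^+ 2 by ring.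
  by apply: lerXn2r; rewrite ?nnegrE //; lra.
have u30 : 0 <= u ^+ 3 by apply: exprn_ge0; lra.
have t20 : 0 <= (T * g) ^+ 2 by apply: exprn_ge0; lra.
(* [(3 / 4) ^+ 3 / 4] exceeds [1 / 16]: the numerator loses a cube and [bb <= 2 * (T * g)] a
   square. *)
apply: (@le_trans _ _ (c / 16 * u ^+ 3 * (4 * (T * g) ^+ 2))).
  by rewrite ler_wpM2l // mulr_ge0 // divr_ge0 // ltW.
apply: (@le_trans _ _ (c * (u ^+ 3 * (27 / 64)) * (T * g) ^+ 2)); last first.
  by rewrite ler_wpM2r // ler_wpM2l // ltW.
have : 0 <= c * u ^+ 3 * (T * g) ^+ 2 by apply: mulr_ge0 => //; apply: mulr_ge0 => //; exact: ltW.
lra.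
Qed.

End ChainBound.

(** The predicate [p] and the comparison of averages stand for the symmetry in use, so that both
    tails share one argument. *)
Lemma one_sided_tail (R : realType) (b lam rR rL : R) :
  0 < b < 1 -> 0 < lam < 1 -> 0 <= rR -> rR < rL ->
  exists C c : R, [/\ 0 < C, 0 < c &
  forall (d : measure_display) (Omega : measurableType d)
         (P : probability Omega R) (Y : asep_index -> Omega -> R)
         (Q : R -> Omega -> int),
    asep_data P b Y -> second_class_process P rR rL Y Q ->
    forall (T u : R) (xi : int) (p : pred int), 1 <= T -> 8 <= u <= T * (rL - rR) ->
    (rL - rR) * (1 - 2 * lam) * T + u - 1 <= xi%:~R <= (rL - rR) * (1 - 2 * lam) * T + u ->
    (forall (N n x : nat) (h : R) (o : 'I_(N.*2).+1), o = N :> nat ->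
       x%:Z = N%:Z + xi -> (x <= N.*2)%N -> 0 <= h * rR -> 0 <= h * rL ->
       (N.*2)%:R * (h * rL + h * rR) <= 1 ->
       avg (dens o b 1 b) (fun c => iter n (bond_op (h * rR) (h * rL) tagged_step)
         (fun s => (p (box_pos N s.2))%:R) (c, o)) <=
       avg (dens o lam 1 lam) (fun c => iter n (bond_op (h * rL) (h * rR) tagged_step)
         (fun s => (x < s.2)%N%:R) (c, o))) ->
    (P [set w | p (Q T w)] <= (C * expR (- (c * u ^+ 3) / (T * (rL - rR)) ^+ 2))%:E)%E].
Proof.
move=> b01 lam01 rR0 rRL; have [C [c [C0 c0 H]]] := chain_bound rR0 rRL lam01.
have rL0 : 0 < rL := le_lt_trans rR0 rRL.
(* Twice the chain bound [C * E + C * E], then [2 * E] for the absence of a silent bond and [E] for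
   the other exceptional events. *)
exists (4 * C + 3), c; split=> // [|d Omega P Y Q data QP T u xi p T1 uT xiT cmp].
  by rewrite addr_gt0 ?mulr_gt0.
set E := expR _; have E0 : 0 < E := expR_gt0 _.
have [N [x [xE xN qN HK]]] := H T u E xi T1 uT xiT E0.
have T0 : 0 < T := lt_le_trans ltr01 T1.
have s0 : 0 < rR + rL by rewrite ltr_wpDl.
have oN : (inord N : 'I_(N.*2).+1) = N :> nat by rewrite inordK // ltnS -addnn leq_addr.
have [K [eta [eta0 HP]]] := chain_transfer rR0 (ltW rL0) s0 T0 b01 data QP oN p E0.
have [eta' [eta'0 HC]] := HK K.
have e0 : 0 < Num.min eta eta' by rewrite lt_min eta0.
have [h [n [h0 hE hn]]] := mesh K T0 e0; move: hE; rewrite le_min => /andP[h1 h2].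
apply: le_trans (HP h n h0 h1 hn) _; rewrite lee_fin.
have [wm bound] := HC h n _ oN h0 h2 hn.
have hR : 0 <= h * rR by rewrite mulr_ge0 // ltW.
have hL : 0 <= h * rL by rewrite mulr_ge0 // ltW.
have := cmp N n x h _ oN xE xN hR hL wm.
move: bound qN; rewrite -/E; set U := avg _ _; set V := avg _ _; set q := _ ^+ N.
move=> h3 h4 h5; lra.
Qed.

Lemma mirror_index (N x z : nat) (xi : int) : x%:Z = N%:Z + xi -> (x <= N.*2)%N ->
  (z%:Z - N%:Z < - xi) = (z < N.*2 - x)%N.
Proof. by move=> xE xN; apply/idP/idP; lia. Qed.

Theorem theorem2p5 (R : realType) (b rL rR : R) :
  0 < b < 1 -> 0 <= rR -> rR < rL ->
  exists C c : R, 0 < C /\ 0 < c /\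
  forall (d : measure_display) (Omega : measurableType d)
         (P : probability Omega R) (Y : asep_index -> Omega -> R)
         (Q : R -> Omega -> int),
    asep_data P b Y ->
    second_class_process P rR rL Y Q ->
    forall T u : R, 1 <= T -> 0 <= u <= T * (rL - rR) ->
      (P [set w | (u < `| (Q T w)%:~R - (rL - rR) * (2 * b - 1) * T |)%R] <=
      (C * expR (- (c * u ^+ 3) / (T * (rL - rR)) ^+ 2))%:E)%E.
Proof.
move=> b01 rR0 rRL; have /andP[b0 b1] := b01.
have b01' : 0 < 1 - b < 1 by lra.
(* Particle-hole exchange turns the density into [1 - b], reflection keeps it; accordingly
   [1 - 2 * lam] takes opposite values in the two tails. *)
have [C1 [c1 [C10 c10 H1]]] := @one_sided_tail R b (1 - b) rR rL b01 b01' rR0 rRL.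
have [C2 [c2 [C20 c20 H2]]] := @one_sided_tail R b b rR rL b01 b01 rR0 rRL.
set g := rL - rR in H1 H2 *; have g0 : 0 < g by rewrite subr_gt0.
pose c := Num.min c1 c2; have c0 : 0 < c by rewrite lt_min c10.
have cc1 : c <= c1 by rewrite ge_min lexx.
have cc2 : c <= c2 by rewrite ge_min lexx orbT.
(* For [u < 8] the bound is made trivial: since [1 <= T], the exponent is at most
   [c * 8 ^+ 3 / g ^+ 2]. *)
pose C3 := expR (c * 512 / g ^+ 2); have C30 : 0 < C3 := expR_gt0 _.
exists (C1 + C2 + C3), c; split; first by rewrite !addr_gt0.
split=> // d Omega P Y Q data QP T u T1 /andP[u0 uT].
set x0 := g * (2 * b - 1) * T.
pose p (y : int) := u < `|y%:~R - x0|.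
have mp := measurable_position T QP.
have T0 : 0 < T := lt_le_trans ltr01 T1.
have Tg0 : 0 < T * g by rewrite mulr_gt0.
set X := u ^+ 3 / (T * g) ^+ 2.
have X0 : 0 <= X by rewrite divr_ge0 // exprn_ge0 // ltW.
have EE c' : expR (- (c' * u ^+ 3) / (T * g) ^+ 2) = expR (- (c' * X)).
  by congr expR; rewrite mulNr -mulrA.
rewrite EE; have E0 : 0 < expR (- (c * X)) := expR_gt0 _.
have Emono c' : c <= c' -> expR (- (c' * X)) <= expR (- (c * X)).
  by move=> cc'; rewrite ler_expR lerN2 ler_wpM2r.
have [u8|u8] := ltP u 8.
  apply: le_trans (probability_le1 P (mp p)) _; rewrite lee_fin.
  have X8 : X <= 512 / g ^+ 2.
    rewrite /X ler_pdivrMr ?exprn_gt0 // mulrAC ler_pdivlMr ?exprn_gt0 //.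
    apply: ler_pM; rewrite ?exprn_ge0 ?(ltW g0) //.
      have -> : 512 = 8 ^+ 3 :> R by ring.
      by apply: lerXn2r; rewrite ?nnegrE // ltW.
    by apply: lerXn2r; rewrite ?nnegrE ?(ltW g0) ?(ltW Tg0) // ler_peMl // ltW.
  have : 1 <= C3 * expR (- (c * X)).
    rewrite /C3 -expRD -[leLHS]expR0 ler_expR subr_ge0 -mulrA ler_wpM2l //; exact: ltW.
  by have := mulr_ge0 (ltW (addr_gt0 C10 C20)) (ltW E0); lra.
(* Positions are integers, so exceeding [x0 + u] is exceeding its floor, and lying below [x0 - u] is
   lying below minus the floor of [u - x0]. *)
pose xi1 := Num.floor (x0 + u); pose xi2 := Num.floor (u - x0).
have f1 : xi1%:~R <= x0 + u < (xi1 + 1)%:~R := floor_itv _.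
have f2 : xi2%:~R <= u - x0 < (xi2 + 1)%:~R := floor_itv _.
rewrite !intrD in f1 f2; have [/andP[f11 f12] /andP[f21 f22]] := (f1, f2).
pose p1 (y : int) := xi1 < y; pose p2 (y : int) := y < - xi2.
have u8T : 8 <= u <= T * g by rewrite u8.
have P1 : (P [set w | p1 (Q T w)] <= (C1 * expR (- (c1 * X)))%:E)%E.
  rewrite -EE; apply: (H1 d Omega P Y Q data QP T u xi1 p1 T1 u8T).
    apply/andP; rewrite (_ : g * _ * T = x0); last by rewrite /x0; ring.
    split; lra.
  move=> N n x h o oN xE xN hR hL wm.
  have pE (s : config * 'I_(N.*2).+1) : p1 (box_pos N s.2) = (x < s.2)%N.
    by rewrite /p1 /box_pos ltrBrDl -xE.
  under [X in avg _ X]funext do under [X in iter _ _ X]funext do rewrite pE.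
  apply: particle_hole_le => //; first by rewrite !ltW.
  by rewrite addrC.
have P2 : (P [set w | p2 (Q T w)] <= (C2 * expR (- (c2 * X)))%:E)%E.
  rewrite -EE; apply: (H2 d Omega P Y Q data QP T u xi2 p2 T1 u8T).
    apply/andP; rewrite (_ : g * _ * T = - x0); last by rewrite /x0; ring.
    split; lra.
  move=> N n x h o oN xE xN hR hL wm.
  have pE (s : config * 'I_(N.*2).+1) : p2 (box_pos N s.2) = (s.2 < N.*2 - x)%N.
    exact: mirror_index.
  under [X in avg _ X]funext do under [X in iter _ _ X]funext do rewrite pE.
  have ro : rev_ord o = o by apply: val_inj; rewrite /= oN subSS -addnn addnK.
  have b01W : 0 <= b <= 1 by rewrite !ltW.
  have := @reflection_le R N.*2 (h * rR) (h * rL) b hR hL b01W _ n o (N.*2 - x) (leq_subr _ _) ro.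
  by rewrite subKn //; apply; rewrite addrC.
have cover : (P [set w | p (Q T w)] <= P ([set w | p1 (Q T w)] `|` [set w | p2 (Q T w)]))%E.
  apply: le_measure; rewrite ?inE; [exact: (mp p)|apply: measurableU; exact: mp|].
  move=> w /=; rewrite /p ltr_normr => /orP[h|h]; [left|right].
    rewrite /p1 -(ltr_int R); lra.
  rewrite /p2 -(ltr_int R) intrN; lra.
apply: le_trans cover _; apply: le_trans (measureU2 _ (mp p1) (mp p2)) _.
apply: le_trans (leeD P1 P2) _; rewrite -EFinD lee_fin.
have h1 := ler_wpM2l (ltW C10) (Emono _ cc1); have h2 := ler_wpM2l (ltW C20) (Emono _ cc2).
have h3 := mulr_ge0 (ltW C30) (ltW E0); lra.
Qed.
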